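(* Let $p$ be a probability density on $\mathbb{R}^d$ such that $\ln p$ is $C^1$, $\nabla\ln p$ is $L$-Lipschitz with $L\ge1$, and $p$ satisfies a log-Sobolev inequality with constant $C_{\mathrm{LS}}\ge1$. Let $s:\mathbb{R}^d\to\mathbb{R}^d$ satisfy, for some $\varepsilon_1\le\sqrt{\frac{1}{48C_{\mathrm{LS}}}}$, $\sup_{x\in\mathbb{R}^d}\|\nabla\ln p(x)-s(x)\|\le\varepsilon_1.$ Let $N\in\mathbb{N}_0$ and $0<h\le\frac{1}{4392\,dC_{\mathrm{LS}}L^2}$. Let $q_{nh}$ be the law of the $n$th iterate of Langevin Monte Carlo with step size $h$ and score estimate $s$, started from $q_0$. Then for every $k$, $$\chi^2(q_{(k+1)h}\|p)\le\exp\Big(-\frac{h}{4C_{\mathrm{LS}}}\Big)\chi^2(q_{kh}\|p)+170\,dL^2h^2+5\varepsilon_1^2h,$$ and $$\chi^2(q_{Nh}\|p)\le\exp\Big(-\frac{Nh}{4C_{\mathrm{LS}}}\Big)\chi^2(q_0\|p)+680\,dL^2hC_{\mathrm{LS}}+20\varepsilon_1^2C_{\mathrm{LS}}\le\exp\Big(-\frac{Nh}{4C_{\mathrm{LS}}}\Big)\chi^2(q_0\|p)+1.$$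
   Context: Langevin Monte Carlo with score estimate $s$ and step size $h$: $x_{(k+1)h}=x_{kh}+h\,s(x_{kh})+\sqrt{2h}\,\xi_{kh}$, $\xi_{kh}\sim N(0,I_d)$ i.i.d. independent of $x_0\sim q_0$. Log-Sobolev inequality with constant $C$: $\mathrm{KL}(q\|p)\le\frac C2\mathbb{E}_q\|\nabla\ln(q/p)\|^2$ for all $q$. $\chi^2(q\|p)=\int q^2/p-1$. *)

(* Defs.v *)
From mathcomp Require Import all_boot all_order all_algebra.
From mathcomp Require Import all_classical all_reals all_analysis.
Import Order.TTheory GRing.Theory Num.Theory.
Import numFieldTopology.Exports numFieldNormedType.Exports.

Set Implicit Arguments.
Unset Strict Implicit.
Unset Printing Implicit Defensive.

Local Open Scope classical_set_scope.
Local Open Scope ring_scope.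

Definition Rd (R : realType) (d : nat) :=
  g_sigma_algebraType (@open 'rV[R]_d).

Definition enorm (R : realType) (d : nat) (x : 'rV[R]_d) : R :=
  Num.sqrt (\sum_(i < d) x ord0 i ^+ 2).

Definition grad (R : realType) (d : nat) (f : 'rV[R]_d -> R) (x : 'rV[R]_d)
  : 'rV[R]_d :=
  \row_(i < d) ('d f x (delta_mx 0 i : 'rV[R]_d)).

(* lam is the Lebesgue measure on (Borel sets of) R^d: it gives every box
   ]a,b] its volume.  (This characterizes it uniquely on Borel sets.) *)
Definition is_lebesgue (R : realType) (d : nat)
    (lam : {measure set (Rd R d) -> \bar R}) : Prop :=
  forall a b : 'rV[R]_d,
    lam [set x : Rd R d | forall i : 'I_d, a ord0 i < (x : 'rV[R]_d) ord0 i <= b ord0 i]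
    = (\prod_(i < d) Num.max 0 (b ord0 i - a ord0 i))%:E.

Definition is_density (R : realType) (d : nat)
    (lam : {measure set (Rd R d) -> \bar R}) (q : Rd R d -> R) : Prop :=
  [/\ measurable_fun setT q, (forall x, 0 <= q x) &
      (\int[lam]_x (q x)%:E = 1)%E].

Definition density_of (R : realType) (d : nat)
    (lam : {measure set (Rd R d) -> \bar R}) (mu : set (Rd R d) -> \bar R)
    (f : Rd R d -> R) : Prop :=
  [/\ measurable_fun setT f, (forall x, 0 <= f x) &
      forall A : set (Rd R d), measurable A ->
        mu A = (\int[lam]_(x in A) (f x)%:E)%E].

(* KL(q || p) for densities q, p (with 0 ln 0 = 0) *)
Definition KL (R : realType) (d : nat) (lam : {measure set (Rd R d) -> \bar R})
    (q p : Rd R d -> R) : \bar R :=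
  (\int[lam]_x (q x * ln (q x / p x))%:E)%E.

Definition fisher (R : realType) (d : nat) (lam : {measure set (Rd R d) -> \bar R})
    (q p : Rd R d -> R) : \bar R :=
  (\int[lam]_x (q x * enorm (grad (fun y : 'rV[R]_d => ln (q y / p y)) x) ^+ 2)%:E)%E.

(* Log-Sobolev inequality with constant C for the density p:
   KL(q||p) <= C/2 E_q ||grad ln(q/p)||^2 for every probability density q
   for which the right-hand side makes sense (q positive, ln(q/p) differentiable). *)
Definition LSI (R : realType) (d : nat) (lam : {measure set (Rd R d) -> \bar R})
    (C : R) (p : Rd R d -> R) : Prop :=
  forall q : Rd R d -> R, is_density lam q -> (forall x, 0 < q x) ->
    (forall x : 'rV[R]_d, differentiable (fun y : 'rV[R]_d => ln (q y / p y)) x) ->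
    (KL lam q p <= (C / 2)%:E * fisher lam q p)%E.

Definition chi2 (R : realType) (d : nat) (lam : {measure set (Rd R d) -> \bar R})
    (q p : Rd R d -> R) : \bar R :=
  (\int[lam]_x ((q x) ^+ 2 / p x)%:E - 1)%E.

(* chi^2(mu || p) for a (probability) measure mu: computed with a density of
   mu w.r.t. lam if one exists, +oo otherwise (mu not absolutely continuous). *)
Definition chi2_law (R : realType) (d : nat) (lam : {measure set (Rd R d) -> \bar R})
    (mu : set (Rd R d) -> \bar R) (p : Rd R d -> R) : \bar R :=
  match pselect (exists f, density_of lam mu f) with
  | left H => chi2 lam (proj1_sig (cid H)) p
  | right _ => +oo%E
  end.

Definition gauss_density (R : realType) (d : nat) (x : Rd R d) : R :=
  expR (- (enorm (x : 'rV[R]_d) ^+ 2) / 2) / (Num.sqrt (2 * pi)) ^+ d.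

Definition mutually_independent (R : realType) (d : nat)
    (d0 : measure_display) (T : measurableType d0) (P : probability T R)
    (I : eqType) (Y : I -> T -> Rd R d) : Prop :=
  forall (J : seq I) (A : I -> set (Rd R d)), uniq J ->
    (forall i, measurable (A i)) ->
    P (\bigcap_(i in [set` J]) (Y i @^-1` A i)) =
      (\prod_(i <- J) fine (P (Y i @^-1` A i)))%:E.

Fixpoint LMC (R : realType) (d : nat) (T : Type) (h : R)
    (s : Rd R d -> Rd R d) (x0 : T -> Rd R d) (xi : nat -> T -> Rd R d)
    (k : nat) : T -> Rd R d :=
  match k with
  | 0 => x0
  | k'.+1 => fun w =>
      let x := LMC h s x0 xi k' w in
      ((x : 'rV[R]_d) + h *: (s x : 'rV[R]_d)
        + Num.sqrt (2 * h) *: (xi k' w : 'rV[R]_d) : Rd R d)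
  end.

(* Main.v *)
Require Import Defs.
From HB Require Import structures.
From mathcomp Require Import all_boot all_order all_algebra.
From mathcomp Require Import all_classical all_reals all_analysis.
From mathcomp Require Import measurable_realfun lra ring.
Import Order.TTheory GRing.Theory Num.Theory.
Import numFieldTopology.Exports numFieldNormedType.Exports.
Set Implicit Arguments.
Unset Strict Implicit.
Unset Printing Implicit Defensive.
Local Open Scope classical_set_scope.
Local Open Scope ring_scope.

(** For one step, freeze the drift at [X] and interpolate: [q_t] is the density of
    [X + t s(X) + sqrt(2t) xi].  With [phi = q_t / p], [Z(t) = int q_t^2 / p] and
    [D(t) = int p |grad phi|^2], integration by parts gives
    [Z' <= - D + int phi E[G_t |grad ln p(y) - s(X)|^2]], where the last term is
    absorbed, up to [O(eps^2 + d L^2 t) Z], by Cauchy-Schwarz and the Lipschitz bound.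
    The log-Sobolev inequality for the density [phi^2 p / Z] yields [Z - 1 <= 2 C D],
    so [Z - 1] contracts at rate [1 / (4 C)] by Gronwall's argument.
    The differential inequality is proved for [X] truncated to a ball, on [[s, h]] with
    [s > 0]; the limit [s -> 0] uses [Z(s) <= exp (kap sqrt s) int f^2 / p], a weighted
    Cauchy-Schwarz inequality, and the truncation is removed by monotone convergence.
    Independence of the iterate and the next noise identifies [q_h] as the density of
    the next iterate. *)

(** Freezing the drift turns every object into an average over [w] of explicit Gaussians, so no
    conditional expectation has to be constructed. The main obstacle is integrability. The energy
    divides by [p], whose inverse may grow like [exp (2 L |y|^2)], so each product must keep
    Gaussian decay. Truncation bounds the position and the drift, a positive initial time bounds the
    kernel, and the smallness of [L h] keeps the kernel narrower than the growth of [p^-1]. The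
    error term also contains the second moments of the displacement and of the score under [phi q],
    on which nothing is assumed. Both are recovered from [Z] and [D]: integration by parts gives a
    displacement moment of order [d t Z + t^2 D], and [q g = grad q - p grad phi] transfers this
    bound to the score. The initial density only has [f^2 / p] integrable, so the energy cannot be
    differentiated at time 0. The truncation radius enters the resulting inequality only through
    [kap], hence disappears as [s -> 0], before the radius tends to infinity. *)

(** * Borel sets of R^d and uniqueness of measures on boxes *)

Section borel.
Context {R : realType} {d : nat}.
Implicit Types (a b x : 'rV[R]_d).

Definition box a b : set (Rd R d) :=
  [set x : Rd R d | forall i : 'I_d, a ord0 i < (x : 'rV[R]_d) ord0 i <= b ord0 i].

Lemma measurable_fun_continuous (f : 'rV[R]_d -> R) :
  continuous f -> measurable_fun [set: Rd R d] f.
Proof.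
move=> cf; apply: (measurability _ (RGenOInfty.measurableE R)).
move=> _ [_ [a ->] <-]; rewrite setTI.
apply: sub_sigma_algebra.
by move/continuousP : cf; apply; exact: interval_open.
Qed.

Lemma measurable_coord (i : 'I_d) :
  measurable_fun [set: Rd R d] (fun x : Rd R d => (x : 'rV[R]_d) ord0 i).
Proof. exact: (measurable_fun_continuous (@coord_continuous R 1 d ord0 i)). Qed.

(** Rational corners make the union countable, so measurability passes from half-open boxes to all
    open sets. Balls of the matrix norm are cubes, hence corners can be chosen coordinate by
    coordinate. *)
Lemma open_bigcup_box (U : set 'rV[R]_d) : open U ->
  U = \bigcup_(ab in [set ab : 'rV[rat]_d * 'rV[rat]_d |
        box (map_mx ratr ab.1) (map_mx ratr ab.2) `<=` U])
      box (map_mx ratr ab.1) (map_mx ratr ab.2).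
Proof.
move=> oU; apply/seteqP; split=> [x Ux|x [ab /=]]; last exact.
have /nbhs_ballP[e /= e0 xeU] : nbhs x U by exact: open_nbhs_nbhs.
have ha i : exists r : rat, x ord0 i - e < ratr r < x ord0 i.
  have /rat_in_itvoo[r] : x ord0 i - e < x ord0 i by rewrite gtrBl.
  by rewrite in_itv /= => ?; exists r.
have hb i : exists r : rat, x ord0 i < ratr r < x ord0 i + e.
  have /rat_in_itvoo[r] : x ord0 i < x ord0 i + e by rewrite ltrDl.
  by rewrite in_itv /= => ?; exists r.
have [fa fap] := choice ha; have [fb fbp] := choice hb.
exists (\row_i fa i, \row_i fb i) => /=.
- move=> z bz; apply: xeU; split => // i j; rewrite (ord1 i) /ball /=.
  have := bz j; rewrite !mxE => /andP[z1 z2].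
  have /andP[] := fap j; have /andP[] := fbp j => ? ? ? ?.
  by rewrite ltr_norml; apply/andP; split; lra.
- move=> i; rewrite !mxE.
  by have /andP[_ ->] := fap i; have /andP[/ltW -> _] := fbp i.
Qed.

Lemma measurable_Rd_coord (d1 : measure_display) (T : measurableType d1)
    (f : T -> Rd R d) :
  (forall i, measurable_fun setT (fun w => (f w : 'rV[R]_d) ord0 i)) ->
  measurable_fun setT f.
Proof.
move=> mf; apply: (@measurability _ _ T (Rd R d) setT f (@open 'rV[R]_d) erefl).
move=> _ [U oU <-]; rewrite setTI (open_bigcup_box oU) preimage_bigcup.
rewrite bigcup_mkcond; apply: countable_bigcupT_measurable => [//|ab].
case: ifPn => // _.
have -> : f @^-1` box (map_mx ratr ab.1) (map_mx ratr ab.2) =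
   \bigcap_(i in [set: 'I_d]) ((fun w => (f w : 'rV[R]_d) ord0 i) @^-1`
      `](map_mx ratr ab.1 ord0 i), (map_mx ratr ab.2 ord0 i)]%classic).
  apply/seteqP; split => w /= H i; first by move=> _; rewrite /= in_itv /= H.
  by have := H i I; rewrite /= in_itv.
apply: fin_bigcap_measurable => // i _.
by rewrite -[X in measurable X]setTI; exact: mf.
Qed.

Lemma box_measurable a b : measurable (box a b).
Proof.
have -> : box a b =
   \bigcap_(i in [set: 'I_d]) ((fun w : Rd R d => (w : 'rV[R]_d) ord0 i) @^-1`
      `](a ord0 i), (b ord0 i)]%classic).
  apply/seteqP; split => w /= H i; first by move=> _; rewrite /= in_itv /= H.
  by have := H i I; rewrite /= in_itv.
apply: fin_bigcap_measurable => // i _.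
by rewrite -[X in measurable X]setTI; exact: measurable_coord.
Qed.

Definition boxes : set (set (Rd R d)) := [set box ab.1 ab.2 | ab in [set: 'rV[R]_d * 'rV[R]_d]].

Lemma measurable_boxes : @measurable _ (Rd R d) = <<s boxes >>.
Proof.
apply/seteqP; split; last first.
  apply: smallest_sub; first exact: sigma_algebra_measurable.
  by move=> _ [[a b] _ <-]; exact: box_measurable.
apply: smallest_sub; first exact: smallest_sigma_algebra.
move=> U oU; rewrite (open_bigcup_box oU) bigcup_mkcond.
apply: (@countable_bigcupT_measurable _ (g_sigma_algebraType boxes)) => [//|ab].
case: ifPn => _; last exact: measurable0.
apply: sub_sigma_algebra; exists (map_mx ratr ab.1, map_mx ratr ab.2) => //.
Qed.

Lemma boxes_setI_closed : setI_closed boxes.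
Proof.
move=> _ _ [[a b] _ <-] [[a' b'] _ <-] /=.
exists (\row_i Num.max (a ord0 i) (a' ord0 i), \row_i Num.min (b ord0 i) (b' ord0 i)) => //.
apply/seteqP; split => x /=; rewrite /box /=.
  by move=> H; split=> i; have := H i; rewrite !mxE gt_max le_min;
    move=> /andP[/andP[? ?] /andP[? ?]]; apply/andP.
by move=> [H1 H2] i; rewrite !mxE gt_max le_min; have /andP[-> ->] := H1 i; have /andP[-> ->] := H2 i.
Qed.

Lemma bigcup_box : \bigcup_k box (const_mx (- k%:R)) (const_mx k%:R) = [set: Rd R d].
Proof.
rewrite -subTset => x _.
have [M HM] : exists M : R, forall i, `|(x : 'rV[R]_d) ord0 i| <= M.
  exists (mx_norm (x : 'rV[R]_d)) => i.
  by rewrite mx_normrE; apply/bigmax_geP; right => /=; exists (ord0, i).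
exists (Num.truncn `|M|).+1 => // i; rewrite !mxE.
have := truncnS_gt `|M|; have := HM i; have := ler_norm M.
by rewrite ler_norml => ? /andP[? ?] ?; apply/andP; split; lra.
Qed.

(** Boxes form a pi-system that generates the Borel sets and is exhausted by cubes of finite
    measure. As [is_lebesgue] prescribes only volumes of boxes, the behaviour of [lam] under affine
    maps is derived from this. *)
Lemma measure_unique_box (m1 m2 : {measure set (Rd R d) -> \bar R}) :
  (forall a b, m1 (box a b) = m2 (box a b)) ->
  (forall a b, (m1 (box a b) < +oo)%E) ->
  forall A, measurable A -> m1 A = m2 A.
Proof.
move=> m12 m1fin A mA.
apply: (measure_unique boxes (fun k => box (const_mx (- k%:R)) (const_mx k%:R))) => //.
- exact: measurable_boxes.
- exact: boxes_setI_closed.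
- by move=> k; exists (const_mx (- k%:R), const_mx k%:R).
- exact: bigcup_box.
- by move=> _ [[a b] _ <-].
Qed.

End borel.

(** * Lebesgue measure under affine maps *)

Section lebesgue.
Context {R : realType} {d : nat}.
Variable lam : {measure set (Rd R d) -> \bar R}.
Hypothesis lamP : is_lebesgue lam.

Lemma lebesgue_boxE a b :
  lam (box a b) = (\prod_(i < d) Num.max 0 (b ord0 i - a ord0 i))%:E.
Proof. exact: lamP. Qed.

Lemma lebesgue_sigma_finite : sigma_finite setT lam.
Proof.
exists (fun k => box (const_mx (- k%:R)) (const_mx k%:R)); first by rewrite bigcup_box.
by move=> k; split; [exact: box_measurable|rewrite lebesgue_boxE ltry].
Qed.

Definition affine_map (c : R) (w : 'rV[R]_d) : Rd R d -> Rd R d :=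
  fun y => c *: (y : 'rV[R]_d) + w.

Lemma measurable_affine_map c w : measurable_fun setT (affine_map c w).
Proof.
apply: measurable_Rd_coord => i; rewrite /affine_map.
under eq_fun do rewrite !mxE.
apply: measurable_funD => //; apply: measurable_funM => //.
exact: measurable_coord.
Qed.

Lemma affine_map_preimage_box c w a b : 0 < c ->
  affine_map c w @^-1` box a b = box (c^-1 *: (a - w)) (c^-1 *: (b - w)).
Proof.
move=> c0; apply/seteqP; split => y /= H i; have := H i; rewrite /affine_map !mxE.
  by rewrite -ltrBlDr -lerBrDr ltr_pdivrMl// ler_pdivlMl.
by rewrite -ltrBlDr -lerBrDr ltr_pdivrMl// ler_pdivlMl.
Qed.

(** The pushforward of [lam] and the rescaled [lam] are both measures, so it suffices to compare
    them on boxes, whose preimages are again boxes because [0 < c]. *)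
Lemma lebesgue_affine c w (A : set (Rd R d)) : 0 < c -> measurable A ->
  lam (affine_map c w @^-1` A) = ((c ^+ d)^-1%:E * lam A)%E.
Proof.
move=> c0 mA.
have cd0 : 0 <= (c ^+ d)^-1 by rewrite invr_ge0 exprn_ge0// ltW.
have mf := measurable_affine_map c w.
pose m1 : {measure set (Rd R d) -> \bar R} := mscale (NngNum cd0) lam.
pose m2 : {measure set (Rd R d) -> \bar R} :=
  @measure_function_pushforward__canonical__measure_function_Measure _ _ _ _ R lam
    (affine_map c w) mf.
suff : m1 A = m2 A by move=> /esym; exact.
apply: measure_unique_box => //.
- move=> a b; rewrite -[RHS]/(lam (affine_map c w @^-1` box a b)) affine_map_preimage_box//.
  rewrite -[LHS]/((c ^+ d)^-1%:E * lam (box a b))%E.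
  rewrite !lebesgue_boxE -EFinM; congr (_%:E).
  rewrite -exprVn -[X in _ ^+ X]card_ord -prodr_const -big_split /=.
  apply: eq_bigr => i _; rewrite !mxE -mulrBr maxr_pMr ?invr_ge0 ?ltW// mulr0.
  by congr (Num.max _ (_ * _)); ring.
- move=> a b; rewrite -[X in (X < _)%E]/((c ^+ d)^-1%:E * lam (box a b))%E.
  by rewrite lebesgue_boxE -EFinM ltry.
Qed.

Lemma ge0_integral_affine c w (f : Rd R d -> \bar R) : 0 < c ->
  measurable_fun setT f -> (forall y, (0 <= f y)%E) ->
  (\int[lam]_y f (affine_map c w y) = (c ^+ d)^-1%:E * \int[lam]_y f y)%E.
Proof.
move=> c0 mf f0.
have cd0 : 0 <= (c ^+ d)^-1 by rewrite invr_ge0 exprn_ge0// ltW.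
have mg := measurable_affine_map c w.
pose m1 : {measure set (Rd R d) -> \bar R} := mscale (NngNum cd0) lam.
pose m2 : {measure set (Rd R d) -> \bar R} :=
  @measure_function_pushforward__canonical__measure_function_Measure _ _ _ _ R lam
    (affine_map c w) mg.
have := @ge0_integral_pushforward _ _ _ _ R (affine_map c w) mg lam setT f measurableT mf.
rewrite preimage_setT => <- //.
rewrite -(@ge0_integral_mscale _ _ _ lam setT measurableT (NngNum cd0))//.
rewrite -[LHS]/(\int[m2]_y f y)%E -[RHS]/(\int[m1]_y f y)%E.
apply: eq_measure_integral => A mA _.
exact: lebesgue_affine.
Qed.

(** Positive and negative parts are translated separately, each by the affine change of variables
    with ratio 1. *)
Lemma integral_translation (w : 'rV[R]_d) (f : Rd R d -> \bar R) :
  measurable_fun setT f ->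
  (\int[lam]_y f ((y : 'rV[R]_d) + w)%R = \int[lam]_y f y)%E.
Proof.
move=> mf; have mg := measurable_affine_map 1 w.
have e (g : Rd R d -> \bar R) : measurable_fun setT g -> (forall y, (0 <= g y)%E) ->
  (\int[lam]_y g ((y : 'rV[R]_d) + w)%R = \int[lam]_y g y)%E.
  move=> mg' g0; rewrite -[RHS]mul1e -[X in (X%:E * _)%E]invr1 -(expr1n _ d).
  rewrite -(@ge0_integral_affine 1 w)//.
  by under [RHS]eq_integral do rewrite /affine_map scale1r.
rewrite integralE [RHS]integralE; congr (_ - _)%E.
  rewrite -[RHS](e _ (measurable_funepos mf)).
    by apply: eq_integral => y _; rewrite !funeposE.
  by move=> y; exact: funepos_ge0.
rewrite -[RHS](e _ (measurable_funeneg mf)).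
  by apply: eq_integral => y _; rewrite !funenegE.
by move=> y; exact: funeneg_ge0.
Qed.

End lebesgue.

(** * Euclidean inner product and norm on row vectors *)

Section euclidean.
Context {R : realType} {d : nat}.
Implicit Types u v w : 'rV[R]_d.

Definition dot u v : R := \sum_(i < d) u ord0 i * v ord0 i.
Definition sqn u : R := dot u u.
Definition evec (i : 'I_d) : 'rV[R]_d := delta_mx 0 i.

Lemma dotC u v : dot u v = dot v u.
Proof. by apply: eq_bigr => i _; rewrite mulrC. Qed.

Lemma dotDl u v w : dot (u + v) w = dot u w + dot v w.
Proof. by rewrite -big_split; apply: eq_bigr => i _; rewrite mxE mulrDl. Qed.

Lemma dotZl c u v : dot (c *: u) v = c * dot u v.
Proof. by rewrite /dot mulr_sumr; apply: eq_bigr => i _; rewrite mxE mulrA. Qed.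

Lemma dotDr u v w : dot u (v + w) = dot u v + dot u w.
Proof. by rewrite dotC dotDl !(dotC u). Qed.

Lemma dotZr c u v : dot u (c *: v) = c * dot u v.
Proof. by rewrite dotC dotZl dotC. Qed.

Lemma dotNl u v : dot (- u) v = - dot u v.
Proof. by rewrite -scaleN1r dotZl mulN1r. Qed.

Lemma dotNr u v : dot u (- v) = - dot u v.
Proof. by rewrite dotC dotNl dotC. Qed.

Lemma dot_evec u i : dot u (evec i) = u ord0 i.
Proof.
rewrite /dot (bigD1 i)//= big1 ?addr0 => [|j ji]; rewrite mxE eqxx /=.
  by rewrite ?eqxx mulr1.
by rewrite (negbTE ji) mulr0.
Qed.

Lemma sqn_ge0 u : 0 <= sqn u.
Proof. by apply: sumr_ge0 => i _; rewrite -expr2 sqr_ge0. Qed.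

Lemma sqnD u v : sqn (u + v) = sqn u + 2 * dot u v + sqn v.
Proof. by rewrite /sqn dotDl !dotDr (dotC v u); ring. Qed.

Lemma sqnZ c u : sqn (c *: u) = c ^+ 2 * sqn u.
Proof. by rewrite /sqn dotZl dotZr; ring. Qed.

Lemma sqnN u : sqn (- u) = sqn u.
Proof. by rewrite /sqn dotNl dotNr opprK. Qed.

Lemma sqnB u v : sqn (u - v) = sqn u - 2 * dot u v + sqn v.
Proof. by rewrite sqnD sqnN dotNr; ring. Qed.

Lemma sqn_evec i : sqn (evec i) = 1.
Proof. by rewrite /sqn dot_evec mxE !eqxx. Qed.

Lemma sqn_eq0 u : sqn u = 0 -> u = 0.
Proof.
move=> /eqP; rewrite psumr_eq0; last by move=> i _; rewrite -expr2 sqr_ge0.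
move=> /allP H; apply/rowP => i; rewrite mxE; apply/eqP.
by have := H i (mem_index_enum i); rewrite -expr2 sqrf_eq0.
Qed.

Lemma enormE u : enorm u = Num.sqrt (sqn u).
Proof. by congr Num.sqrt; apply: eq_bigr => i _; rewrite expr2. Qed.

Lemma enorm_ge0 u : 0 <= enorm u. Proof. by rewrite sqrtr_ge0. Qed.

Lemma enorm_sqr u : enorm u ^+ 2 = sqn u.
Proof. by rewrite enormE sqr_sqrtr// sqn_ge0. Qed.

Lemma cauchy_schwarz_sqr u v : dot u v ^+ 2 <= sqn u * sqn v.
Proof.
have [v0|v0] := eqVneq (sqn v) 0.
  have -> : dot u v = 0.
    by rewrite (sqn_eq0 v0) /dot big1// => i _; rewrite mxE mulr0.
  by rewrite v0 mulr0 expr0n.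
have v1 : 0 < sqn v by rewrite lt_neqAle eq_sym v0 sqn_ge0.
have := sqn_ge0 (sqn v *: u - dot u v *: v).
rewrite sqnB !sqnZ dotZl dotZr.
have -> : sqn v ^+ 2 * sqn u - 2 * (sqn v * (dot u v * dot u v)) +
    dot u v ^+ 2 * sqn v = sqn v * (sqn u * sqn v - dot u v ^+ 2) by ring.
by rewrite pmulr_rge0// subr_ge0.
Qed.

Lemma cauchy_schwarz u v : `|dot u v| <= enorm u * enorm v.
Proof.
rewrite -(@ler_pXn2r _ 2)// ?nnegrE ?mulr_ge0 ?enorm_ge0//.
by rewrite exprMn !enorm_sqr real_normK ?num_real// cauchy_schwarz_sqr.
Qed.

Lemma enormD u v : enorm (u + v) <= enorm u + enorm v.
Proof.
rewrite -(@ler_pXn2r _ 2)// ?nnegrE ?addr_ge0 ?enorm_ge0//.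
rewrite enorm_sqr sqnD sqrrD !enorm_sqr.
have := cauchy_schwarz u v; have := ler_norm (dot u v).
lra.
Qed.

Lemma enormZ c u : enorm (c *: u) = `|c| * enorm u.
Proof. by rewrite !enormE sqnZ sqrtrM ?sqr_ge0// sqrtr_sqr. Qed.

Lemma enormN u : enorm (- u) = enorm u.
Proof. by rewrite !enormE sqnN. Qed.

Lemma enormB u v : enorm (u - v) = enorm (v - u).
Proof. by rewrite -enormN opprB. Qed.

Lemma coord_le_enorm u i : `|u ord0 i| <= enorm u.
Proof.
have := cauchy_schwarz u (evec i).
by rewrite dot_evec (enormE (evec i)) sqn_evec sqrtr1 mulr1.
Qed.

(** Expand [0 <= |u + 2 v|^2]. A Gaussian recentred by a bounded vector is thus dominated by a
    centred one of half the rate. *)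
Lemma sqn_shift_ge u v : sqn (u + v) >= sqn u / 2 - sqn v.
Proof.
have := sqn_ge0 (u + 2 *: v); rewrite !sqnD dotZr sqnZ; lra.
Qed.

(** Combines [n <= 1 + L n^2] with [1 + x <= exp x]. Linear factors then count as Gaussian growth of
    rate [L], which keeps the bookkeeping of growth additive. *)
Lemma enorm_le_expR (L : R) u : 1 <= L -> enorm u <= expR (L * sqn u).
Proof.
move=> L1; have := expR_ge1Dx (L * sqn u); rewrite -enorm_sqr => H.
apply: le_trans H; have L0 : 0 <= L - 1 by lra.
have := mulr_ge0 L0 (sqr_ge0 (enorm u)); have := sqr_ge0 (enorm u - 1).
have := enorm_ge0 u; nra.
Qed.

Lemma sqn_le_mx_norm u : sqn u <= d%:R * `|u| ^+ 2.
Proof.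
rewrite -[d in d%:R]card_ord mulr_natl -sumr_const; apply: ler_sum => i _.
rewrite -expr2 -(real_normK (num_real (u ord0 i))) lerXn2r ?nnegrE//.
rewrite /Num.Def.normr /= mx_normrE.
by apply/bigmax_geP; right => /=; exists (ord0, i).
Qed.

Lemma dot_continuous u : continuous (dot u).
Proof.
apply: (@continuous_big R 'I_d +%R 0 xpredT add_continuous _ (index_enum _)
  (fun i v => u ord0 i * v ord0 i)) => i _.
by move=> x; apply: continuousM; [exact: cst_continuous|exact: coord_continuous].
Qed.

Lemma sqn_continuous : continuous sqn.
Proof.
apply: (@continuous_big R 'I_d +%R 0 xpredT add_continuous _ (index_enum _)
  (fun i v => v ord0 i * v ord0 i)) => i _.
by move=> x; apply: continuousM; exact: coord_continuous.
Qed.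

End euclidean.

(** * Domination by Gaussian growth or decay *)

Section dominated.
Context {R : realType} {d : nat} {U : Type}.
Implicit Types (B : set U) (f g : U -> 'rV[R]_d -> R).

(* [k] may have any sign: Gaussian decay for [k < 0], Gaussian growth for [k > 0]. *)
Definition dom B (k : R) f := exists M, forall u y, B u -> `|f u y| <= M * expR (k * sqn y).

Lemma dom_ge0 B k f : dom B k f ->
  exists2 M, 0 <= M & forall u y, B u -> `|f u y| <= M * expR (k * sqn y).
Proof.
move=> [M HM]; exists `|M| => // u y Bu; apply: le_trans (HM u y Bu) _.
by rewrite ler_pM2r ?expR_gt0// ler_norm.
Qed.

Lemma dom_le k1 B k2 f : dom B k1 f -> k1 <= k2 -> dom B k2 f.
Proof.
move=> /dom_ge0[M M0 HM] k12; exists M => u y Bu; apply: le_trans (HM u y Bu) _.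
by rewrite ler_wpM2l// ler_expR ler_wpM2r// sqn_ge0.
Qed.

(** Rates add under products, so the integrability of a product of several factors reduces to a
    linear inequality between rates. *)
Lemma domM k1 k2 B k f g : dom B k1 f -> dom B k2 g -> k1 + k2 <= k ->
  dom B k (fun u y => f u y * g u y).
Proof.
move=> /dom_ge0[M M0 HM] /dom_ge0[N N0 HN] k12; apply: dom_le k12.
exists (M * N) => u y Bu; rewrite normrM mulrDl expRD mulrACA.
by rewrite ler_pM// ?HM ?HN.
Qed.

Lemma domD B k f g : dom B k f -> dom B k g -> dom B k (fun u y => f u y + g u y).
Proof.
move=> [M HM] [N HN]; exists (M + N) => u y Bu.
by rewrite mulrDl (le_trans (ler_normD _ _))// lerD ?HM ?HN.
Qed.

Lemma domN B k f : dom B k f -> dom B k (fun u y => - f u y).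
Proof. by move=> [M HM]; exists M => u y Bu; rewrite normrN HM. Qed.

Lemma domB B k f g : dom B k f -> dom B k g -> dom B k (fun u y => f u y - g u y).
Proof. by move=> df dg; apply: domD => //; exact: domN. Qed.

Lemma dom_bounded B (c : U -> R) M : (forall u, B u -> `|c u| <= M) ->
  dom B 0 (fun u _ => c u).
Proof. by move=> HM; exists M => u y Bu; rewrite mul0r expR0 mulr1 HM. Qed.

Lemma domZ B k c f : dom B k f -> dom B k (fun u y => c * f u y).
Proof.
move=> df; apply: (domM (k1 := 0) _ df); last by rewrite add0r.
by exists `|c| => u y _; rewrite mul0r expR0 mulr1.
Qed.

Lemma dom_sum B k (F : 'I_d -> U -> 'rV[R]_d -> R) : (forall i, dom B k (F i)) ->
  dom B k (fun u y => \sum_(i < d) F i u y).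
Proof.
move=> H; have [M HM] := choice H; exists (\sum_i M i) => u y Bu.
rewrite mulr_suml (le_trans (ler_norm_sum _ _ _))//.
by apply: ler_sum => i _; exact: HM.
Qed.

Lemma dom_ler B k f g : dom B k g -> (forall u y, B u -> `|f u y| <= `|g u y|) -> dom B k f.
Proof. by move=> [M HM] fg; exists M => u y Bu; rewrite (le_trans (fg _ _ Bu))// HM. Qed.

End dominated.

(** A one-point parameter set turns a single function into a constant family, so that the rules
    above apply to it. *)
Definition dom1 {R : realType} {d : nat} (k : R) (f : 'rV[R]_d -> R) :=
  dom [set: unit] k (fun _ => f).

(** * Gaussian integrals and integration by parts *)

Section gaussian.
Context {R : realType} {d : nat}.
Variable lam : {measure set (Rd R d) -> \bar R}.
Hypothesis lamP : is_lebesgue lam.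
Hypothesis gaussP : (\int[lam]_x (gauss_density x)%:E = 1)%E.

Lemma measurable_sqn : measurable_fun [set: Rd R d] (fun y : Rd R d => sqn (y : 'rV[R]_d)).
Proof. exact: (measurable_fun_continuous sqn_continuous). Qed.

Lemma measurable_sqn_shift (m : 'rV[R]_d) :
  measurable_fun [set: Rd R d] (fun y : Rd R d => sqn ((y : 'rV[R]_d) - m)).
Proof.
have -> : (fun y : Rd R d => sqn ((y : 'rV[R]_d) - m)) = sqn \o affine_map 1 (- m).
  by apply/funext => y; rewrite /= /affine_map scale1r.
exact: (measurableT_comp measurable_sqn (measurable_affine_map _ _)).
Qed.

Lemma measurable_expR_sqn k :
  measurable_fun [set: Rd R d] (fun y : Rd R d => expR (k * sqn (y : 'rV[R]_d))).
Proof.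
apply: measurableT_comp => //; apply: measurable_funM => //; exact: measurable_sqn.
Qed.

(** The normalization [gaussP] replaces the classical computation, and only a dilation by
    [Num.sqrt (2 * k)] is left. In the end [gaussP] is supplied by the law of the noise. *)
Lemma gaussian_integral (k : R) : 0 < k ->
  (\int[lam]_y (expR (- k * sqn (y : 'rV[R]_d)))%:E =
   ((Num.sqrt (2 * pi) / Num.sqrt (2 * k)) ^+ d)%:E)%E.
Proof.
move=> k0; have c0 : 0 < Num.sqrt (2 * k) by rewrite sqrtr_gt0 mulr_gt0.
have s0 : 0 < Num.sqrt (2 * pi) :> R by rewrite sqrtr_gt0 mulr_gt0// pi_gt0.
have mgd : measurable_fun [set: Rd R d] (fun y : Rd R d => (gauss_density y)%:E).
  apply/measurable_EFinP; rewrite /gauss_density.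
  under eq_fun do rewrite enorm_sqr.
  apply: measurable_funM => //; apply: measurableT_comp => //.
  apply: measurable_funM => //; apply: measurableT_comp => //; exact: measurable_sqn.
have gd0 (y : Rd R d) : (0 <= (gauss_density y)%:E)%E.
  by rewrite lee_fin divr_ge0 ?expR_ge0// exprn_ge0// ltW.
have := ge0_integral_affine lamP 0 c0 mgd gd0; rewrite gaussP mule1 => e.
transitivity (\int[lam]_y ((Num.sqrt (2 * pi) ^+ d)%:E *
    (gauss_density (affine_map (Num.sqrt (2 * k)) 0 y))%:E))%E.
  apply: eq_integral => y _; rewrite -EFinM; congr (_%:E).
  rewrite /gauss_density /affine_map addr0 enorm_sqr sqnZ sqr_sqrtr; last by rewrite mulr_ge0 ?ltW.
  rewrite [RHS]mulrC divfK ?lt0r_neq0 ?exprn_gt0//; congr expR; by field.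
rewrite ge0_integralZl//=.
- by rewrite e -EFinM exprMn exprVn.
- exact: (measurableT_comp mgd (measurable_affine_map _ _)).
Qed.

Lemma integrable_expR_sqn (k : R) : k < 0 ->
  lam.-integrable setT (fun y : Rd R d => (expR (k * sqn (y : 'rV[R]_d)))%:E).
Proof.
move=> k0; apply/integrableP; split.
  by apply/measurable_EFinP; exact: measurable_expR_sqn.
under eq_integral do rewrite gee0_abs ?lee_fin ?expR_ge0//.
have := @gaussian_integral (- k); rewrite opprK oppr_gt0 => -> //.
by rewrite ltry.
Qed.

Lemma integrable_dom1 (k : R) (f : 'rV[R]_d -> R) : k < 0 ->
  measurable_fun [set: Rd R d] f -> dom1 k f ->
  lam.-integrable [set: Rd R d] (EFin \o f).
Proof.
move=> k0 mf /dom_ge0[M M0 HM].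
apply: (@le_integrable _ _ _ lam setT _ _ (fun y : Rd R d => (M * expR (k * sqn (y : 'rV[R]_d)))%:E)) => //.
- exact/measurable_EFinP.
- move=> y _ /=; rewrite lee_fin [leRHS]ger0_norm; first exact: (HM tt).
  by rewrite mulr_ge0 ?expR_ge0.
- by under eq_fun do rewrite EFinM; apply: integrableZl => //; exact: integrable_expR_sqn.
Qed.

Section integration_by_parts.

(** Differentiation under the integral requires a bound that is uniform along a segment; its price
    is half of the decay rate. *)
Lemma dom1_shift (k : R) (f : 'rV[R]_d -> R) (v : 'rV[R]_d) : k < 0 -> dom1 k f ->
  exists2 M, 0 <= M & forall r y, `|r| <= 1 -> `|f (y + r *: v)| <= M * expR (k / 2 * sqn y).
Proof.
move=> k0 /dom_ge0[M M0 HM]; exists (M * expR (- k * sqn v)).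
  by rewrite mulr_ge0 ?expR_ge0.
move=> r y r1; apply: le_trans (HM tt _ I) _.
rewrite -mulrA ler_wpM2l// -expRD ler_expR.
have := sqn_shift_ge y (r *: v); rewrite sqnZ.
have : r ^+ 2 <= 1 by rewrite -real_normK ?num_real// expr_le1.
have := sqn_ge0 v; have := sqn_ge0 y.
move: (sqn (y + _)) (sqn y) (sqn v) (r ^+ 2) => a b c e b0 c0 e1 H.
have H1 : 0 <= (- k * c) * (1 - e).
  by apply: mulr_ge0; [apply: mulr_ge0; lra|lra].
have H2 : 0 <= - k * (a - (b / 2 - e * c)) by apply: mulr_ge0; lra.
nra.
Qed.

(** By translation invariance the integral of [w (y + r v)] does not depend on [r]; differentiating
    under the integral at [r = 0] gives the claim. Applied to a product [w], this is integration by
    parts without boundary terms. *)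
Lemma integral_partial_eq0 (k : R) (v : 'rV[R]_d) (w w' : 'rV[R]_d -> R) : k < 0 ->
  measurable_fun [set: Rd R d] w -> measurable_fun [set: Rd R d] w' ->
  (forall y, is_derive (0 : R) (1 : R) (fun r => w (y + r *: v)) (w' y)) ->
  dom1 k w -> dom1 k w' -> \int[lam]_y w' y = 0.
Proof.
move=> k0 mw mw' dw domw domw'.
have k20 : k / 2 < 0 by lra.
have [M M0 HM] := dom1_shift v k0 domw.
have [M' M'0 HM'] := dom1_shift v k0 domw'.
pose f (r : R) (y : Rd R d) := w ((y : 'rV[R]_d) + r *: v).
have mshift (r : R) : measurable_fun [set: Rd R d] (f r).
  have -> : f r = w \o (affine_map 1 (r *: v)).
    by apply/funext => y; rewrite /f /= /affine_map scale1r.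
  by apply: measurableT_comp => //; exact: measurable_affine_map.
have df r y : is_derive r (1 : R) (f ^~ y) (w' (y + r *: v)).
  have := dw (y + r *: v) => -[].
  rewrite /derivable /derive.
  set F := (X in cvg (nbhs (X @ _)) -> _).
  have FE : F = (fun h => h^-1 *: (((f ^~ y) \o shift r) (h *: 1) - f r y)).
    apply/funext => s; rewrite /F /f /= scale0r !addr0.
    by rewrite scalerDl -addrA (addrC (r *: v)).
  rewrite FE => dw1; rewrite -/F FE => dw2; exact: (DeriveDef dw1 dw2).
have I0 : (`](-1), 1[%classic : set R) 0 by rewrite /= in_itv /=; apply/andP; split; lra.
have I1 r : (`](-1), 1[%classic : set R) r -> `|r| <= 1.
  by rewrite /= in_itv /= => /andP[r1 r2]; rewrite ler_norml; apply/andP; split; lra.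
have intf r : (`](-1), 1[%classic : set R) r -> lam.-integrable setT (EFin \o f r).
  move=> /I1 r1; apply: (integrable_dom1 k20 (mshift r)).
  by exists M => _ y _; exact: HM.
have derf r (y : Rd R d) : (`](-1), 1[%classic : set R) r -> [set: Rd R d] y -> derivable (f ^~ y) r 1.
  by move=> _ _; have [] := df r y.
have G0 (y : Rd R d) : 0 <= M' * expR (k / 2 * sqn (y : 'rV[R]_d)).
  by rewrite mulr_ge0 ?expR_ge0.
have intG : lam.-integrable [set: Rd R d]
    (EFin \o (fun y : Rd R d => M' * expR (k / 2 * sqn (y : 'rV[R]_d)))).
  rewrite /comp; under eq_fun do rewrite EFinM.
  by apply: integrableZl => //; exact: integrable_expR_sqn.
have Gub r (y : Rd R d) : (`](-1), 1[%classic : set R) r -> [set: Rd R d] y ->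
    `|partial1of2 f r y| <= M' * expR (k / 2 * sqn (y : 'rV[R]_d)).
  by move=> /I1 r1 _; rewrite partial1of2E; have [_ ->] := df r y; exact: HM'.
have := differentiation_under_integral measurableT I0 intf derf G0 intG Gub.
have int1 (r : R) : \int[lam]_y f r y = \int[lam]_y w y.
  rewrite /Rintegral; congr fine; rewrite /f.
  by apply: (@integral_translation _ _ lam lamP (r *: v) (EFin \o w)); exact/measurable_EFinP.
have -> : (fun r => \int[lam]_y f r y) = cst (\int[lam]_y w y) by exact/funext.
rewrite derive1_cst => ->; apply: eq_Rintegral => y _.
by rewrite partial1of2E; have [_ ->] := df 0 y; rewrite scale0r addr0.
Qed.

End integration_by_parts.
End gaussian.

(** * Averages over a probability space and Fubini's theorem *)

Section mixture.
Context {R : realType} {d : nat}.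
Variable lam : {measure set (Rd R d) -> \bar R}.
Hypothesis lamP : is_lebesgue lam.
Hypothesis gaussP : (\int[lam]_x (gauss_density x)%:E = 1)%E.
Context (d1 : measure_display) (T : measurableType d1) (P : probability T R).
Implicit Types H : T -> 'rV[R]_d -> R.

Definition jointly_measurable H :=
  measurable_fun [set: T * Rd R d] (fun z : T * Rd R d => H z.1 (z.2 : 'rV[R]_d)).

(** The measure [lam] itself, packed with its sigma-finiteness so that the product theorems apply to
    it. *)
Let slam : {sigma_finite_measure set (Rd R d) -> \bar R} :=
  HB.pack (lam : set (Rd R d) -> \bar R) (Measure.class lam)
   (isSigmaFinite.Build _ _ _ lam (lebesgue_sigma_finite lamP))
   (isSFinite.Build _ _ _ lam (sfinite_measure_sigma_finite (lebesgue_sigma_finite lamP))).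

Lemma jointly_measurable1 H w : jointly_measurable H -> measurable_fun [set: Rd R d] (H w).
Proof. by move=> mH; exact: (measurableT_comp mH (measurable_pair1 w)). Qed.

Lemma jointly_measurable2 H (y : 'rV[R]_d) : jointly_measurable H -> measurable_fun setT (H ^~ y).
Proof. by move=> mH; exact: (measurableT_comp mH (measurable_pair2 (y : Rd R d))). Qed.

Lemma measure_setT_prob : (P : {measure set T -> \bar R}) setT = 1%E.
Proof. exact: probability_setT. Qed.

Lemma integrable_bounded (f : T -> R) M : measurable_fun setT f -> (forall w, `|f w| <= M) ->
  P.-integrable setT (EFin \o f).
Proof.
move=> mf fM; apply: measurable_bounded_integrable => //.
  by rewrite (le_lt_trans (probability_le1 _ _))// ltry.
exists M; split; first exact: num_real.
by move=> x Mx w _ /=; rewrite (le_trans (fM w))// ltW.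
Qed.

Lemma integrable_mixture k H y : jointly_measurable H -> dom [set: T] k H ->
  P.-integrable setT (EFin \o H ^~ y).
Proof.
move=> mH [M HM]; apply: (integrable_bounded (M := M * expR (k * sqn y))).
  exact: jointly_measurable2.
by move=> w; exact: HM.
Qed.

Lemma integrable_dom k H w : k < 0 -> jointly_measurable H -> dom [set: T] k H ->
  lam.-integrable [set: Rd R d] (EFin \o H w).
Proof.
move=> k0 mH [M HM]; apply: (integrable_dom1 lamP gaussP k0).
  exact: jointly_measurable1.
by exists M => _ y _; exact: HM.
Qed.

Lemma dom_mixture k H : jointly_measurable H -> dom [set: T] k H ->
  dom1 k (fun y => \int[P]_w H w y).
Proof.
move=> mH dH; have [M HM] := dH; exists M => _ y _.
apply: le_trans (le_normr_Rintegral measurableT (integrable_mixture y mH dH)) _.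
have e : M * expR (k * sqn y) = \int[P]_w (cst (M * expR (k * sqn y)) w).
  by rewrite Rintegral_cst// measure_setT_prob mulr1.
rewrite e; apply: le_Rintegral => //.
- apply: (integrable_bounded (M := M * expR (k * sqn y))).
    exact: measurableT_comp (jointly_measurable2 _ mH).
  by move=> w; rewrite normr_id; exact: HM.
- exact: finite_measure_integrable_cst.
- by move=> w _; exact: HM.
Qed.

(** The Gaussian bound does not depend on [w] and [P] has mass 1, so the iterated integral is at
    most a single Gaussian integral. *)
Lemma integrable_prod k H : k < 0 -> jointly_measurable H -> dom [set: T] k H ->
  (P \x slam)%E.-integrable setT (fun z : T * Rd R d => (H z.1 z.2)%:E).
Proof.
move=> k0 mH dH; have [M M0 HM] := dom_ge0 dH.
apply/integrable12ltyP; first exact/measurable_EFinP.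
apply: (@le_lt_trans _ _ (\int[P]_w (\int[lam]_y (M * expR (k * sqn (y : 'rV[R]_d)))%:E))%E).
  apply: ge0_le_integral => //.
  - by move=> w _; apply: integral_ge0 => y _; rewrite lee_fin.
  - apply: (@measurable_fun_fubini_tonelli_F _ _ _ _ R slam (fun z => `|(H z.1 z.2)%:E|)%E) => //.
    by apply: measurableT_comp => //; exact/measurable_EFinP.
  - move=> w _; apply: ge0_le_integral => //.
    + apply: measurableT_comp => //; apply/measurable_EFinP; exact: (jointly_measurable1 _ mH).
    + by apply/measurable_EFinP/measurable_funM => //; exact: measurable_expR_sqn.
    + by move=> y _; rewrite lee_fin; exact: HM.
have i : lam.-integrable setT (fun y : Rd R d => (M * expR (k * sqn (y : 'rV[R]_d)))%:E).
  by under eq_fun do rewrite EFinM; apply: integrableZl => //; exact: integrable_expR_sqn.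
rewrite integral_cst// measure_setT_prob mule1.
by have /integrableP[_] := i; under eq_integral do rewrite gee0_abs ?lee_fin ?mulr_ge0 ?expR_ge0//.
Qed.

Lemma measurable_mixture k H : k < 0 -> jointly_measurable H -> dom [set: T] k H ->
  measurable_fun [set: Rd R d] (fun y => \int[P]_w H w y).
Proof.
move=> k0 mH dH; have iH := integrable_prod k0 mH dH.
exact: (measurableT_comp (@fine_measurable _ setT measurableT) (measurable_fubini_G iH)).
Qed.

Lemma Fubini_mixture k H : k < 0 -> jointly_measurable H -> dom [set: T] k H ->
  \int[lam]_y (\int[P]_w H w y) = \int[P]_w (\int[lam]_y H w y).
Proof.
move=> k0 mH dH; have iH := integrable_prod k0 mH dH.
rewrite /Rintegral; congr fine.
transitivity (\int[lam]_y \int[P]_w (H w y)%:E)%E.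
  apply: eq_integral => y _; rewrite fineK//.
  exact: (integrable_fin_num measurableT (integrable_mixture y mH dH)).
rewrite -(Fubini iH) /=; apply: eq_integral => w _; rewrite fineK//.
exact: (integrable_fin_num measurableT (integrable_dom w k0 mH dH)).
Qed.

End mixture.

(** * Linearity of real integrals and the weighted Cauchy-Schwarz inequality *)

Section Rintegral_extra.
Context {R : realType} (d1 : measure_display) (T : measurableType d1).
Variable mu : {measure set T -> \bar R}.
Implicit Types f g : T -> R.

Lemma integrable_scale (c : R) f : mu.-integrable setT (EFin \o f) ->
  mu.-integrable setT (EFin \o (fun x => c * f x)).
Proof.
by move=> fi; rewrite /comp; under eq_fun do rewrite EFinM; exact: integrableZl.
Qed.

Lemma integrable_add f g : mu.-integrable setT (EFin \o f) -> mu.-integrable setT (EFin \o g) ->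
  mu.-integrable setT (EFin \o (fun x => f x + g x)).
Proof.
by move=> fi gi; rewrite /comp; under eq_fun do rewrite EFinD; exact: integrableD.
Qed.

Lemma integrable_sub f g : mu.-integrable setT (EFin \o f) -> mu.-integrable setT (EFin \o g) ->
  mu.-integrable setT (EFin \o (fun x => f x - g x)).
Proof.
by move=> fi gi; rewrite /comp; under eq_fun do rewrite EFinB; exact: integrableB.
Qed.

Lemma integrable_bigsum (I : Type) (s : seq I) (F : I -> T -> R) :
  (forall i, mu.-integrable setT (EFin \o F i)) ->
  mu.-integrable setT (EFin \o (fun x => \sum_(i <- s) F i x)).
Proof.
move=> iF; elim: s => [|i s IH].
  rewrite /comp; under eq_fun do rewrite big_nil; exact: integrable0.
by rewrite /comp; under eq_fun do rewrite big_cons; exact: integrable_add.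
Qed.

Lemma Rintegral_sum (I : Type) (s : seq I) (F : I -> T -> R) :
  (forall i, mu.-integrable setT (EFin \o F i)) ->
  \int[mu]_x (\sum_(i <- s) F i x) = \sum_(i <- s) \int[mu]_x F i x.
Proof.
move=> iF; elim: s => [|i s IH].
  rewrite big_nil; under eq_Rintegral do rewrite big_nil.
  by rewrite Rintegral_cst// mul0r.
rewrite big_cons; under eq_Rintegral do rewrite big_cons.
by rewrite RintegralD// ?IH//; exact: integrable_bigsum.
Qed.

End Rintegral_extra.

Section Rintegral_linear.
Context {R : realType} (d1 : measure_display) (T : measurableType d1).
Variable mu : {measure set T -> \bar R}.
Implicit Types (f g h : T -> R) (a b c e : R).

Lemma Rintegral0 : \int[mu]_(x in setT) (0 : R) = 0.
Proof. by rewrite Rintegral_cst// mul0r. Qed.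

Lemma Rintegral_lin2 a b c f h :
  mu.-integrable setT (EFin \o f) -> mu.-integrable setT (EFin \o h) ->
  \int[mu]_x (a * f x - b * (c * h x)) = a * \int[mu]_x f x - b * (c * \int[mu]_x h x).
Proof.
move=> fi hi; have i1 := integrable_scale a fi.
have i3 := integrable_scale c hi; have i4 := integrable_scale b i3.
by rewrite RintegralB// !RintegralZl.
Qed.

Lemma Rintegral_lin3 a b c e f g h :
  mu.-integrable setT (EFin \o f) -> mu.-integrable setT (EFin \o g) ->
  mu.-integrable setT (EFin \o h) ->
  \int[mu]_x (a * f x + b * g x - c * (e * h x)) =
  a * \int[mu]_x f x + b * \int[mu]_x g x - c * (e * \int[mu]_x h x).
Proof.
move=> fi gi hi; have i1 := integrable_scale a fi; have i2 := integrable_scale b gi.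
have i3 := integrable_scale e hi; have i4 := integrable_scale c i3.
by rewrite RintegralB// ?RintegralD// ?RintegralZl//; exact: integrable_add.
Qed.

Lemma Rintegral_lin3' a b c f g h :
  mu.-integrable setT (EFin \o f) -> mu.-integrable setT (EFin \o g) ->
  mu.-integrable setT (EFin \o h) ->
  \int[mu]_x (a * f x + b * g x - c * h x) =
  a * \int[mu]_x f x + b * \int[mu]_x g x - c * \int[mu]_x h x.
Proof.
move=> fi gi hi; have i1 := integrable_scale a fi; have i2 := integrable_scale b gi.
have i4 := integrable_scale c hi.
by rewrite RintegralB// ?RintegralD// ?RintegralZl//; exact: integrable_add.
Qed.

(** The integral of [(r - f)^2 h] is a quadratic polynomial in [r] that is nonnegative everywhere;
    evaluate it at [r = B / A]. *)
Lemma weighted_cauchy_schwarz f h :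
  (forall x, 0 <= h x) ->
  mu.-integrable setT (EFin \o h) -> mu.-integrable setT (EFin \o (fun x => f x * h x)) ->
  mu.-integrable setT (EFin \o (fun x => f x ^+ 2 * h x)) ->
  (\int[mu]_x (f x * h x)) ^+ 2 <= (\int[mu]_x h x) * (\int[mu]_x (f x ^+ 2 * h x)).
Proof.
move=> h0 ih ifh if2h.
set A := \int[mu]_x h x; set B := \int[mu]_x (f x * h x).
set C := \int[mu]_x (f x ^+ 2 * h x).
have A0 : 0 <= A by apply: Rintegral_ge0.
have H r : 0 <= A * r ^+ 2 - 2 * B * r + C.
  have -> : A * r ^+ 2 - 2 * B * r + C = r ^+ 2 * A + 1 * C - (2 * r) * B by ring.
  rewrite -(Rintegral_lin3' _ _ _ ih if2h ifh); apply: Rintegral_ge0 => x _.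
  have -> : r ^+ 2 * h x + 1 * (f x ^+ 2 * h x) - 2 * r * (f x * h x) = (r - f x) ^+ 2 * h x by ring.
  by rewrite mulr_ge0 ?sqr_ge0.
have [A1|A1] := eqVneq A 0; last first.
  have A2 : 0 < A by rewrite lt_neqAle eq_sym A1.
  have := mulr_ge0 A0 (H (B / A)).
  have -> : A * (A * (B / A) ^+ 2 - 2 * B * (B / A) + C) = A * C - B ^+ 2 by field.
  by rewrite subr_ge0.
have [->|B0] := eqVneq B 0; first by rewrite A1 mul0r expr0n.
(* When [A = 0] the polynomial is affine, and this [r] gives it the value -1 unless [B = 0]. *)
have := H ((C + 1) / (2 * B)); rewrite A1 mul0r add0r.
have -> : - (2 * B * ((C + 1) / (2 * B))) + C = - 1 by field.
by rewrite oppr_ge0 ler10.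
Qed.

End Rintegral_linear.

(** * Gradients, derivatives along lines and Lipschitz gradients *)

Section gradient.
Context {R : realType} {d : nat}.
Implicit Types (u v x y : 'rV[R]_d) (f : 'rV[R]_d -> R).

Lemma dot_linear u : linear (dot u : 'rV[R]_d -> R^o).
Proof. by move=> c v w; rewrite dotDr dotZr. Qed.

(** A quadratic remainder is [o(k)]; passing from the Euclidean to the matrix norm costs a factor
    [d]. This form suits mixtures, because a remainder bound that is uniform in [w] survives
    averaging. *)
Lemma is_diff_quadratic f x u (M : R) :
  (forall k, enorm k <= 1 -> `|f (k + x) - f x - dot u k| <= M * sqn k) ->
  is_diff x f (dot u).
Proof.
move=> H.
pose df : {linear 'rV[R]_d -> R^o} :=
  HB.pack (dot u : 'rV[R]_d -> R^o) (GRing.isLinear.Build _ _ _ _ _ (dot_linear u)).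
have cdf : continuous df by exact: dot_continuous.
have E : f \o shift x = cst (f x) + df +o_ (0 : 'rV[R]_d) id.
  apply/eqaddoP => _/posnumP[e].
  pose N : R := `|M| * d%:R + 1.
  have N0 : 0 < N by rewrite /N ltr_wpDl ?mulr_ge0.
  have D0 : 0 < (d%:R + 1 : R) by rewrite ltr_wpDl.
  near=> k.
  have k1 : `|k| <= (d%:R + 1)^-1.
    near: k; apply/nbhs_ballP; exists (d%:R + 1)^-1; first by rewrite /= invr_gt0.
    by move=> z; rewrite -ball_normE /= sub0r normrN => /ltW.
  have k2 : `|k| <= e%:num / N.
    near: k; apply/nbhs_ballP; exists (e%:num / N); first by rewrite /= divr_gt0.
    by move=> z; rewrite -ball_normE /= sub0r normrN => /ltW.
  have nk0 := normr_ge0 k.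
  have sk := sqn_le_mx_norm k.
  have kk1 : enorm k <= 1.
    rewrite -(@ler_pXn2r _ 2)// ?nnegrE ?enorm_ge0// enorm_sqr expr1n.
    apply: le_trans sk _.
    have : `|k| * (d%:R + 1) <= 1 by rewrite -ler_pdivlMr// div1r.
    have : 0 <= (d%:R : R) by [].
    move: `|k| (d%:R : R) nk0 => a b a0 b0 ab; nra.
  have -> : (f \o shift x - (cst (f x) + df)) k = f (k + x) - f x - dot u k.
    by rewrite /= !fctE /= /shift /= opprD addrA.
  apply: le_trans (H k kk1) _.
  apply: (@le_trans _ _ (`|M| * (d%:R * `|k| ^+ 2))).
    apply: (@le_trans _ _ (`|M| * sqn k)); last by rewrite ler_wpM2l.
    by rewrite ler_wpM2r ?sqn_ge0 ?ler_norm.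
  have : `|k| * N <= e%:num by rewrite -ler_pdivlMr.
  rewrite /N => H2.
  have -> : `|M| * (d%:R * `|k| ^+ 2) = (`|k| * (`|M| * d%:R)) * `|k| by ring.
  by rewrite ler_wpM2r//; lra.
have dE := diff_unique cdf E.
apply: DiffDef; last by rewrite dE.
by apply/diff_locallyP; rewrite dE.
Unshelve. all: by end_near. Qed.

Lemma is_derive_line_shift f y v r D :
  is_derive (0 : R) (1 : R) (fun s => f (y + r *: v + s *: v)) D ->
  is_derive r (1 : R) (fun s => f (y + s *: v)) D.
Proof.
move=> -[]; rewrite /derivable /derive.
set F := (X in cvg (nbhs (X @ _)) -> _).
have FE : F = (fun h => h^-1 *: (((fun s => f (y + s *: v)) \o shift r) (h *: 1)
    - f (y + r *: v))).
  apply/funext => s; rewrite /F /= scale0r !addr0.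
  by rewrite scalerDl -addrA (addrC (r *: v)).
by rewrite FE => dw1; rewrite -/F FE => dw2; exact: (DeriveDef dw1 dw2).
Qed.

Lemma is_diff_line f y u v :
  is_diff y f (dot u) -> is_derive (0 : R) (1 : R) (fun r => f (y + r *: v)) (dot u v).
Proof.
move=> dfu.
have d1 : differentiable f y by exact: ex_diff.
have d2 : 'd f y = dot u :> (_ -> _) by exact: diff_val.
have d3 := diff_derivable (v := v) d1; have d4 := deriveE v d1.
move: d3 d4; rewrite d2 /derivable /derive.
set F := (X in cvg (nbhs (X @ _)) -> _).
have FE : F = (fun h => h^-1 *: (((fun s => f (y + s *: v)) \o shift 0) (h *: 1)
    - f (y + 0 *: v))).
  apply/funext => s; rewrite /F /= scale0r !addr0.
  by congr (_ *: (f _ - _)); rewrite addrC; congr (_ + _ *: _); exact/esym/mulr1.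
by rewrite FE => dw1; rewrite -/F FE => dw2; exact: (DeriveDef dw1 dw2).
Qed.

Lemma gradE f y u : is_diff y f (dot u) -> grad f y = u.
Proof.
move=> dfu; apply/rowP => i; rewrite mxE.
by have -> : 'd f y = dot u :> (_ -> _) by [exact: diff_val]; rewrite dot_evec.
Qed.

Lemma row_sum_evec v : v = \sum_(i < d) v ord0 i *: evec i.
Proof.
rewrite [LHS]matrix_sum_delta big_ord_recl big_ord0 addr0.
by apply: eq_bigr => i _.
Qed.

Lemma is_diff_grad f y : differentiable f y -> is_diff y f (dot (grad f y)).
Proof.
move=> df; apply: DiffDef => //; apply/funext => v.
rewrite [in LHS](row_sum_evec v) linear_sum /dot; apply: eq_bigr => i _.
by rewrite linearZ /= mxE mulrC.
Qed.

(** The mean value theorem on the segment gives [f y - f x = dot (g z) (y - x)] for an intermediate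
    [z], and [g z] differs from [g x] by at most [L |y - x|]. An integral remainder would give
    [L / 2]; the cruder constant suffices for the growth bounds on [p]. *)
Lemma lipschitz_grad_lower f (g : 'rV[R]_d -> 'rV[R]_d) (L : R) x y : 0 <= L ->
  (forall z, is_diff z f (dot (g z))) ->
  (forall a b, enorm (g a - g b) <= L * enorm (a - b)) ->
  f x + dot (g x) (y - x) - L * sqn (y - x) <= f y.
Proof.
move=> L0 df gL; set v := y - x.
have dl r : is_derive r (1 : R) (fun s => f (x + s *: v)) (dot (g (x + r *: v)) v).
  by apply: is_derive_line_shift; exact: is_diff_line.
have cl : {within `[0, 1], continuous (fun s => f (x + s *: v))}.
  apply: continuous_subspaceT => r.
  by apply: differentiable_continuous; apply/derivable1_diffP; have [] := dl r.
have [c] := @MVT _ (fun s => f (x + s *: v)) (fun r => dot (g (x + r *: v)) v) 0 1 ltr01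
  (fun r _ => dl r) cl.
rewrite in_itv /= => /andP[c0 c1]; rewrite subr0 mulr1 scale1r scale0r addr0 /v.
rewrite [x + _]addrC subrK -/v => /eqP; rewrite subr_eq => /eqP ->.
have := cauchy_schwarz (g (x + c *: v) - g x) v; rewrite dotDl dotNl.
move=> /ler_normlP[]; rewrite lerNl => H1 _.
have := gL (x + c *: v) x; rewrite [x + _]addrC addrK enormZ gtr0_norm// => H2.
have H3 : enorm (g (c *: v + x) - g x) * enorm v <= L * sqn v.
  rewrite -enorm_sqr; have := enorm_ge0 v => v0.
  apply: le_trans (ler_wpM2r v0 H2) _.
  rewrite expr2 !mulrA ler_wpM2r// ler_wpM2r//.
  by rewrite -[leRHS]mulr1 ler_wpM2l// ltW.
by move: H1; rewrite [x + _]addrC; lra.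
Qed.

End gradient.

Section gradient_rules.
Context {R : realType} {d : nat}.
Implicit Types (u v x y : 'rV[R]_d) (f : 'rV[R]_d -> R).

Lemma is_diff_ln f y u : 0 < f y -> is_diff y f (dot u) ->
  is_diff y (fun z => ln (f z)) (dot ((f y)^-1 *: u)).
Proof.
move=> f0 df.
have D : is_derive (f y) (1 : R) (@ln R) (f y)^-1 by exact: is_derive1_ln.
have dl : differentiable (@ln R) (f y) by apply/derivable1_diffP; have [] := D.
have dl2 : is_diff (f y) (@ln R) (fun h => h * (f y)^-1).
  apply: DiffDef => //; apply/funext => h.
  by rewrite diff1E// derive1E; have [_ ->] := D.
have := is_diff_comp df dl2.
set F := (X in is_diff _ X _); set G := (X in is_diff _ _ X).
have -> // : G = dot ((f y)^-1 *: u).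
by apply/funext => v; rewrite /G /= dotZl mulrC.
Qed.

Lemma is_diff_lincomb f h y u v (c : R) : is_diff y f (dot u) -> is_diff y h (dot v) ->
  is_diff y (fun z => 2 * f z - 2 * h z - c) (dot (2 *: u - 2 *: v)).
Proof.
move=> df dh.
have := is_diffB (is_diffB (is_diffZ 2 df) (is_diffZ 2 dh)) (is_diff_cst c y).
set F := (X in is_diff _ X _); set G := (X in is_diff _ _ X).
have -> // : G = dot (2 *: u - 2 *: v).
by apply/funext => w; rewrite /G !fctE dotDl dotNl !dotZl subr0.
Qed.

End gradient_rules.

(** * The heat kernel and its derivatives *)

Section heat_kernel.
Context {R : realType} {d : nat}.
Implicit Types (u v x y : 'rV[R]_d) (t : R).

(** The density of [N(0, 2t I)], that is, the fundamental solution of the heat equation. The factor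
    [(4 pi t)^(-d/2)] is kept inside the exponential, so that positivity is immediate and
    derivatives are those of an exponent. *)
Definition heat t v : R := expR (- (sqn v) / (4 * t) - d%:R / 2 * ln (4 * pi * t)).

Lemma heat_ge0 t v : 0 <= heat t v. Proof. exact: expR_ge0. Qed.

Definition heat_cst t : R := expR (- (d%:R / 2 * ln (4 * pi * t))).

Lemma heatE t v : heat t v = heat_cst t * expR (- (4 * t)^-1 * sqn v).
Proof. by rewrite -expRD /heat; congr expR; rewrite addrC mulNr mulNr (mulrC (sqn v)). Qed.

Lemma heat_cstE t : 0 < t -> heat_cst t = (Num.sqrt (4 * pi * t) ^+ d)^-1.
Proof.
move=> t0; have h0 : 0 < 4 * pi * t :> R by rewrite !mulr_gt0// pi_gt0.
rewrite /heat_cst expRN; congr (_^-1).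
rewrite -{1}(sqr_sqrtr (ltW h0)) lnXn ?sqrtr_gt0//.
have -> : d%:R / 2 * (ln (Num.sqrt (4 * pi * t)) *+ 2) = d%:R * ln (Num.sqrt (4 * pi * t)) by field.
by rewrite expRM_natl lnK ?posrE ?sqrtr_gt0.
Qed.

Lemma heat_expand t v k : t != 0 ->
  heat t (v + k) = heat t v * expR (- (2 * dot v k + sqn k) / (4 * t)).
Proof. by move=> t0; rewrite /heat -expRD sqnD; congr expR; field. Qed.

Lemma expR_taylor1 (r : R) : `|expR r - 1 - r| <= r ^+ 2 * expR `|r|.
Proof.
have h1 := expR_ge1Dx r; have h2 := expR_ge1Dx (- r).
rewrite ger0_norm; last lra.
have e0 := expR_gt0 r.
have e1 : expR r * expR (- r) = 1 by rewrite -expRD subrr expR0.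
have h3 : expR r - 1 <= r * expR r by nra.
have [r0|r0] := leP 0 r.
  rewrite ger0_norm//; have : r * (expR r - 1) <= r * (r * expR r) by rewrite ler_wpM2l.
  nra.
rewrite ltr0_norm//.
have h4 : 1 <= expR (- r) by rewrite -expR0 ler_expR; lra.
have h5 : r * (expR r - 1) <= r ^+ 2 by nra.
have : r ^+ 2 * 1 <= r ^+ 2 * expR (- r) by rewrite ler_wpM2l ?sqr_ge0.
nra.
Qed.

(** The constant is uniform in [v], so the bound can be averaged over all centres. The exponent
    changes by at most [|k| b] with [b] linear in [|v|], and the Gaussian factor absorbs both
    [b^2 <= 4 exp b] and the [exp b] of the exponential remainder. *)
Lemma heat_taylor t : 0 < t -> exists2 M, 0 <= M &
  forall v k, enorm k <= 1 ->
  `|heat t (k + v) - heat t v + dot v k / (2 * t) * heat t v| <= M * sqn k.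
Proof.
move=> t0; pose c := heat_cst t.
have c0 : 0 <= c by exact: expR_ge0.
exists (c * (4 * expR (6 / (4 * t)) + (4 * t)^-1)).
  by rewrite mulr_ge0// addr_ge0 ?mulr_ge0 ?expR_ge0 ?invr_ge0 ?mulr_ge0 ?ltW.
move=> v k k1; rewrite [k + v]addrC heat_expand ?gt_eqF//.
set r := - (2 * dot v k + sqn k) / (4 * t).
set n := enorm v; set b := (2 * n + 1) / (4 * t).
have t4 : 0 < 4 * t by rewrite mulr_gt0.
have n0 : 0 <= n by exact: enorm_ge0.
have k0 : 0 <= enorm k by exact: enorm_ge0.
have b0 : 0 <= b by rewrite /b divr_ge0 ?(ltW t4)//; lra.
have rb : `|r| <= enorm k * b.
  rewrite /r /b normrM normfV (gtr0_norm t4) normrN mulrA ler_wpM2r ?invr_ge0 ?(ltW t4)//.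
  apply: le_trans (ler_normD _ _) _.
  rewrite normrM (ger0_norm (sqn_ge0 k)) -enorm_sqr [`|2|]ger0_norm//.
  have := cauchy_schwarz v k; rewrite -/n => H; nra.
have rb1 : `|r| <= b by nra.
have -> : heat t v * expR r - heat t v + dot v k / (2 * t) * heat t v =
    heat t v * ((expR r - 1 - r) - sqn k / (4 * t)).
  by rewrite /r; field; rewrite gt_eqF.
rewrite normrM (ger0_norm (heat_ge0 _ _)).
have hv : heat t v = c * expR (- (4 * t)^-1 * n ^+ 2) by rewrite heatE enorm_sqr.
have hc : heat t v <= c.
  rewrite hv -[leRHS]mulr1 ler_wpM2l// expR_le1 mulNr oppr_le0.
  by apply: mulr_ge0; [rewrite invr_ge0; exact: ltW|exact: sqr_ge0].
have H1 : heat t v * (r ^+ 2 * expR `|r|) <= c * 4 * expR (6 / (4 * t)) * sqn k.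
  have r2 : r ^+ 2 <= sqn k * b ^+ 2.
    rewrite -enorm_sqr -exprMn -(real_normK (num_real r)).
    by apply: lerXn2r => //; rewrite nnegrE mulr_ge0.
  have b2 : b ^+ 2 <= 4 * expR b.
    have : 1 + b / 2 <= expR (b / 2) by exact: expR_ge1Dx.
    have -> : expR b = expR (b / 2) ^+ 2 by rewrite expr2 -expRD; congr expR; field.
    move=> H; have : 0 <= expR (b / 2) by exact: expR_ge0.
    nra.
  have er : expR `|r| <= expR b by rewrite ler_expR.
  apply: (@le_trans _ _ (heat t v * ((sqn k * (4 * expR b)) * expR b))).
    rewrite ler_wpM2l ?heat_ge0// ler_pM ?sqr_ge0 ?expR_ge0//.
    by apply: le_trans r2 _; rewrite ler_wpM2l ?sqn_ge0.
  rewrite hv.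
  have -> : c * expR (- (4 * t)^-1 * n ^+ 2) * (sqn k * (4 * expR b) * expR b) =
    c * 4 * (expR (- (4 * t)^-1 * n ^+ 2) * expR b * expR b) * sqn k by ring.
  rewrite -!expRD ler_wpM2r ?sqn_ge0// ler_wpM2l ?mulr_ge0// ler_expR.
  (* The number 6 is the maximum of [4 n + 2 - n^2 = 6 - (n - 2)^2]. *)
  have -> : - (4 * t)^-1 * n ^+ 2 + b + b = (4 * n + 2 - n ^+ 2) / (4 * t).
    by rewrite /b; field; rewrite gt_eqF.
  by rewrite ler_wpM2r ?invr_ge0 ?(ltW t4)//; have := sqr_ge0 (n - 2); nra.
have H2 : heat t v * (sqn k / (4 * t)) <= c * (4 * t)^-1 * sqn k.
  by rewrite -mulrA [_^-1 * _]mulrC ler_wpM2r// divr_ge0 ?sqn_ge0 ?(ltW t4).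
apply: (@le_trans _ _ (heat t v * (r ^+ 2 * expR `|r|) + heat t v * (sqn k / (4 * t)))).
  rewrite -mulrDr ler_wpM2l ?heat_ge0//.
  apply: le_trans (ler_normB _ _) _; rewrite lerD ?expR_taylor1//.
  by rewrite ger0_norm// divr_ge0 ?sqn_ge0 ?(ltW t4).
rewrite (_ : c * _ * sqn k = c * 4 * expR (6 / (4 * t)) * sqn k + c * (4 * t)^-1 * sqn k).
  exact: lerD.
by rewrite mulrDr mulrDl mulrA.
Qed.

Lemma is_derive_heat_line t v u : t != 0 ->
  is_derive (0 : R) (1 : R) (fun r => heat t (v + r *: u)) (- (dot v u) / (2 * t) * heat t v).
Proof.
move=> t0.
have E : (fun r => heat t (v + r *: u)) = expR \o (fun r : R =>
   - (sqn v + 2 * (dot v u) * r + r ^+ 2 * sqn u) / (4 * t) - d%:R / 2 * ln (4 * pi * t)).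
  by apply/funext => r; rewrite /= /heat sqnD dotZr sqnZ; congr expR; field.
rewrite E.
have D : is_derive (0 : R) (1 : R) (fun r : R =>
   - (sqn v + 2 * (dot v u) * r + r ^+ 2 * sqn u) / (4 * t) - d%:R / 2 * ln (4 * pi * t))
   (- (dot v u) / (2 * t)).
  apply: is_derive_eq.
  by rewrite /GRing.scale /=; field.
apply: is_derive_eq; rewrite /= expr0n /= mul0r addr0 mulr0 addr0 mulrC.
by rewrite /heat.
Qed.

Lemma is_derive_heat_time (b S : 'rV[R]_d) t : 0 < t ->
  is_derive t (1 : R) (fun s => heat s (b - s *: S))
    ((sqn (b - t *: S) / (4 * t ^+ 2) + dot (b - t *: S) S / (2 * t) - d%:R / (2 * t))
      * heat t (b - t *: S)).
Proof.
move=> t0; have tn0 : t != 0 by rewrite gt_eqF.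
have p0 : 0 < 4 * pi :> R by rewrite mulr_gt0// pi_gt0.
pose F (s : R) := - (sqn b / 4) * s^-1 + dot b S / 2 - s * (sqn S / 4) - d%:R / 2 * (ln (4 * pi) + ln s).
have D : is_derive t (1 : R) F (sqn b / (4 * t ^+ 2) - sqn S / 4 - d%:R / (2 * t)).
  have D1 : is_derive t (1 : R) (fun s : R => s^-1) (- t ^- 2 *: 1).
    exact: (@is_deriveV _ id).
  have D2 : is_derive t (1 : R) (@ln R) t^-1 by exact: is_derive1_ln.
  have := is_deriveB (is_deriveB (is_deriveD (is_deriveZ (- (sqn b / 4)) D1)
     (is_derive_cst (dot b S / 2) t 1)) (is_deriveZ (sqn S / 4) (is_derive_id t 1)))
     (is_deriveZ (d%:R / 2) (is_deriveD (is_derive_cst (ln (4 * pi)) t 1) D2)).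
  set D3 := (X in is_derive _ _ _ X); set F' := (X in is_derive _ _ X _ -> _).
  have -> : F' = F by apply/funext => s; rewrite /F' /F !fctE /= [s * _]mulrC.
  have -> // : D3 = sqn b / (4 * t ^+ 2) - sqn S / 4 - d%:R / (2 * t).
  by rewrite /D3 /GRing.scale /=; field.
have D2 : is_derive t (1 : R) (expR \o F)
    ((sqn (b - t *: S) / (4 * t ^+ 2) + dot (b - t *: S) S / (2 * t) - d%:R / (2 * t))
      * heat t (b - t *: S)).
  have := is_derive1_comp (is_derive_expR (F t)) D.
  set D3 := (X in is_derive _ _ _ X); move=> D4.
  apply: (is_derive_eq D4); rewrite /D3 [LHS]mulrC; congr (_ * _).
    rewrite sqnB dotZr sqnZ dotDl dotNl dotZl -/(sqn S); field.
    exact: tn0.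
  rewrite /heat /F sqnB dotZr sqnZ [ln (_ * t)]lnM ?posrE//; congr expR.
  by field.
(* Splitting the logarithm requires a positive time, so the two expressions agree only near [t]. *)
apply: near_eq_is_derive D2.
near=> s; have s0 : 0 < s by near: s; exact: lt_nbhsr.
rewrite /heat /F /= sqnB dotZr sqnZ [ln (_ * s)]lnM ?posrE//; congr expR.
by field; rewrite gt_eqF.
Unshelve. all: by end_near. Qed.

Lemma measurable_heat_shift t (m : 'rV[R]_d) :
  measurable_fun [set: Rd R d] (fun y : Rd R d => heat t ((y : 'rV[R]_d) - m)).
Proof.
rewrite /heat; apply: measurableT_comp => //; apply: measurable_funB => //.
apply: measurable_funM => //; apply: measurableT_comp => //; exact: measurable_sqn_shift.
Qed.

End heat_kernel.

(** * Scalar inequalities that fix the constants *)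

(** [I] is half the derivative of the energy [Z], [D] the dissipation, [E] the drift error, [N] and
    [W] the displacement and score moments. Eliminating [W] and then [N] gives [E <= 31/10 (eps^2 Z
    + 6 d L^2 t Z + 8 (L t)^2 D)], whence [186/10]; the [D] part is below [D / 100] because
    [L t <= 1/100]. *)
Lemma dissipation_arith (R : realType) (L t eps dd Z D E N W I : R) :
  0 < L -> 0 < t -> L * t <= 1 / 100 ->
  I <= - 2^-1 * D + 2^-1 * E ->
  E <= 31 / 10 * (eps ^+ 2 * Z + (L * t) ^+ 2 * W + L ^+ 2 * N) ->
  N <= 4 * t * (dd * Z) + 4 * t ^+ 2 * D ->
  W <= (2 * t ^+ 2)^-1 * N + 2 * D -> 0 <= D ->
  2 * I <= - (99 / 100) * D + (31 / 10 * eps ^+ 2 + 186 / 10 * dd * L ^+ 2 * t) * Z.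
Proof.
move=> L0 t0 Lt h1 h2 h3 h4 D0.
have Lt0 : 0 <= L * t by rewrite mulr_ge0 ?ltW.
have Lt2 : (L * t) ^+ 2 <= 1 / 10000 by move: (L * t) Lt0 Lt => x x0 x1; nra.
have h5 : (L * t) ^+ 2 * W <= 2^-1 * (L ^+ 2 * N) + 2 * ((L * t) ^+ 2 * D).
  have := ler_wpM2l (sqr_ge0 (L * t)) h4.
  have -> // : (L * t) ^+ 2 * ((2 * t ^+ 2)^-1 * N + 2 * D) =
    2^-1 * (L ^+ 2 * N) + 2 * ((L * t) ^+ 2 * D).
  by field; rewrite gt_eqF.
have h6 : L ^+ 2 * N <= 4 * (dd * L ^+ 2 * t * Z) + 4 * ((L * t) ^+ 2 * D).
  have := ler_wpM2l (sqr_ge0 L) h3.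
  have -> // : L ^+ 2 * (4 * t * (dd * Z) + 4 * t ^+ 2 * D) =
     4 * (dd * L ^+ 2 * t * Z) + 4 * ((L * t) ^+ 2 * D) by ring.
have h7 : (L * t) ^+ 2 * D <= 1 / 10000 * D by rewrite ler_wpM2r.
have -> : (31 / 10 * eps ^+ 2 + 186 / 10 * dd * L ^+ 2 * t) * Z =
  31 / 10 * (eps ^+ 2 * Z) + 186 / 10 * (dd * L ^+ 2 * t * Z) by ring.
move: ((L * t) ^+ 2 * D) (eps ^+ 2 * Z) (L ^+ 2 * N) ((L * t) ^+ 2 * W) (dd * L ^+ 2 * t * Z)
  h1 h2 h5 h6 h7 D0 => x1 x2 x3 x4 x5; clear; lra.
Qed.

(** The log-Sobolev bound turns [- 99/100 D] into at most [- 0.495 (Z - 1) / C]. Writing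
    [Z = (Z - 1) + 1] in the error term costs at most [0.07 (Z - 1) / C], since
    [31/480 + 186/43920 < 7/100]; what remains is better than the rate [1 / (4 C)]. *)
Lemma decay_arith (R : realType) (C D Z x x' ep I : R) : 0 < C -> 1 <= Z ->
  Z - 1 <= 2 * C * D -> I <= - (99 / 100) * D + (31 / 10 * ep + 186 / 10 * x) * Z ->
  x <= x' -> 0 <= x' -> 0 <= ep -> C * x' <= 1 / 4392 -> C * ep <= 1 / 48 ->
  I <= - (4 * C)^-1 * (Z - 1) + (4 * ep + 20 * x').
Proof.
move=> C0 Z1 ZD HI xx x0 ep0 Cx Cep.
have k1 : 1 / 2 * ((Z - 1) / C) <= D.
  have -> : 1 / 2 * ((Z - 1) / C) = (Z - 1) / (2 * C) by field; rewrite gt_eqF.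
  by rewrite ler_pdivrMr ?mulr_gt0// mulrC.
have k4 : 0 <= (Z - 1) / C by rewrite divr_ge0 ?(ltW C0)// subr_ge0.
have k3 : (31 / 10 * ep + 186 / 10 * x) * C <= 7 / 100.
  have : x * C <= x' * C by rewrite ler_wpM2r// ltW.
  move: Cx Cep; rewrite !(mulrC C) mulrDl -!(mulrA _ _ C).
  by move: (x * C) (x' * C) (ep * C) => a b c; clear; lra.
have k2 := ler_wpM2r k4 k3.
have k5 : (31 / 10 * ep + 186 / 10 * x) * C * ((Z - 1) / C) =
  (31 / 10 * ep + 186 / 10 * x) * (Z - 1) by field; rewrite gt_eqF.
have k6 : - (4 * C)^-1 * (Z - 1) = - (1 / 4 * ((Z - 1) / C)) by field; rewrite gt_eqF.
have k7 : (31 / 10 * ep + 186 / 10 * x) * Z =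
   (31 / 10 * ep + 186 / 10 * x) * (Z - 1) + (31 / 10 * ep + 186 / 10 * x) by ring.
apply: (le_trans HI); rewrite k6 k7; move: k2; rewrite k5.
move: k1 k4 xx x0 ep0.
move: ((Z - 1) / C) ((31 / 10 * ep + 186 / 10 * x) * (Z - 1)) => a b; clear; lra.
Qed.

(** Undoes the integrating factor: multiply the goal by [expR (c * e)]. *)
Lemma exponential_transfer (R : realType) (c e s b x y : R) :
  expR (c * e) * x - b * expR (c * e) * e <= expR (c * s) * y - b * expR (c * e) * s ->
  x <= expR (- (c * (e - s))) * y + b * (e - s).
Proof.
move=> H; have -> : - (c * (e - s)) = - (c * e) + c * s by ring.
rewrite expRD -(ler_pM2l (expR_gt0 (c * e))).
have h : expR (c * e) * expR (- (c * e)) = 1 by rewrite -expRD subrr expR0.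
have -> : expR (c * e) * (expR (- (c * e)) * expR (c * s) * y + b * (e - s)) =
  (expR (c * e) * expR (- (c * e))) * (expR (c * s) * y) + b * expR (c * e) * e
    - b * expR (c * e) * s by ring.
rewrite h mul1r; lra.
Qed.

(** * Mixtures of heat kernels with frozen drift: uniform domination *)

Section kernel_mixture.
Context {R : realType} {d : nat}.
Variable lam : {measure set (Rd R d) -> \bar R}.
Hypothesis lamP : is_lebesgue lam.
Hypothesis gaussP : (\int[lam]_x (gauss_density x)%:E = 1)%E.
Context (d1 : measure_display) (T : measurableType d1) (P : probability T R).
Variables (a : T -> R) (X S : T -> 'rV[R]_d) (A rho sigma L : R).
Hypothesis ma : measurable_fun setT a.
Hypothesis a0 : forall w, 0 <= a w.
Hypothesis aA : forall w, a w <= A.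
Hypothesis mX : forall i, measurable_fun setT (fun w => X w ord0 i).
Hypothesis mS : forall i, measurable_fun setT (fun w => S w ord0 i).
Hypothesis Xrho : forall w, enorm (X w) <= rho.
Hypothesis Ssigma : forall w, enorm (S w) <= sigma.
Hypothesis L1 : 1 <= L.

(* [mix ker t] (below) is the density at time [t] of [X + t S + sqrt(2t) xi] under the law
   [a P]; the integrand [ker] is Gaussian in the displacement [disp]. *)
Definition disp (t : R) (w : T) (y : 'rV[R]_d) : 'rV[R]_d := y - X w - t *: S w.
Definition ker (t : R) (w : T) (y : 'rV[R]_d) : R := a w * heat t (disp t w y).

Lemma ker_ge0 t w y : 0 <= ker t w y.
Proof. by rewrite mulr_ge0 ?heat_ge0. Qed.

Lemma jm_disp t i : jointly_measurable (fun w y => disp t w y ord0 i).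
Proof.
rewrite /jointly_measurable /disp.
under eq_fun do rewrite !mxE.
apply: measurable_funB; first apply: measurable_funB.
- exact: (measurableT_comp (measurable_coord i) measurable_snd).
- exact: (measurableT_comp (mX i) measurable_fst).
- apply: measurable_funM => //; exact: (measurableT_comp (mS i) measurable_fst).
Qed.

Lemma jm_fst (f : T -> R) : measurable_fun setT f -> jointly_measurable (d := d) (fun w y => f w).
Proof. by move=> mf; exact: (measurableT_comp mf measurable_fst). Qed.

Lemma jm_snd (f : 'rV[R]_d -> R) : measurable_fun [set: Rd R d] f ->
  jointly_measurable (fun (w : T) y => f y).
Proof. by move=> mf; exact: (measurableT_comp mf measurable_snd). Qed.

Lemma jm_mul (F G : T -> 'rV[R]_d -> R) : jointly_measurable F -> jointly_measurable G ->
  jointly_measurable (fun w y => F w y * G w y).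
Proof. exact: measurable_funM. Qed.

Lemma jm_add (F G : T -> 'rV[R]_d -> R) : jointly_measurable F -> jointly_measurable G ->
  jointly_measurable (fun w y => F w y + G w y).
Proof. exact: measurable_funD. Qed.

Lemma jm_sub (F G : T -> 'rV[R]_d -> R) : jointly_measurable F -> jointly_measurable G ->
  jointly_measurable (fun w y => F w y - G w y).
Proof. exact: measurable_funB. Qed.

Lemma jm_cst (c : R) : jointly_measurable (d := d) (fun (w : T) y => c).
Proof. exact: measurable_cst. Qed.

Lemma jm_dot (u v : T -> 'rV[R]_d -> 'rV[R]_d) :
  (forall i, jointly_measurable (fun w y => u w y ord0 i)) ->
  (forall i, jointly_measurable (fun w y => v w y ord0 i)) ->
  jointly_measurable (fun w y => dot (u w y) (v w y)).
Proof.
move=> mu mv; rewrite /jointly_measurable /dot.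
by apply: measurable_sum => i; exact: (measurable_funM (mu i) (mv i)).
Qed.

Lemma jm_ker t : jointly_measurable (ker t).
Proof.
apply: jm_mul; first exact: jm_fst.
rewrite /jointly_measurable /heat.
apply: measurableT_comp => //; apply: measurable_funB => //; apply: measurable_funM => //.
apply: measurableT_comp => //; exact: (jm_dot (jm_disp t) (jm_disp t)).
Qed.

Variables (tau t1 : R).
Hypothesis tau0 : 0 < tau.
Hypothesis taut1 : tau < t1.

(** Open, so that time derivatives exist at each point; bounded away from 0, so that the kernel and
    the powers of [1 / t] are uniformly bounded. *)
Definition times : set R := [set t | tau < t < t1].
Definition indices : set (R * T) := [set u | times u.1].

(** Measurability is needed time by time, whereas one bound serves all times and samples: it
    justifies Fubini's theorem in [(w, y)] as well as differentiation in [t]. *)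
Definition unif_dom (k : R) (F : R -> T -> 'rV[R]_d -> R) :=
  (forall t, times t -> jointly_measurable (F t)) /\ dom indices k (fun u y => F u.1 u.2 y).

Lemma unif_dom_le k1 k F : unif_dom k1 F -> k1 <= k -> unif_dom k F.
Proof. by move=> [mF dF] k1k; split => //; exact: dom_le dF k1k. Qed.

Lemma unif_dom_mul k1 k2 k F G : unif_dom k1 F -> unif_dom k2 G -> k1 + k2 <= k ->
  unif_dom k (fun t w y => F t w y * G t w y).
Proof.
move=> [mF dF] [mG dG] kk; split; last exact: domM dF dG kk.
by move=> t tt; apply: jm_mul; [exact: mF|exact: mG].
Qed.

Lemma unif_dom_add k F G : unif_dom k F -> unif_dom k G -> unif_dom k (fun t w y => F t w y + G t w y).
Proof.
move=> [mF dF] [mG dG]; split; last exact: domD dF dG.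
by move=> t tt; apply: jm_add; [exact: mF|exact: mG].
Qed.

Lemma unif_dom_sub k F G : unif_dom k F -> unif_dom k G -> unif_dom k (fun t w y => F t w y - G t w y).
Proof.
move=> [mF dF] [mG dG]; split; last exact: domB dF dG.
by move=> t tt; apply: jm_sub; [exact: mF|exact: mG].
Qed.

Lemma unif_dom_coef (c : R -> R) M : (forall t, times t -> `|c t| <= M) ->
  unif_dom 0 (fun t w y => c t).
Proof.
move=> cM; split; first by move=> t _; exact: jm_cst.
by apply: (@dom_bounded _ _ _ _ (fun u : R * T => c u.1)) => u; exact: cM.
Qed.

Lemma unif_dom_cst c : unif_dom 0 (fun t w y => c).
Proof. exact: (@unif_dom_coef (fun=> c) `|c|). Qed.

Lemma unif_dom_snd k (f : 'rV[R]_d -> R) : measurable_fun [set: Rd R d] f -> dom1 k f ->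
  unif_dom k (fun t w y => f y).
Proof.
move=> mf [M HM]; split; first by move=> t _; exact: jm_snd.
by exists M => u y _; exact: (HM tt).
Qed.

Lemma unif_dom_sum k (F : 'I_d -> R -> T -> 'rV[R]_d -> R) : (forall i, unif_dom k (F i)) ->
  unif_dom k (fun t w y => \sum_(i < d) F i t w y).
Proof.
move=> gF; split; last by apply: dom_sum => i; have [] := gF i.
move=> t tt; rewrite /jointly_measurable.
by apply: measurable_sum => i; have [H _] := gF i; exact: H.
Qed.

Let r := rho + t1 * sigma.

Lemma rho_ge0 (w : T) : 0 <= rho.
Proof. exact: le_trans (enorm_ge0 (X w)) (Xrho w). Qed.

Lemma sigma_ge0 (w : T) : 0 <= sigma.
Proof. exact: le_trans (enorm_ge0 (S w)) (Ssigma w). Qed.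

Lemma disp_shift t w y : times t -> exists2 u, disp t w y = y + u & enorm u <= r.
Proof.
move=> /andP[tt1 tt2]; exists (- X w - t *: S w); first by rewrite /disp addrA.
apply: le_trans (enormD _ _) _; rewrite !enormN enormZ lerD//.
have t0 : 0 < t by exact: lt_trans tt1.
rewrite gtr0_norm//; apply: ler_pM => //; first exact: ltW.
  exact: enorm_ge0.
exact: ltW.
Qed.

Lemma enorm_disp t w y : times t -> enorm (disp t w y) <= enorm y + r.
Proof.
move=> /(disp_shift w y)[u -> ur]; apply: le_trans (enormD _ _) _; by rewrite lerD2l.
Qed.

Lemma r_ge0 (w : T) : 0 <= r.
Proof.
rewrite addr_ge0 ?(rho_ge0 w)// mulr_ge0 ?(sigma_ge0 w)//.
by apply: ltW; exact: lt_trans taut1.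
Qed.

Lemma expR_ge1 (k : R) (y : 'rV[R]_d) : 0 <= k -> 1 <= expR (k * sqn y).
Proof. by move=> k0; rewrite -[leLHS]expR0 ler_expR mulr_ge0// sqn_ge0. Qed.

Lemma enorm_disp_dom t w y : times t -> enorm (disp t w y) <= (1 + r) * expR (L * sqn y).
Proof.
move=> tt; apply: le_trans (enorm_disp w y tt) _; rewrite mulrDl mul1r.
rewrite lerD ?enorm_le_expR// ler_peMr ?(r_ge0 w)// expR_ge1//.
by apply: le_trans L1.
Qed.

Lemma unif_dom_disp i : unif_dom L (fun t w y => disp t w y ord0 i).
Proof.
split; first by move=> t _; exact: jm_disp.
exists (1 + r) => u y tt; apply: le_trans (coord_le_enorm _ _) _; exact: enorm_disp_dom.
Qed.

Lemma unif_dom_S i : unif_dom 0 (fun t w y => S w ord0 i).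
Proof.
split; first by move=> t _; exact: jm_fst.
apply: (@dom_bounded _ _ _ _ (fun u : R * T => S u.2 ord0 i) sigma) => u _.
exact: le_trans (coord_le_enorm _ _) (Ssigma _).
Qed.

Lemma unif_dom_sqn_disp : unif_dom (2 * L) (fun t w y => sqn (disp t w y)).
Proof.
apply: unif_dom_sum => i; apply: (unif_dom_mul (unif_dom_disp i) (unif_dom_disp i)); lra.
Qed.

Lemma unif_dom_dot_disp_S : unif_dom L (fun t w y => dot (disp t w y) (S w)).
Proof.
apply: unif_dom_sum => i; apply: (unif_dom_mul (unif_dom_disp i) (unif_dom_S i)); lra.
Qed.

(** The shift by [X + t S] has length at most [r]. It costs half of the rate
    [1 / (4 t) >= 1 / (4 t1)] and a factor [exp (r^2 / (4 tau))]; the normalizing constant is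
    largest at [tau]. *)
Lemma unif_dom_ker : unif_dom (- (8 * t1)^-1) ker.
Proof.
split; first by move=> t _; exact: jm_ker.
have t10 : 0 < t1 by exact: lt_trans taut1.
exists (A * (heat_cst (d := d) tau * expR (r ^+ 2 / (4 * tau)))) => -[t w] y /= tt.
have /andP[tt1 tt2] := tt; have t0 : 0 < t by exact: lt_trans tt1.
rewrite ger0_norm ?ker_ge0// /ker -[leRHS]mulrA ler_pM ?heat_ge0// heatE -[leRHS]mulrA.
have p0 : 0 < 4 * pi :> R by rewrite mulr_gt0// pi_gt0.
apply: ler_pM; rewrite ?expR_ge0//.
  rewrite ler_expR lerN2 ler_wpM2l ?divr_ge0// ler_ln ?posrE ?(mulr_gt0 p0)//.
  by rewrite ler_pM2l// ltW.
rewrite -expRD ler_expR.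
have [u -> ur] := disp_shift w y tt.
have u2 : sqn u <= r ^+ 2 by rewrite -enorm_sqr lerXn2r ?nnegrE ?enorm_ge0 ?(r_ge0 w).
have := sqn_shift_ge y u => H.
have i0 : 0 < (4 * t)^-1 by rewrite invr_gt0 mulr_gt0.
apply: (@le_trans _ _ ((4 * t)^-1 * (r ^+ 2 - sqn y / 2))).
  by rewrite mulNr -mulrN ler_pM2l//; lra.
have i1 : (4 * t)^-1 <= (4 * tau)^-1 by rewrite lef_pV2 ?posrE ?mulr_gt0// ler_pM2l// ltW.
have i2 : (4 * t1)^-1 <= (4 * t)^-1 by rewrite lef_pV2 ?posrE ?mulr_gt0// ler_pM2l// ltW.
have -> : (8 * t1)^-1 = (4 * t1)^-1 / 2 by field; rewrite gt_eqF.
have h1 : (4 * t)^-1 * r ^+ 2 <= (4 * tau)^-1 * r ^+ 2 by rewrite ler_wpM2r ?sqr_ge0.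
have h2 : (4 * t1)^-1 * sqn y <= (4 * t)^-1 * sqn y by rewrite ler_wpM2r ?sqn_ge0.
move: h1 h2; rewrite [r ^+ 2 / _]mulrC.
move: (4 * t)^-1 (4 * t1)^-1 (4 * tau)^-1 (sqn y) (r ^+ 2) => b1 b2 b3 b4 b5; lra.
Qed.

Definition mix (F : R -> T -> 'rV[R]_d -> R) t y : R := \int[P]_w F t w y.

Section mix_facts.
Variables (k : R) (F : R -> T -> 'rV[R]_d -> R).
Hypothesis gF : unif_dom k F.

Let dF t : times t -> dom [set: T] k (F t).
Proof. by move=> tt; have [_ [M HM]] := gF; exists M => w y _; exact: (HM (t, w)). Qed.

Let mF t : times t -> jointly_measurable (F t).
Proof. by have [H _] := gF; exact: H. Qed.

Lemma integrable_mix t y : times t -> P.-integrable setT (EFin \o (fun w => F t w y)).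
Proof. by move=> tt; exact: (integrable_mixture P y (mF tt) (dF tt)). Qed.

Lemma measurable_mix t : k < 0 -> times t -> measurable_fun [set: Rd R d] (mix F t).
Proof. by move=> k0 tt; exact: (measurable_mixture lamP gaussP P k0 (mF tt) (dF tt)). Qed.

Lemma dom_mix t : times t -> dom1 k (mix F t).
Proof. by move=> tt; exact: (dom_mixture P (mF tt) (dF tt)). Qed.

Lemma dom_mix_uniform : dom times k (mix F).
Proof.
have [_ [M HM]] := gF; exists M => t y tt.
have [N HN] := dF tt.
apply: le_trans (le_normr_Rintegral measurableT (integrable_mix y tt)) _.
have e : M * expR (k * sqn y) = \int[P]_w (cst (M * expR (k * sqn y)) w).
  by rewrite Rintegral_cst// measure_setT_prob mulr1.
rewrite e; apply: le_Rintegral => //.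
- apply: (integrable_bounded P (M := M * expR (k * sqn y))).
    exact: measurableT_comp (jointly_measurable2 _ (mF tt)).
  by move=> w; rewrite normr_id; exact: (HM (t, w)).
- exact: finite_measure_integrable_cst.
- by move=> w _; exact: (HM (t, w)).
Qed.

Lemma integral_mix t : k < 0 -> times t ->
  \int[lam]_y mix F t y = \int[P]_w \int[lam]_y F t w y.
Proof. by move=> k0 tt; exact: (Fubini_mixture lamP gaussP P k0 (mF tt) (dF tt)). Qed.

End mix_facts.

(** * Positivity, space gradient and time derivative of the mixture *)

Hypothesis a1 : \int[P]_w a w = 1.

Lemma times_gt0 t : times t -> 0 < t.
Proof. by move=> /andP[tt _]; exact: lt_trans tt. Qed.

Lemma integrable_a : P.-integrable setT (EFin \o a).
Proof. by apply: (integrable_bounded P (M := A)) => // w; rewrite ger0_norm. Qed.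

(** Since [|disp| <= |y| + r], the kernel is at least a positive constant times [a w], and [a] has
    integral 1. *)
Lemma mix_ker_gt0 t y : times t -> 0 < mix ker t y.
Proof.
move=> tt; have t0 := times_gt0 tt.
pose c := heat_cst (d := d) t * expR (- (4 * t)^-1 * (enorm y + r) ^+ 2).
have c0 : 0 < c by rewrite mulr_gt0 ?expR_gt0.
have ce : c = \int[P]_w (c * a w).
  by rewrite RintegralZl ?a1 ?mulr1//; exact: integrable_a.
apply: (lt_le_trans c0); rewrite [leLHS]ce; apply: le_Rintegral => //.
- by apply: integrable_scale; exact: integrable_a.
- exact: (integrable_mix unif_dom_ker).
- move=> w _; rewrite /ker mulrC ler_wpM2l// heatE ler_wpM2l ?expR_ge0//.
  rewrite ler_expR mulNr mulNr lerN2 ler_wpM2l ?invr_ge0 ?mulr_ge0 ?(ltW t0)//.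
  by rewrite -enorm_sqr lerXn2r ?nnegrE ?enorm_ge0 ?enorm_disp// addr_ge0 ?enorm_ge0 ?(r_ge0 w).
Qed.

Definition dispker (i : 'I_d) := fun t w y => disp t w y ord0 i * ker t w y.

Lemma unif_dom_dispker i : unif_dom (- (8 * t1)^-1 + L) (dispker i).
Proof. by apply: (unif_dom_mul (unif_dom_disp i) unif_dom_ker); rewrite addrC. Qed.

(* The gradient of [mix ker t]. *)
Definition gmix t y : 'rV[R]_d := \row_i (- (2 * t)^-1 * mix (dispker i) t y).

Lemma disp_shiftE t w y k : disp t w (k + y) = k + disp t w y.
Proof. by rewrite /disp !addrA. Qed.

(** The remainder of [heat_taylor] does not depend on the centre, so it stays quadratic, with
    constant [A * M], after averaging over [w]. *)
Lemma is_diff_mix t y : times t -> is_diff y (mix ker t) (dot (gmix t y)).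
Proof.
move=> tt; have t0 := times_gt0 tt.
have [M M0 HM] := heat_taylor (d := d) t0.
apply: (@is_diff_quadratic _ _ _ _ _ (A * M)) => k k1.
pose F w := \sum_(i < d) (- (2 * t)^-1 * k ord0 i) * dispker i t w y.
have iF : P.-integrable setT (EFin \o F).
  by apply: integrable_bigsum => i; apply: integrable_scale; exact: (integrable_mix (unif_dom_dispker i)).
have -> : dot (gmix t y) k = \int[P]_w F w.
  rewrite Rintegral_sum; last first.
    by move=> i; apply: integrable_scale; exact: (integrable_mix (unif_dom_dispker i)).
  rewrite /dot; apply: eq_bigr => i _; rewrite RintegralZl//; last first.
    exact: (integrable_mix (unif_dom_dispker i)).
  by rewrite !mxE mulrAC.
have i1 := integrable_mix unif_dom_ker (k + y) tt; have i2 := integrable_mix unif_dom_ker y tt.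
have i3 : P.-integrable setT (EFin \o (fun w => ker t w (k + y) - ker t w y)) by exact: integrable_sub.
have i4 : P.-integrable setT (EFin \o (fun w => ker t w (k + y) - ker t w y - F w)) by exact: integrable_sub.
rewrite /mix -RintegralB// -RintegralB//.
apply: le_trans (le_normr_Rintegral measurableT i4) _.
have e : A * M * sqn k = \int[P]_w (cst (A * M * sqn k) w).
  by rewrite Rintegral_cst// measure_setT_prob mulr1.
rewrite e; apply: le_Rintegral => //.
- rewrite (_ : (EFin \o _) = (fun w => `|(ker t w (k + y) - ker t w y - F w)%:E|%E))//.
  exact: integrable_abse.
- exact: finite_measure_integrable_cst.
- move=> w _.
  have -> : ker t w (k + y) - ker t w y - F w = a w * (heat t (k + disp t w y) -
      heat t (disp t w y) + dot (disp t w y) k / (2 * t) * heat t (disp t w y)).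
    rewrite /F /ker disp_shiftE.
    have -> : \sum_(i < d) - (2 * t)^-1 * k ord0 i * dispker i t w y =
        - (2 * t)^-1 * (dot (disp t w y) k) * ker t w y.
      rewrite /dot mulr_sumr mulr_suml; apply: eq_bigr => i _; rewrite /dispker; ring.
    rewrite /ker; ring.
  by rewrite normrM ger0_norm// /cst -[leRHS]mulrA ler_pM// HM.
Qed.

(* The time derivative of [ker]. *)
Definition dker t w y : R :=
  (sqn (disp t w y) / (4 * t ^+ 2) + dot (disp t w y) (S w) / (2 * t) - d%:R / (2 * t)) * ker t w y.

Lemma unif_dom_dker : unif_dom (- (8 * t1)^-1 + 2 * L) dker.
Proof.
have gi (c : R) n : unif_dom 0 (fun t w y => (c * t ^+ n)^-1).
  apply: (unif_dom_coef (M := `|(c * tau ^+ n)^-1|)) => t /andP[tt _].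
  have t0 : 0 < t by exact: lt_trans tt.
  rewrite !invfM !normrM ler_wpM2l// !ger0_norm ?invr_ge0 ?exprn_ge0 ?(ltW t0) ?(ltW tau0)//.
  by rewrite lef_pV2 ?posrE ?exprn_gt0// lerXn2r ?nnegrE ?(ltW t0) ?(ltW tau0)// ltW.
apply: (unif_dom_mul (k1 := 2 * L) _ unif_dom_ker); last by rewrite addrC.
apply: unif_dom_sub.
  apply: unif_dom_add.
    by apply: (unif_dom_mul unif_dom_sqn_disp (gi 4 2%N)); rewrite addr0.
  by apply: (unif_dom_mul unif_dom_dot_disp_S (gi 2 1%N)); have := L1; lra.
apply: (unif_dom_le (k1 := 0)); last by have := L1; lra.
by apply: (unif_dom_mul (unif_dom_cst d%:R) (gi 2 1%N)); lra.
Qed.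

Lemma is_derive_mix t y : times t -> is_derive t (1 : R) ((mix ker) ^~ y) (mix dker t y).
Proof.
move=> tt.
have It : (`]tau, t1[%classic : set R) t by rewrite /= in_itv.
have Iu s : (`]tau, t1[%classic : set R) s -> times s by rewrite /= in_itv.
have dk s w : times s -> is_derive s (1 : R) (fun u => ker u w y) (dker s w y).
  move=> ss; have s0 := times_gt0 ss.
  have D := is_derive_heat_time (y - X w) (S w) s0.
  apply: (is_derive_eq (is_deriveZ (a w) D)).
  by rewrite /dker /ker /disp /GRing.scale /= mulrCA.
have [_ /dom_ge0[M M0 HM]] := unif_dom_dker.
pose G (w : T) := M * expR ((- (8 * t1)^-1 + 2 * L) * sqn y).
have intf s : (`]tau, t1[%classic : set R) s -> P.-integrable setT (EFin \o (fun w => ker s w y)).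
  by move=> /Iu ss; exact: (integrable_mix unif_dom_ker).
have derf s w : (`]tau, t1[%classic : set R) s -> [set: T] w -> derivable (fun u => ker u w y) s 1.
  by move=> /Iu ss _; have [] := dk s w ss.
have G0 w : 0 <= G w by rewrite mulr_ge0 ?expR_ge0.
have intG : P.-integrable [set: T] (EFin \o G) by exact: finite_measure_integrable_cst.
have Gub s w : (`]tau, t1[%classic : set R) s -> [set: T] w ->
    `|partial1of2 (fun u w => ker u w y) s w| <= G w.
  by move=> /Iu ss _; rewrite partial1of2E; have [_ ->] := dk s w ss; exact: (HM (s, w)).
apply: DeriveDef.
  exact: (derivable_under_integral measurableT It intf derf G0 intG Gub).
rewrite -derive1E (differentiation_under_integral measurableT It intf derf G0 intG Gub).
by apply: eq_Rintegral => w _; rewrite partial1of2E; have [_ ->] := dk t w tt.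
Qed.

(** * The target density: growth of its inverse and of its score *)

Variables (p : 'rV[R]_d -> R) (g : 'rV[R]_d -> 'rV[R]_d).
Hypothesis p0 : forall y, 0 < p y.
Hypothesis mp : measurable_fun [set: Rd R d] p.
Hypothesis pdiff : forall x, is_diff x (fun y => ln (p y)) (dot (g x)).
Hypothesis mg : forall i, measurable_fun [set: Rd R d] (fun y => g y ord0 i).
Hypothesis gL : forall x y, enorm (g x - g y) <= L * enorm (x - y).
(* [ker] decays like [exp (- |y|^2 / (8 t1))], whereas [p^-1] and [g] grow at most like
   [exp (2 L |y|^2)] and [exp (L |y|^2)]: this leaves room for every product below. *)
Hypothesis t1L : 40 * L <= (8 * t1)^-1.

Definition gauss_dom k (f : 'rV[R]_d -> R) := measurable_fun [set: Rd R d] f /\ dom1 k f.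

Lemma gauss_dom_integrable k f : k < 0 -> gauss_dom k f -> lam.-integrable [set: Rd R d] (EFin \o f).
Proof. by move=> k0 [mf df]; exact: (integrable_dom1 lamP gaussP k0 mf df). Qed.

Lemma gauss_dom_le k1 k f : gauss_dom k1 f -> k1 <= k -> gauss_dom k f.
Proof. by move=> [mf df] kk; split => //; exact: dom_le df kk. Qed.

Lemma gauss_dom_mul k1 k2 k f h : gauss_dom k1 f -> gauss_dom k2 h -> k1 + k2 <= k ->
  gauss_dom k (fun y => f y * h y).
Proof.
move=> [mf df] [mh dh] kk; split; first exact: (measurable_funM mf mh).
exact: domM df dh kk.
Qed.

Lemma gauss_dom_add k f h : gauss_dom k f -> gauss_dom k h -> gauss_dom k (fun y => f y + h y).
Proof. by move=> [mf df] [mh dh]; split; [exact: (measurable_funD mf mh)|exact: domD df dh]. Qed.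

Lemma gauss_dom_sub k f h : gauss_dom k f -> gauss_dom k h -> gauss_dom k (fun y => f y - h y).
Proof. by move=> [mf df] [mh dh]; split; [exact: (measurable_funB mf mh)|exact: domB df dh]. Qed.

Lemma gauss_dom_scale k c f : gauss_dom k f -> gauss_dom k (fun y => c * f y).
Proof.
move=> [mf df]; split; last exact: domZ.
by apply: measurable_funM => //; exact: measurable_cst.
Qed.

Lemma gauss_dom_mix k F t : unif_dom k F -> k < 0 -> times t -> gauss_dom k (mix F t).
Proof.
by move=> gF k0 tt; split; [exact: (measurable_mix gF)|exact: (dom_mix gF)].
Qed.

Lemma gauss_dom_g i : gauss_dom L (fun y => g y ord0 i).
Proof.
split => //; exists (enorm (g 0) + L) => _ y _.
apply: le_trans (coord_le_enorm _ _) _.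
have := enormD (g y - g 0) (g 0); rewrite subrK => H; apply: le_trans H _.
have := gL y 0; rewrite subr0 => H.
have h1 := enorm_le_expR y L1.
have h2 := @expR_ge1 L y (le_trans ler01 L1).
have h3 : L * enorm y <= L * expR (L * sqn y) by rewrite ler_wpM2l// (le_trans ler01 L1).
have h4 : enorm (g 0) <= enorm (g 0) * expR (L * sqn y) by rewrite ler_peMr// enorm_ge0.
by rewrite mulrDl; lra.
Qed.

Lemma inv_pE y : (p y)^-1 = expR (- ln (p y)).
Proof. by rewrite expRN lnK// posrE. Qed.

(** A Lipschitz gradient bounds [ln p] from below by a quadratic around 0. Its linear term is split
    as [|g 0| |y| <= |g 0|^2 / 4 + |y|^2], and [1 <= L] absorbs the extra [|y|^2] into the rate
    [2 L]. *)
Lemma gauss_dom_invp : gauss_dom (2 * L) (fun y => (p y)^-1).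
Proof.
split.
  have -> : (fun y => (p y)^-1) = expR \o (fun y => - ln (p y)).
    by apply/funext => y; rewrite inv_pE.
  apply: measurableT_comp => //; apply: measurableT_comp => //.
  exact: (measurableT_comp (@measurable_ln R) mp).
exists (expR (- ln (p 0) + sqn (g 0) / 4)) => _ y _.
rewrite inv_pE ger0_norm ?expR_ge0// -expRD ler_expR.
have L0 : 0 <= L by exact: le_trans L1.
have := lipschitz_grad_lower 0 y L0 pdiff gL; rewrite subr0.
have := cauchy_schwarz (g 0) y => /ler_normlP[h1 _] h2.
have h3 : enorm (g 0) * enorm y <= sqn (g 0) / 4 + sqn y.
  by rewrite -!enorm_sqr; have := sqr_ge0 (enorm (g 0) / 2 - enorm y); nra.
have h4 : sqn y <= L * sqn y by rewrite ler_peMl// sqn_ge0.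
lra.
Qed.

Definition phi t y : R := mix ker t y * (p y)^-1.
(* The gradient of [phi t]. *)
Definition dphi t y : 'rV[R]_d := (p y)^-1 *: (gmix t y - mix ker t y *: g y).

(** The [40 L] of the kernel minus the [2 L] of a squared displacement; [- 38 L] then serves as the
    common rate of the mixtures below. *)
Lemma K_neg : - (8 * t1)^-1 + 2 * L <= - 38 * L.
Proof. by have := t1L; lra. Qed.

Lemma L_gt0 : 0 < L. Proof. exact: lt_le_trans ltr01 L1. Qed.

Lemma unif_dom38_ker : unif_dom (- 38 * L) ker.
Proof. by apply: (unif_dom_le unif_dom_ker); have := K_neg; have := L_gt0; lra. Qed.

Lemma unif_dom38_dispker i : unif_dom (- 38 * L) (dispker i).
Proof. by apply: (unif_dom_le (unif_dom_dispker i)); have := K_neg; have := L_gt0; lra. Qed.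

Definition disp2ker (i : 'I_d) := fun t w y => disp t w y ord0 i ^+ 2 * ker t w y.

Lemma unif_dom38_disp2ker i : unif_dom (- 38 * L) (disp2ker i).
Proof.
have h : unif_dom (2 * L) (fun t w y => disp t w y ord0 i ^+ 2).
  by apply: (unif_dom_mul (unif_dom_disp i) (unif_dom_disp i)); lra.
by apply: (unif_dom_mul h unif_dom_ker); have := K_neg; have := L_gt0; lra.
Qed.

Definition Sker (i : 'I_d) := fun (t : R) w y => S w ord0 i * ker t w y.

Lemma unif_dom38_Sker i : unif_dom (- 38 * L) (Sker i).
Proof. by apply: (unif_dom_mul (unif_dom_S i) unif_dom38_ker); lra. Qed.

Definition Sdispker (i : 'I_d) := fun t w y => S w ord0 i * disp t w y ord0 i * ker t w y.

Lemma unif_dom38_Sdispker i : unif_dom (- 38 * L) (Sdispker i).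
Proof.
have h : unif_dom L (fun t w y => S w ord0 i * disp t w y ord0 i).
  by apply: (unif_dom_mul (unif_dom_S i) (unif_dom_disp i)); lra.
by apply: (unif_dom_mul h unif_dom_ker); have := K_neg; have := L_gt0; lra.
Qed.

Lemma neg38 : - 38 * L < 0. Proof. by have := L_gt0; lra. Qed.

(** * Integration by parts at a fixed time and sample *)

Section fixed_time.
Variable t : R.
Hypothesis tt : times t.

Let nq := gauss_dom_mix unif_dom38_ker neg38 tt.

Lemma gauss_dom_gmix i : gauss_dom (- 38 * L) (fun y => gmix t y ord0 i).
Proof.
have -> : (fun y => gmix t y ord0 i) = (fun y => - (2 * t)^-1 * mix (dispker i) t y).
  by apply/funext => y; rewrite mxE.
apply: gauss_dom_scale; exact: (gauss_dom_mix (unif_dom38_dispker i) neg38 tt).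
Qed.

Lemma gauss_dom_phi : gauss_dom (- 36 * L) (phi t).
Proof. by apply: (gauss_dom_mul nq gauss_dom_invp); lra. Qed.

Lemma gauss_dom_score i : gauss_dom (- 37 * L) (fun y => gmix t y ord0 i - mix ker t y * g y ord0 i).
Proof.
apply: gauss_dom_sub; first by apply: (gauss_dom_le (gauss_dom_gmix i)); have := L_gt0; lra.
by apply: (gauss_dom_mul nq (gauss_dom_g i)); lra.
Qed.

Lemma dphiE y i : dphi t y ord0 i = (p y)^-1 * (gmix t y ord0 i - mix ker t y * g y ord0 i).
Proof. by rewrite !mxE. Qed.

Lemma gauss_dom_dphi i : gauss_dom (- 35 * L) (fun y => dphi t y ord0 i).
Proof.
have -> : (fun y => dphi t y ord0 i) = (fun y => (p y)^-1 * (gmix t y ord0 i - mix ker t y * g y ord0 i)).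
  by apply/funext => y; rewrite dphiE.
by apply: (gauss_dom_mul gauss_dom_invp (gauss_dom_score i)); lra.
Qed.

Lemma is_derive_phi_line y v :
  is_derive (0 : R) (1 : R) (fun s => phi t (y + s *: v)) (dot (dphi t y) v).
Proof.
have D1 := is_diff_line v (is_diff_mix y tt).
have D2 := is_diff_line v (pdiff y).
have D3 : is_derive (0 : R) (1 : R) (expR \o (fun s => - ln (p (y + s *: v))))
    (expR (- ln (p (y + 0 *: v))) * - dot (g y) v).
  exact: (@is_derive1_comp _ expR (fun s => - ln (p (y + s *: v))) 0 _ _
    (is_derive_expR _) (is_deriveN D2)).
have := is_deriveM D1 D3.
set f1 := (X in is_derive _ _ X _); set df1 := (X in is_derive _ _ _ X).
have -> : f1 = (fun s => phi t (y + s *: v)).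
  by apply/funext => s; rewrite /f1 /phi inv_pE fctE.
have -> // : df1 = dot (dphi t y) v.
rewrite /df1 /= scale0r addr0 -inv_pE /dphi dotZl dotDl dotNl dotZl /GRing.scale /=; ring.
Qed.

Lemma is_derive_ker_line w y i :
  is_derive (0 : R) (1 : R) (fun s => ker t w (y + s *: evec i))
    (- (disp t w y ord0 i) / (2 * t) * ker t w y).
Proof.
have tn0 : t != 0 by rewrite gt_eqF// times_gt0.
have D := is_derive_heat_line (disp t w y) (evec i) tn0.
have := is_deriveZ (a w) D.
set f1 := (X in is_derive _ _ X _); set df1 := (X in is_derive _ _ _ X).
have -> : f1 = (fun s => ker t w (y + s *: evec i)).
  by apply/funext => s; rewrite /f1 /ker [y + _]addrC disp_shiftE [_ + disp _ _ _]addrC.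
have -> // : df1 = - (disp t w y ord0 i) / (2 * t) * ker t w y.
by rewrite /df1 dot_evec /ker /GRing.scale /= mulrCA.
Qed.

Lemma is_derive_disp_line w y i :
  is_derive (0 : R) (1 : R) (fun s => disp t w (y + s *: evec i) ord0 i) 1.
Proof.
have -> : (fun s : R => disp t w (y + s *: evec i) ord0 i) = (fun s => s + disp t w y ord0 i).
  by apply/funext => s; rewrite [y + _]addrC disp_shiftE !mxE !eqxx mulr1.
by apply: is_derive_eq; rewrite addr0.
Qed.

Let nker w : gauss_dom (- 38 * L) (ker t w).
Proof.
have [H [M HM]] := unif_dom38_ker; split; first exact: (jointly_measurable1 w (H _ tt)).
by exists M => _ y _; exact: (HM (t, w)).
Qed.

Let ndisp w i : gauss_dom L (fun y => disp t w y ord0 i).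
Proof.
have [H [M HM]] := unif_dom_disp i; split; first exact: (jointly_measurable1 w (H _ tt)).
by exists M => _ y _; exact: (HM (t, w)).
Qed.

(** The integrand is the [i]-th partial derivative of [phi * disp_i * ker]: the three terms come
    from [dphi], from [d_i disp_i = 1], and from [d_i ker = - disp_i / (2 t) * ker]. *)
Lemma ibp_disp w i : \int[lam]_y
  (dphi t y ord0 i * dispker i t w y + phi t y * ker t w y
   - (2 * t)^-1 * (phi t y * disp2ker i t w y)) = 0.
Proof.
have L0 := L_gt0.
have n1 : gauss_dom (- 37 * L) (dispker i t w) by apply: (gauss_dom_mul (ndisp w i) (nker w)); lra.
have n2 : gauss_dom (- 36 * L) (disp2ker i t w).
  have h : gauss_dom (2 * L) (fun y => disp t w y ord0 i ^+ 2) by apply: (gauss_dom_mul (ndisp w i) (ndisp w i)); lra.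
  by apply: (gauss_dom_mul h (nker w)); lra.
have n3 : gauss_dom (- L) (fun y => phi t y * dispker i t w y) by apply: (gauss_dom_mul gauss_dom_phi n1); lra.
have [m3 d3] := n3.
have n4 : gauss_dom (- L) (fun y => dphi t y ord0 i * dispker i t w y + phi t y * ker t w y
   - (2 * t)^-1 * (phi t y * disp2ker i t w y)).
  apply: gauss_dom_sub; first apply: gauss_dom_add.
  - by apply: (gauss_dom_mul (gauss_dom_dphi i) n1); lra.
  - by apply: (gauss_dom_mul gauss_dom_phi (nker w)); lra.
  - by apply: gauss_dom_scale; apply: (gauss_dom_mul gauss_dom_phi n2); lra.
have [m4 d4] := n4.
apply: (@integral_partial_eq0 _ _ _ lamP gaussP (- L) (evec i) _ _ _ m3 m4 _ d3 d4); first by lra.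
move=> y; have D1 := is_derive_phi_line y (evec i).
have D2 := is_deriveM (is_derive_disp_line w y i) (is_derive_ker_line w y i).
apply: (is_derive_eq (is_deriveM D1 D2)).
rewrite /dispker /disp2ker scale0r addr0 dot_evec !fctE /= scale0r addr0 /GRing.scale /=.
by field; rewrite gt_eqF// times_gt0.
Qed.

Lemma ibp_S w i : \int[lam]_y
  (dphi t y ord0 i * Sker i t w y - (2 * t)^-1 * (phi t y * Sdispker i t w y)) = 0.
Proof.
have L0 := L_gt0.
have n1 : gauss_dom (- 38 * L) (Sker i t w) by apply: gauss_dom_scale; exact: nker.
have n2 : gauss_dom (- 37 * L) (Sdispker i t w).
  have h : gauss_dom L (fun y => S w ord0 i * disp t w y ord0 i) by apply: gauss_dom_scale; exact: ndisp.
  by apply: (gauss_dom_mul h (nker w)); lra.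
have n3 : gauss_dom (- L) (fun y => phi t y * Sker i t w y) by apply: (gauss_dom_mul gauss_dom_phi n1); lra.
have [m3 d3] := n3.
have n4 : gauss_dom (- L) (fun y => dphi t y ord0 i * Sker i t w y -
    (2 * t)^-1 * (phi t y * Sdispker i t w y)).
  apply: gauss_dom_sub.
  - by apply: (gauss_dom_mul (gauss_dom_dphi i) n1); lra.
  - by apply: gauss_dom_scale; apply: (gauss_dom_mul gauss_dom_phi n2); lra.
have [m4 d4] := n4.
apply: (@integral_partial_eq0 _ _ _ lamP gaussP (- L) (evec i) _ _ _ m3 m4 _ d3 d4); first by lra.
move=> y; have D1 := is_derive_phi_line y (evec i).
have D2 := is_deriveZ (S w ord0 i) (is_derive_ker_line w y i).
apply: (is_derive_eq (is_deriveM D1 D2)).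
rewrite /Sker /Sdispker scale0r addr0 dot_evec /= ?scale0r ?addr0 /GRing.scale /=.
by field; rewrite gt_eqF// times_gt0.
Qed.

End fixed_time.

(** Allows a kernel at time [t] to be multiplied by [phi t] or [dphi t], which are controlled at
    that time only, while the rules for families still apply. *)
Lemma unif_dom_freeze k F t : unif_dom k F -> times t -> unif_dom k (fun _ w y => F t w y).
Proof.
move=> [mF [M HM]] tt; split; first by move=> _ _; exact: mF.
by exists M => u y _; exact: (HM (t, u.2)).
Qed.

Definition Eker := fun (t : R) w y => sqn (S w - g y) * ker t w y.
Definition Eiker (i : 'I_d) := fun (t : R) w y => (S w ord0 i - g y ord0 i) ^+ 2 * ker t w y.

Lemma unif_dom_Sg i : unif_dom L (fun (t : R) w y => S w ord0 i - g y ord0 i).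
Proof.
have [mgi dgi] := gauss_dom_g i.
apply: unif_dom_sub; first by apply: (unif_dom_le (unif_dom_S i)); have := L_gt0; lra.
exact: unif_dom_snd.
Qed.

Lemma unif_dom38_Sgker i : unif_dom (- 38 * L) (fun t w y => (S w ord0 i - g y ord0 i) * ker t w y).
Proof. by apply: (unif_dom_mul (unif_dom_Sg i) unif_dom_ker); have := K_neg; have := L_gt0; lra. Qed.

Lemma unif_dom38_Eiker i : unif_dom (- 38 * L) (Eiker i).
Proof.
have h : unif_dom (2 * L) (fun (t : R) w y => (S w ord0 i - g y ord0 i) ^+ 2).
  by apply: (unif_dom_mul (unif_dom_Sg i) (unif_dom_Sg i)); lra.
by apply: (unif_dom_mul h unif_dom_ker); have := K_neg; lra.
Qed.

Lemma EkerE t w y : Eker t w y = \sum_(i < d) Eiker i t w y.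
Proof. by rewrite /Eker mulr_suml; apply: eq_bigr => i _; rewrite !mxE -expr2. Qed.

Lemma gauss_dom_int f : gauss_dom (- L) f -> lam.-integrable [set: Rd R d] (EFin \o f).
Proof. by apply: gauss_dom_integrable; have := L_gt0; lra. Qed.

(** * Energy dissipation at a fixed time *)

Section fixed_time_integrals.
Variable t : R.
Hypothesis tt : times t.

Let q := mix ker t.
Let U i := mix (dispker i) t.
Let V i := mix (disp2ker i) t.
Let B i := mix (Sker i) t.
Let Y i := mix (Sdispker i) t.
Let E i := mix (Eiker i) t.
Let nq : gauss_dom (- 38 * L) q := gauss_dom_mix unif_dom38_ker neg38 tt.
Let nU i : gauss_dom (- 38 * L) (U i) := gauss_dom_mix (unif_dom38_dispker i) neg38 tt.
Let nV i : gauss_dom (- 38 * L) (V i) := gauss_dom_mix (unif_dom38_disp2ker i) neg38 tt.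
Let nB i : gauss_dom (- 38 * L) (B i) := gauss_dom_mix (unif_dom38_Sker i) neg38 tt.
Let nY i : gauss_dom (- 38 * L) (Y i) := gauss_dom_mix (unif_dom38_Sdispker i) neg38 tt.
Let nE i : gauss_dom (- 38 * L) (E i) := gauss_dom_mix (unif_dom38_Eiker i) neg38 tt.
Let nphi := gauss_dom_phi tt.
Let ndphi i := gauss_dom_dphi tt i.
Let t0 : 0 < t := times_gt0 tt.

Lemma q_gt0 y : 0 < q y. Proof. exact: mix_ker_gt0. Qed.

Lemma phi_gt0 y : 0 < phi t y.
Proof. by rewrite /phi mulr_gt0 ?invr_gt0// q_gt0. Qed.

Let ixk y := integrable_mix unif_dom38_ker y tt.
Let ixU i y := integrable_mix (unif_dom38_dispker i) y tt.
Let ixV i y := integrable_mix (unif_dom38_disp2ker i) y tt.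
Let ixB i y := integrable_mix (unif_dom38_Sker i) y tt.
Let ixY i y := integrable_mix (unif_dom38_Sdispker i) y tt.
Let ixE i y := integrable_mix (unif_dom38_Eiker i) y tt.

Let n_phiq : gauss_dom (- L) (fun y => phi t y * q y).
Proof. by apply: (gauss_dom_mul nphi nq); have := L_gt0; lra. Qed.
Let n_phiV i : gauss_dom (- L) (fun y => phi t y * V i y).
Proof. by apply: (gauss_dom_mul nphi (nV i)); have := L_gt0; lra. Qed.
Let n_phiY i : gauss_dom (- L) (fun y => phi t y * Y i y).
Proof. by apply: (gauss_dom_mul nphi (nY i)); have := L_gt0; lra. Qed.
Let n_phiE i : gauss_dom (- L) (fun y => phi t y * E i y).
Proof. by apply: (gauss_dom_mul nphi (nE i)); have := L_gt0; lra. Qed.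
Let n_dphiU i : gauss_dom (- L) (fun y => dphi t y ord0 i * U i y).
Proof. by apply: (gauss_dom_mul (ndphi i) (nU i)); have := L_gt0; lra. Qed.
Let n_dphiB i : gauss_dom (- L) (fun y => dphi t y ord0 i * B i y).
Proof. by apply: (gauss_dom_mul (ndphi i) (nB i)); have := L_gt0; lra. Qed.
(** The factor [p] cancels the inverse of [p] in one of the two copies of [dphi]; what is left is
    [dphi] times a score difference, both of known rate. *)
Lemma gauss_dom_pdphi i : gauss_dom (- L) (fun y => p y * dphi t y ord0 i ^+ 2).
Proof.
have -> : (fun y => p y * dphi t y ord0 i ^+ 2) =
    (fun y => dphi t y ord0 i * (gmix t y ord0 i - mix ker t y * g y ord0 i)).
  by apply/funext => y; rewrite dphiE; field; rewrite gt_eqF.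
by apply: (gauss_dom_mul (ndphi i) (gauss_dom_score tt i)); have := L_gt0; lra.
Qed.
Let n_phiqg i : gauss_dom (- L) (fun y => phi t y * q y * g y ord0 i ^+ 2).
Proof.
have h : gauss_dom (2 * L) (fun y => g y ord0 i ^+ 2) by apply: (gauss_dom_mul (gauss_dom_g i) (gauss_dom_g i)); lra.
have h2 : gauss_dom (- 74 * L) (fun y => phi t y * q y) by apply: (gauss_dom_mul nphi nq); lra.
by apply: (gauss_dom_mul h2 h); have := L_gt0; lra.
Qed.

(** Average [ibp_disp] over [w] and exchange the integrals. This is the only source of information
    on the displacement moment under [phi q]. *)
Lemma ibp_disp_mix i :
  (2 * t)^-1 * \int[lam]_y (phi t y * V i y) =
  \int[lam]_y (dphi t y ord0 i * U i y) + \int[lam]_y (phi t y * q y).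
Proof.
pose F (_ : R) w y := dphi t y ord0 i * dispker i t w y + phi t y * ker t w y
   - (2 * t)^-1 * (phi t y * disp2ker i t w y).
have L0 := L_gt0.
have gp : unif_dom (- 36 * L) (fun (_ : R) (w : T) y => phi t y) by have [? ?] := nphi; exact: unif_dom_snd.
have gd : unif_dom (- 35 * L) (fun (_ : R) (w : T) y => dphi t y ord0 i).
  by have [? ?] := ndphi i; exact: unif_dom_snd.
have gF : unif_dom (- L) F.
  apply: unif_dom_sub; first apply: unif_dom_add.
  - by apply: (unif_dom_mul gd (unif_dom_freeze (unif_dom38_dispker i) tt)); lra.
  - by apply: (unif_dom_mul gp (unif_dom_freeze unif_dom38_ker tt)); lra.
  - apply: (unif_dom_mul (k2 := - L) (unif_dom_cst (2 * t)^-1)); last by lra.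
    by apply: (unif_dom_mul gp (unif_dom_freeze (unif_dom38_disp2ker i) tt)); lra.
have nL : - L < 0 by lra.
have H : \int[lam]_y mix F t y = 0.
  rewrite (integral_mix gF nL tt) -[RHS](Rintegral0 P).
  by apply: eq_Rintegral => w _; exact: ibp_disp.
have j1 := gauss_dom_int (n_dphiU i); have j2 := gauss_dom_int n_phiq; have j3 := gauss_dom_int (n_phiV i).
have : \int[lam]_y (1 * (dphi t y ord0 i * U i y) + 1 * (phi t y * q y) -
    (2 * t)^-1 * (phi t y * V i y)) = 0.
  rewrite -[RHS]H; apply: eq_Rintegral => y _; rewrite !mul1r.
  exact/esym/(Rintegral_lin3 (dphi t y ord0 i) (phi t y) (2 * t)^-1 (phi t y)
    (ixU i y) (ixk y) (ixV i y)).
rewrite (Rintegral_lin3' 1 1 (2 * t)^-1 j1 j2 j3) !mul1r => /eqP.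
by rewrite subr_eq0 => /eqP ->.
Qed.

Lemma ibp_S_mix i :
  (2 * t)^-1 * \int[lam]_y (phi t y * Y i y) = \int[lam]_y (dphi t y ord0 i * B i y).
Proof.
pose F (_ : R) w y := dphi t y ord0 i * Sker i t w y - (2 * t)^-1 * (phi t y * Sdispker i t w y).
have L0 := L_gt0.
have gp : unif_dom (- 36 * L) (fun (_ : R) (w : T) y => phi t y) by have [? ?] := nphi; exact: unif_dom_snd.
have gd : unif_dom (- 35 * L) (fun (_ : R) (w : T) y => dphi t y ord0 i).
  by have [? ?] := ndphi i; exact: unif_dom_snd.
have gF : unif_dom (- L) F.
  apply: unif_dom_sub.
  - by apply: (unif_dom_mul gd (unif_dom_freeze (unif_dom38_Sker i) tt)); lra.
  - apply: (unif_dom_mul (k2 := - L) (unif_dom_cst (2 * t)^-1)); last by lra.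
    by apply: (unif_dom_mul gp (unif_dom_freeze (unif_dom38_Sdispker i) tt)); lra.
have nL : - L < 0 by lra.
have H : \int[lam]_y mix F t y = 0.
  rewrite (integral_mix gF nL tt) -[RHS](Rintegral0 P).
  by apply: eq_Rintegral => w _; exact: ibp_S.
have j1 := gauss_dom_int (n_dphiB i); have j3 := gauss_dom_int (n_phiY i).
have : \int[lam]_y (1 * (dphi t y ord0 i * B i y) - (2 * t)^-1 * (1 * (phi t y * Y i y))) = 0.
  rewrite -[RHS]H; apply: eq_Rintegral => y _; rewrite !mul1r.
  exact/esym/(Rintegral_lin2 (dphi t y ord0 i) (2 * t)^-1 (phi t y) (ixB i y) (ixY i y)).
rewrite (Rintegral_lin2 1 (2 * t)^-1 1 j1 j3) !mul1r => /eqP.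
by rewrite subr_eq0 => /eqP ->.
Qed.

Lemma mix_dkerE y : mix dker t y =
  \sum_(i < d) ((4 * t ^+ 2)^-1 * V i y + (2 * t)^-1 * Y i y - (2 * t)^-1 * q y).
Proof.
rewrite /mix.
have -> : (fun w => dker t w y) = (fun w => \sum_(i < d) ((4 * t ^+ 2)^-1 * disp2ker i t w y
    + (2 * t)^-1 * Sdispker i t w y - (2 * t)^-1 * ker t w y)).
  apply/funext => w; rewrite /dker big_split /= big_split /= sumr_const card_ord -!mulr_sumr.
  have -> : \sum_(i < d) disp2ker i t w y = sqn (disp t w y) * ker t w y.
    by rewrite /sqn /dot mulr_suml; apply: eq_bigr => i _; rewrite /disp2ker expr2.
  have -> : \sum_(i < d) Sdispker i t w y = dot (disp t w y) (S w) * ker t w y.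
    by rewrite /dot mulr_suml; apply: eq_bigr => i _; rewrite /Sdispker; ring.
  by rewrite -mulr_natl; field; rewrite gt_eqF.
have h1 i := integrable_scale (4 * t ^+ 2)^-1 (ixV i y).
have h2 i := integrable_scale (2 * t)^-1 (ixY i y).
have h3 := integrable_scale (2 * t)^-1 (ixk y).
rewrite Rintegral_sum; last first.
  by move=> i; apply: integrable_sub => //; exact: integrable_add.
apply: eq_bigr => i _.
exact: (Rintegral_lin3' _ _ _ (ixV i y) (ixY i y) (ixk y)).
Qed.

(** The Fokker-Planck equation of the interpolation tested against [phi]: as
    [(2 t)^-1 U = - grad q], the right-hand side pairs [grad phi] with the probability flux
    [B - grad q]. *)
Lemma dissipation_identity : \int[lam]_y (phi t y * mix dker t y) =
  \sum_(i < d) \int[lam]_y (dphi t y ord0 i * ((2 * t)^-1 * U i y + B i y)).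
Proof.
have j1 i := gauss_dom_int (n_dphiU i); have j2 := gauss_dom_int n_phiq.
have j3 i := gauss_dom_int (n_phiV i); have j4 i := gauss_dom_int (n_phiY i).
have j5 i := gauss_dom_int (n_dphiB i).
have -> : (fun y => phi t y * mix dker t y) = (fun y => \sum_(i < d)
   ((4 * t ^+ 2)^-1 * (phi t y * V i y) + (2 * t)^-1 * (phi t y * Y i y)
     - (2 * t)^-1 * (phi t y * q y))).
  apply/funext => y; rewrite mix_dkerE mulr_sumr; apply: eq_bigr => i _; ring.
have h1 i := integrable_scale (4 * t ^+ 2)^-1 (j3 i).
have h2 i := integrable_scale (2 * t)^-1 (j4 i).
have h3 := integrable_scale (2 * t)^-1 j2.
rewrite Rintegral_sum; last first.
  by move=> i; apply: integrable_sub => //; exact: integrable_add.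
apply: eq_bigr => i _.
rewrite (Rintegral_lin3' _ _ _ (j3 i) (j4 i) j2) (ibp_S_mix i).
have -> : (4 * t ^+ 2)^-1 * \int[lam]_y (phi t y * V i y) =
  (2 * t)^-1 * ((2 * t)^-1 * \int[lam]_y (phi t y * V i y)).
  by field; rewrite gt_eqF.
rewrite (ibp_disp_mix i).
have -> : (fun y => dphi t y ord0 i * ((2 * t)^-1 * U i y + B i y)) =
  (fun y => (2 * t)^-1 * (dphi t y ord0 i * U i y) + 1 * (dphi t y ord0 i * B i y)
     - 0 * (dphi t y ord0 i * B i y)).
  by apply/funext => y; ring.
rewrite (Rintegral_lin3' _ _ _ (j1 i) (j5 i) (j5 i)).
set x1 := Rintegral _ _ _; set x2 := Rintegral _ _ _; set x3 := Rintegral _ _ _; ring.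
Qed.

(** Energy, dissipation, displacement moment, score moment and drift error, the last four by
    coordinate; they feed [dissipation_arith]. *)
Let Z := \int[lam]_y (phi t y * q y).
Let Di i := \int[lam]_y (p y * dphi t y ord0 i ^+ 2).
Let Ni i := \int[lam]_y (phi t y * V i y).
Let Wi i := \int[lam]_y (phi t y * q y * g y ord0 i ^+ 2).
Let Ei i := \int[lam]_y (phi t y * E i y).

Let iZ := gauss_dom_int n_phiq.
Let iD i := gauss_dom_int (gauss_dom_pdphi i).
Let iN i := gauss_dom_int (n_phiV i).
Let iW i := gauss_dom_int (n_phiqg i).
Let iE i := gauss_dom_int (n_phiE i).

Lemma disp_cauchy_schwarz i y : U i y ^+ 2 <= q y * V i y.
Proof.
apply: (@weighted_cauchy_schwarz _ _ _ P (fun w => disp t w y ord0 i) (fun w => ker t w y)).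
- by move=> w; exact: ker_ge0.
- exact: ixk.
- exact: ixU.
- exact: ixV.
Qed.

Lemma drift_cauchy_schwarz i y : (B i y - q y * g y ord0 i) ^+ 2 <= q y * E i y.
Proof.
have -> : B i y - q y * g y ord0 i = \int[P]_w ((S w ord0 i - g y ord0 i) * ker t w y).
  have := Rintegral_lin2 1 1 (g y ord0 i) (ixB i y) (ixk y).
  rewrite !mul1r [g y ord0 i * _]mulrC => <-; apply: eq_Rintegral => w _.
  by rewrite /Sker; ring.
apply: (@weighted_cauchy_schwarz _ _ _ P (fun w => S w ord0 i - g y ord0 i) (fun w => ker t w y)).
- by move=> w; exact: ker_ge0.
- exact: ixk.
- exact: (integrable_mix (unif_dom38_Sgker i)).
- exact: ixE.
Qed.

Lemma gmixE y i : gmix t y ord0 i = p y * dphi t y ord0 i + q y * g y ord0 i.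
Proof. by rewrite dphiE mulrA divff ?gt_eqF// mul1r subrK. Qed.

Lemma dispmixE y i : U i y = - (2 * t) * (p y * dphi t y ord0 i + q y * g y ord0 i).
Proof. by rewrite -gmixE mxE; rewrite /U; field; rewrite gt_eqF. Qed.

Lemma phiE y : phi t y = q y / p y. Proof. by []. Qed.

(** Pointwise the integrand equals [- p dphi^2 + dphi (B - q g)]. Young's inequality with weight [p]
    gives up half of the first term, and [(B - q g)^2 / p <= q E / p = phi E] by Cauchy-Schwarz. *)
Lemma dissipation_le i :
  \int[lam]_y (dphi t y ord0 i * ((2 * t)^-1 * U i y + B i y)) <= - 2^-1 * Di i + 2^-1 * Ei i.
Proof.
have e : - 2^-1 * Di i + 2^-1 * Ei i - 0 * Ei i = - 2^-1 * Di i + 2^-1 * Ei i.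
  by rewrite mul0r subr0.
rewrite -e -(Rintegral_lin3' (- 2^-1) 2^-1 0 (iD i) (iE i) (iE i)).
apply: le_Rintegral => //.
- have -> : (fun y => dphi t y ord0 i * ((2 * t)^-1 * U i y + B i y)) =
    (fun y => (2 * t)^-1 * (dphi t y ord0 i * U i y) + dphi t y ord0 i * B i y).
    by apply/funext => y; ring.
  apply: integrable_add; last exact: (gauss_dom_int (n_dphiB i)).
  by apply: integrable_scale; exact: (gauss_dom_int (n_dphiU i)).
- apply: integrable_sub; first apply: integrable_add.
  + by apply: integrable_scale; exact: iD.
  + by apply: integrable_scale; exact: iE.
  + by apply: integrable_scale; exact: iE.
- move=> y _; have := drift_cauchy_schwarz i y; have py := p0 y.
  rewrite dispmixE phiE mul0r subr0.
  move: (dphi t y ord0 i) (B i y) (q y) (g y ord0 i) (E i y) (p y) py => x b Q G e' pp pp0 H.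
  have -> : x * ((2 * t)^-1 * (- (2 * t) * (pp * x + Q * G)) + b) =
    - (pp * x ^+ 2) + x * (b - Q * G) by field; rewrite gt_eqF.
  have h : x * (b - Q * G) <= 2^-1 * (pp * x ^+ 2) + 2^-1 * ((b - Q * G) ^+ 2 / pp).
    have := mulr_ge0 (ltW pp0) (sqr_ge0 (x - (b - Q * G) / pp)).
    have -> : pp * (x - (b - Q * G) / pp) ^+ 2 =
      pp * x ^+ 2 - 2 * (x * (b - Q * G)) + (b - Q * G) ^+ 2 / pp by field; rewrite gt_eqF.
    lra.
  have h2 : (b - Q * G) ^+ 2 / pp <= Q * e' / pp by rewrite ler_wpM2r// invr_ge0 ltW.
  have -> : Q / pp * e' = Q * e' / pp by rewrite mulrAC.
  lra.
Qed.

(** Integration by parts gives [N / (2 t) = int dphi U + Z]; Young's inequality and [U^2 <= q V]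
    bound the integral by [t D + N / (4 t)], whose second term absorbs into the left-hand side. *)
Lemma disp_moment_le i : Ni i <= 4 * t * Z + 4 * t ^+ 2 * Di i.
Proof.
have h : \int[lam]_y (dphi t y ord0 i * U i y) <= t * Di i + (4 * t)^-1 * Ni i.
  have e : t * Di i + (4 * t)^-1 * Ni i - 0 * Ni i = t * Di i + (4 * t)^-1 * Ni i.
    by rewrite mul0r subr0.
  rewrite -e -(Rintegral_lin3' t (4 * t)^-1 0 (iD i) (iN i) (iN i)).
  apply: le_Rintegral => //.
  - exact: (gauss_dom_int (n_dphiU i)).
  - apply: integrable_sub; first apply: integrable_add.
    + by apply: integrable_scale; exact: iD.
    + by apply: integrable_scale; exact: iN.
    + by apply: integrable_scale; exact: iN.
  - move=> y _; have := disp_cauchy_schwarz i y; have py := p0 y; rewrite phiE mul0r subr0.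
    move: (dphi t y ord0 i) (U i y) (q y) (V i y) (p y) py => x u Q v pp pp0 H.
    have : x * u <= t * (pp * x ^+ 2) + (4 * t)^-1 * (u ^+ 2 / pp).
      have := mulr_ge0 (ltW (mulr_gt0 t0 pp0)) (sqr_ge0 (x - u / (2 * t * pp))).
      have -> : t * pp * (x - u / (2 * t * pp)) ^+ 2 =
        t * (pp * x ^+ 2) - x * u + (4 * t)^-1 * (u ^+ 2 / pp).
        by field; rewrite !gt_eqF// ?mulr_gt0.
      lra.
    have : (4 * t)^-1 * (u ^+ 2 / pp) <= (4 * t)^-1 * (Q * v / pp).
      rewrite ler_wpM2l ?invr_ge0 ?mulr_ge0 ?(ltW t0)// ler_wpM2r// invr_ge0; exact: ltW.
    have -> : Q / pp * v = Q * v / pp by rewrite mulrAC.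
    lra.
have := ibp_disp_mix i; rewrite -/Z -/(Ni i) => e.
have : (2 * t)^-1 * Ni i <= t * Di i + (4 * t)^-1 * Ni i + Z by rewrite e lerD2r.
move=> H.
have : (4 * t) * ((2 * t)^-1 * Ni i) <= (4 * t) * (t * Di i + (4 * t)^-1 * Ni i + Z).
  by rewrite ler_wpM2l// mulr_ge0 ?(ltW t0).
have -> : 4 * t * ((2 * t)^-1 * Ni i) = 2 * Ni i by field; rewrite gt_eqF.
have -> : 4 * t * (t * Di i + (4 * t)^-1 * Ni i + Z) = 4 * t ^+ 2 * Di i + Ni i + 4 * t * Z.
  by field; rewrite gt_eqF.
lra.
Qed.

(** Since [U = - 2 t (p dphi + q g)], the vector [q g] is a combination of [U / (2 t)] and [p dphi].
    Use [(x + y)^2 <= 2 x^2 + 2 y^2] and [U^2 <= q V]. *)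
Lemma score_moment_le i : Wi i <= (2 * t ^+ 2)^-1 * Ni i + 2 * Di i.
Proof.
have e : (2 * t ^+ 2)^-1 * Ni i + 2 * Di i - 0 * Di i = (2 * t ^+ 2)^-1 * Ni i + 2 * Di i.
  by rewrite mul0r subr0.
rewrite -e -(Rintegral_lin3' (2 * t ^+ 2)^-1 2 0 (iN i) (iD i) (iD i)).
apply: le_Rintegral => //.
- apply: integrable_sub; first apply: integrable_add.
  + by apply: integrable_scale; exact: iN.
  + by apply: integrable_scale; exact: iD.
  + by apply: integrable_scale; exact: iD.
- move=> y _; have := disp_cauchy_schwarz i y; have py := p0 y.
  rewrite dispmixE phiE mul0r subr0.
  move: (dphi t y ord0 i) (q y) (g y ord0 i) (V i y) (p y) py => x Q G v pp pp0 H.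
  have H2 : (pp * x + Q * G) ^+ 2 / pp <= (4 * t ^+ 2)^-1 * (Q * v) / pp.
    rewrite ler_wpM2r ?invr_ge0 ?(ltW pp0)// ler_pdivlMl; last by rewrite mulr_gt0// exprn_gt0.
    apply: le_trans H; rewrite le_eqVlt; apply/orP; left; apply/eqP; ring.
  have -> : Q / pp * Q * G ^+ 2 = (Q * G) ^+ 2 / pp by rewrite exprMn; field; rewrite gt_eqF.
  have h3 : (Q * G) ^+ 2 / pp <= 2 * ((pp * x + Q * G) ^+ 2 / pp) + 2 * (pp * x ^+ 2).
    have := mulr_ge0 (ltW pp0) (sqr_ge0 ((2 * pp * x + Q * G) / pp)).
    have -> : pp * ((2 * pp * x + Q * G) / pp) ^+ 2 =
      2 * ((pp * x + Q * G) ^+ 2 / pp) + 2 * (pp * x ^+ 2) - (Q * G) ^+ 2 / pp.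
      by field; rewrite gt_eqF.
    lra.
  apply: (le_trans h3).
  have -> : (2 * t ^+ 2)^-1 * (Q / pp * v) = 2 * ((4 * t ^+ 2)^-1 * (Q * v) / pp).
    by field; rewrite !gt_eqF.
  by rewrite lerD2r ler_wpM2l.
Qed.

Variable eps : R.
Hypothesis err : forall w, enorm (g (X w) - S w) <= eps.
Hypothesis Lt : L * t <= 1 / 100.

(** With [n = |g y - S|], one has [|y - X| <= |disp| + t (|g y| + n)], so the Lipschitz bound
    contains [n] again, with factor [L t <= 1/100]. Absorbing it leaves [99/100 n] below a sum of
    three terms, and [3 / (99/100)^2 < 31/10]. *)
Lemma drift_error w y : sqn (S w - g y) <=
  31 / 10 * (eps ^+ 2 + (L * t) ^+ 2 * sqn (g y) + L ^+ 2 * sqn (disp t w y)).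
Proof.
rewrite -!enorm_sqr enormB; set n := enorm (g y - S w); set m := enorm (g y); set k := enorm (disp t w y).
have n0 : 0 <= n := enorm_ge0 _; have m0 : 0 <= m := enorm_ge0 _; have k0 : 0 <= k := enorm_ge0 _.
have L0 := L_gt0.
have s1 : enorm (S w) <= m + n.
  have := enormD (g y) (S w - g y); rewrite addrC subrK => H; apply: le_trans H _.
  by rewrite lerD2l enormB.
have s2 : enorm (y - X w) <= k + t * (m + n).
  have -> : y - X w = disp t w y + t *: S w by rewrite /disp subrK.
  apply: le_trans (enormD _ _) _; rewrite lerD2l enormZ gtr0_norm//.
  by rewrite ler_wpM2l// ltW.
have s3 : n <= L * (k + t * (m + n)) + eps.
  have := enormD (g y - g (X w)) (g (X w) - S w); rewrite addrA subrK => H; apply: le_trans H _.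
  rewrite lerD//; apply: le_trans (gL _ _) _; by rewrite ler_wpM2l// ltW.
have e0 : 0 <= eps by exact: le_trans (enorm_ge0 _) (err w).
have Lt0 : 0 <= L * t by rewrite mulr_ge0 ?ltW.
have s4 : 99 / 100 * n <= L * k + L * t * m + eps.
  have : L * t * n <= 1 / 100 * n by rewrite ler_wpM2r.
  lra.
have Lk0 : 0 <= L * k by rewrite mulr_ge0// ltW.
have Lm0 : 0 <= L * t * m by rewrite mulr_ge0.
rewrite -!exprMn.
move: (L * k) (L * t * m) Lk0 Lm0 s4 => A1 A2 h1 h2 s4.
have s5 : (99 / 100 * n) ^+ 2 <= (A1 + A2 + eps) ^+ 2 by rewrite lerXn2r ?nnegrE//; lra.
have := sqr_ge0 (A1 - A2); have := sqr_ge0 (A1 - eps); have := sqr_ge0 (A2 - eps).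
nra.
Qed.

Lemma energy_error_le : \sum_(i < d) Ei i <=
  31 / 10 * (eps ^+ 2 * Z + (L * t) ^+ 2 * (\sum_(i < d) Wi i) + L ^+ 2 * (\sum_(i < d) Ni i)).
Proof.
have isum1 := integrable_bigsum (index_enum 'I_d) iE.
have isum2 := integrable_bigsum (index_enum 'I_d) iW.
have isum3 := integrable_bigsum (index_enum 'I_d) iN.
rewrite -(Rintegral_sum _ iE) -(Rintegral_sum _ iW) -(Rintegral_sum _ iN).
set c := 31 / 10.
(* Only the shape [a f + b g - c h] of [Rintegral_lin3'] is sought here, whence the double
   negation. *)
have e : forall a1' a2' a3' : R, c * (eps ^+ 2 * a1' + (L * t) ^+ 2 * a2' + L ^+ 2 * a3') =
  (c * eps ^+ 2) * a1' + (c * (L * t) ^+ 2) * a2' - (- (c * L ^+ 2)) * a3' by move=> *; ring.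
rewrite e -(Rintegral_lin3' _ _ _ iZ isum2 isum3).
apply: le_Rintegral => //.
  apply: integrable_sub; first apply: integrable_add.
  + by apply: integrable_scale; exact: iZ.
  + by apply: integrable_scale; exact: isum2.
  + by apply: integrable_scale; exact: isum3.
move=> y _; rewrite -e -!mulr_sumr.
have -> : c * (eps ^+ 2 * (phi t y * q y) + (L * t) ^+ 2 * (phi t y * q y * \sum_(i < d) g y ord0 i ^+ 2) +
    L ^+ 2 * (phi t y * \sum_(i < d) V i y)) = phi t y *
    (c * ((eps ^+ 2 + (L * t) ^+ 2 * sqn (g y)) * q y + L ^+ 2 * \sum_(i < d) V i y)).
  have -> : \sum_(i < d) g y ord0 i ^+ 2 = sqn (g y) by apply: eq_bigr => i _; rewrite expr2.
  by ring.
rewrite ler_wpM2l ?(ltW (phi_gt0 y))//.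
have -> : \sum_(i < d) E i y = \int[P]_w Eker t w y.
  rewrite -(Rintegral_sum _ (fun i => ixE i y)); apply: eq_Rintegral => w _.
  by rewrite EkerE.
have iV := integrable_bigsum (index_enum 'I_d) (fun i => ixV i y).
rewrite -(Rintegral_sum _ (fun i => ixV i y)).
have e2 : forall a1' a2' : R, c * ((eps ^+ 2 + (L * t) ^+ 2 * sqn (g y)) * a1' + L ^+ 2 * a2') =
  (c * (eps ^+ 2 + (L * t) ^+ 2 * sqn (g y))) * a1' + (c * L ^+ 2) * a2' - 0 * a1'.
  by move=> *; ring.
rewrite e2 -(Rintegral_lin3' _ _ _ (ixk y) iV (ixk y)).
apply: le_Rintegral => //.
- have -> : (fun w => Eker t w y) = (fun w => \sum_(i < d) Eiker i t w y).
    by apply/funext => w; rewrite EkerE.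
  exact: (integrable_bigsum (index_enum 'I_d) (fun i => ixE i y)).
- apply: integrable_sub; first apply: integrable_add.
  + by apply: integrable_scale; exact: ixk.
  + by apply: integrable_scale; exact: iV.
  + by apply: integrable_scale; exact: ixk.
- move=> w _; rewrite -e2.
  have -> : \sum_(i < d) disp2ker i t w y = sqn (disp t w y) * ker t w y.
    by rewrite /sqn /dot mulr_suml; apply: eq_bigr => i _; rewrite /disp2ker expr2.
  have -> : c * ((eps ^+ 2 + (L * t) ^+ 2 * sqn (g y)) * ker t w y + L ^+ 2 * (sqn (disp t w y) * ker t w y))
     = c * (eps ^+ 2 + (L * t) ^+ 2 * sqn (g y) + L ^+ 2 * sqn (disp t w y)) * ker t w y by ring.
  by rewrite /Eker ler_wpM2r ?ker_ge0// drift_error.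
Qed.

Lemma dissipation_bound :
  2 * \int[lam]_y (phi t y * mix dker t y) <=
  - (99 / 100) * (\sum_(i < d) Di i) + (31 / 10 * eps ^+ 2 + 186 / 10 * d%:R * L ^+ 2 * t) * Z.
Proof.
rewrite dissipation_identity.
have h1 : \sum_(i < d) \int[lam]_y (dphi t y ord0 i * ((2 * t)^-1 * U i y + B i y)) <=
   - 2^-1 * (\sum_(i < d) Di i) + 2^-1 * (\sum_(i < d) Ei i).
  by rewrite !mulr_sumr -big_split /=; apply: ler_sum => i _; exact: dissipation_le.
have h2 := energy_error_le.
have h3 : \sum_(i < d) Ni i <= 4 * t * (d%:R * Z) + 4 * t ^+ 2 * (\sum_(i < d) Di i).
  have -> : d%:R * Z = \sum_(i < d) Z by rewrite sumr_const card_ord mulr_natl.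
  by rewrite !mulr_sumr -big_split /=; apply: ler_sum => i _; exact: disp_moment_le.
have h4 : \sum_(i < d) Wi i <= (2 * t ^+ 2)^-1 * (\sum_(i < d) Ni i) + 2 * (\sum_(i < d) Di i).
  by rewrite !mulr_sumr -big_split /=; apply: ler_sum => i _; exact: score_moment_le.
have D0 : 0 <= \sum_(i < d) Di i.
  by apply: sumr_ge0 => i _; apply: Rintegral_ge0 => y _; rewrite mulr_ge0 ?sqr_ge0 ?(ltW (p0 y)).
exact: (dissipation_arith L_gt0 t0 Lt h1 h2 h3 h4 D0).
Qed.

End fixed_time_integrals.

(** * Evolution of the energy: log-Sobolev inequality and Gronwall's argument *)

Lemma is_derive_energy t : times t ->
  is_derive t (1 : R) (fun s => \int[lam]_y (phi s y * mix ker s y))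
    (2 * \int[lam]_y (phi t y * mix dker t y)).
Proof.
move=> tt; have L0 := L_gt0.
have It : (`]tau, t1[%classic : set R) t by rewrite /= in_itv.
have Iu s : (`]tau, t1[%classic : set R) s -> times s by rewrite /= in_itv.
have dk s y : times s -> is_derive s (1 : R) (fun u => phi u y * mix ker u y)
    (2 * (phi s y * mix dker s y)).
  move=> ss; have D := is_derive_mix y ss.
  have := is_deriveZ (p y)^-1 (is_deriveM D D).
  set f1 := (X in is_derive _ _ X _); set df1 := (X in is_derive _ _ _ X).
  have -> : f1 = (fun u => phi u y * mix ker u y).
    by apply/funext => u; rewrite /f1 /phi mulrAC [RHS]mulrC.
  have -> // : df1 = 2 * (phi s y * mix dker s y).
  by rewrite /df1 /phi /GRing.scale /=; ring.
have g38 : unif_dom (- 38 * L) dker by exact: unif_dom_le unif_dom_dker K_neg.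
have /dom_ge0[M M0 HM] : dom times (- L) (fun s y => 2 * (phi s y * mix dker s y)).
  apply: domZ; apply: (domM (k1 := - 36 * L) _ (dom_mix_uniform g38)); last by lra.
  apply: (domM (k2 := 2 * L) (dom_mix_uniform unif_dom38_ker)); last by lra.
  by have [_ [M HM]] := gauss_dom_invp; exists M => s y _; exact: (HM Datatypes.tt).
pose f (s : R) (y : Rd R d) := phi s y * mix ker s y.
pose G (y : Rd R d) := M * expR (- L * sqn (y : 'rV[R]_d)).
have intf s : (`]tau, t1[%classic : set R) s -> lam.-integrable [set: Rd R d] (EFin \o f s).
  move=> /Iu ss; apply: (@gauss_dom_int (fun y => phi s y * mix ker s y)).
  apply: (gauss_dom_mul (gauss_dom_phi ss) (gauss_dom_mix unif_dom38_ker neg38 ss)); lra.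
have derf s (y : Rd R d) : (`]tau, t1[%classic : set R) s -> [set: Rd R d] y -> derivable (f ^~ y) s 1.
  by move=> /Iu ss _; have [] := dk s y ss.
have G0 y : 0 <= G y by rewrite mulr_ge0 ?expR_ge0.
have intG : lam.-integrable [set: Rd R d] (EFin \o G).
  rewrite /comp; under eq_fun do rewrite EFinM.
  by apply: integrableZl => //; apply: integrable_expR_sqn => //; lra.
have Gub s (y : Rd R d) : (`]tau, t1[%classic : set R) s -> [set: Rd R d] y ->
    `|partial1of2 f s y| <= G y.
  by move=> /Iu ss _; rewrite partial1of2E; have [_ ->] := dk s y ss; exact: HM.
apply: DeriveDef.
  exact: (derivable_under_integral measurableT It intf derf G0 intG Gub).
rewrite -derive1E (differentiation_under_integral measurableT It intf derf G0 intG Gub).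
have i : lam.-integrable [set: Rd R d] (EFin \o (fun y => phi t y * mix dker t y)).
  apply: (@gauss_dom_int (fun y => phi t y * mix dker t y)).
  apply: (gauss_dom_mul (gauss_dom_phi tt) (gauss_dom_mix g38 neg38 tt)); lra.
rewrite -(RintegralZl _ measurableT i).
by apply: eq_Rintegral => y _; rewrite partial1of2E; have [_ ->] := dk t y tt.
Qed.

Lemma integral_heat s m : 0 < s -> (\int[lam]_y (heat s ((y : 'rV[R]_d) - m)%R)%:E = 1)%E.
Proof.
move=> s0.
have mh : measurable_fun [set: Rd R d] (fun y : Rd R d => (heat s (y : 'rV[R]_d))%:E).
  apply/measurable_EFinP; rewrite /heat; apply: measurableT_comp => //.
  apply: measurable_funB => //; apply: measurable_funM => //; apply: measurableT_comp => //.
  exact: measurable_sqn.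
rewrite (integral_translation lamP (- m) mh).
under eq_integral do rewrite heatE EFinM.
rewrite ge0_integralZl//=; [|by apply/measurable_EFinP; exact: measurable_expR_sqn
  |by rewrite lee_fin expR_ge0].
have k0 : 0 < (4 * s)^-1 by rewrite invr_gt0 mulr_gt0.
rewrite (gaussian_integral lamP gaussP k0) heat_cstE// -EFinM /=.
have s4 : 0 < 4 * pi * s :> R by rewrite !mulr_gt0// pi_gt0.
have -> : Num.sqrt (2 * pi) / Num.sqrt (2 / (4 * s)) = Num.sqrt (4 * pi * s) :> R.
  rewrite -sqrtrV; last by rewrite divr_ge0 ?mulr_ge0 ?ltW.
  rewrite -sqrtrM; last by rewrite mulr_ge0 ?pi_ge0.
  by congr Num.sqrt; field; rewrite gt_eqF.
by rewrite mulVf// expf_neq0// gt_eqF// sqrtr_gt0.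
Qed.

Lemma integral_mix_ker t : times t -> \int[lam]_y mix ker t y = 1.
Proof.
move=> tt; rewrite (integral_mix unif_dom38_ker neg38 tt) -[RHS]a1.
apply: eq_Rintegral => w _.
have t0 := times_gt0 tt.
have -> : (fun y : Rd R d => ker t w y) = (fun y : Rd R d => a w * heat t ((y : 'rV[R]_d) - (X w + t *: S w))).
  by apply/funext => y; rewrite /ker /disp opprD addrA.
rewrite /Rintegral; under eq_integral do rewrite EFinM.
rewrite ge0_integralZl//=; [|idtac|by move=> y _; rewrite lee_fin heat_ge0|by rewrite lee_fin].
- by rewrite integral_heat// mule1.
- by apply/measurable_EFinP; exact: measurable_heat_shift.
Qed.

Hypothesis pint : lam.-integrable [set: Rd R d] (EFin \o p).
Hypothesis p1 : \int[lam]_y p y = 1.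

Lemma ln_le_sub1 (x : R) : 0 < x -> ln x <= x - 1.
Proof. by move=> x0; have := expR_ge1Dx (ln x); rewrite lnK ?posrE//; lra. Qed.

Lemma normr_ln_le (x : R) : 0 < x -> `|ln x| <= x + x^-1.
Proof.
move=> x0; have xi0 : 0 < x^-1 by rewrite invr_gt0.
have h1 := ln_le_sub1 x0; have := ln_le_sub1 xi0; rewrite lnV ?posrE// => h2.
by rewrite ler_norml; apply/andP; split; lra.
Qed.

(** Integrate [0 <= p (phi - 1)^2 = phi q - 2 q + p], where [p] and [q] have mass 1. *)
Lemma energy_ge1 t : times t -> 1 <= \int[lam]_y (phi t y * mix ker t y).
Proof.
move=> tt; have L0 := L_gt0.
have iq : lam.-integrable [set: Rd R d] (EFin \o mix ker t).
  by apply: (gauss_dom_integrable neg38); exact: gauss_dom_mix unif_dom38_ker neg38 tt.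
have iZ : lam.-integrable [set: Rd R d] (EFin \o (fun y => phi t y * mix ker t y)).
  apply: (@gauss_dom_int (fun y => phi t y * mix ker t y)).
  by apply: (gauss_dom_mul (gauss_dom_phi tt) (gauss_dom_mix unif_dom38_ker neg38 tt)); lra.
have e : 2 * \int[lam]_y mix ker t y + 0 * \int[lam]_y mix ker t y - 1 * \int[lam]_y p y = 1.
  by rewrite integral_mix_ker// p1; ring.
rewrite -[leLHS]e -(Rintegral_lin3' 2 0 1 iq iq pint).
apply: le_Rintegral => //.
  apply: integrable_sub; first apply: integrable_add.
  - by apply: integrable_scale.
  - by apply: integrable_scale.
  - by apply: integrable_scale.
move=> y _; rewrite /phi; have py := p0 y.
move: (mix ker t y) (p y) py => Q pp pp0.
have := mulr_ge0 (ltW pp0) (sqr_ge0 (Q / pp - 1)).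
have -> : pp * (Q / pp - 1) ^+ 2 = Q / pp * Q - 2 * Q + pp by field; rewrite gt_eqF.
lra.
Qed.

(* The log-Sobolev inequality is applied to the density [phi^2 p / Z]: its Fisher information
   is [4 D / Z], and [2 ln phi - ln Z >= 3 - 1 / Z - 2 Z / phi] bounds its KL from below. *)
Lemma lsi_energy t C : times t -> LSI lam C p ->
  \int[lam]_y (phi t y * mix ker t y) - 1 <=
  2 * C * \sum_(i < d) \int[lam]_y (p y * dphi t y ord0 i ^+ 2).
Proof.
move=> tt lsi; have L0 := L_gt0; have t0 := times_gt0 tt.
set Z := \int[lam]_y (phi t y * mix ker t y).
have Z1 : 1 <= Z by exact: energy_ge1.
have Z0 : 0 < Z by exact: lt_le_trans ltr01 Z1.
have nq := gauss_dom_mix unif_dom38_ker neg38 tt.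
have nphi := gauss_dom_phi tt.
have n1 : gauss_dom (- 74 * L) (fun y => phi t y * mix ker t y) by apply: (gauss_dom_mul nphi nq); lra.
have iq : lam.-integrable [set: Rd R d] (EFin \o mix ker t) by exact: (gauss_dom_integrable neg38 nq).
have iZ : lam.-integrable [set: Rd R d] (EFin \o (fun y => phi t y * mix ker t y)).
  by apply: (@gauss_dom_int (fun y => phi t y * mix ker t y)); apply: (gauss_dom_le n1); lra.
have iD i : lam.-integrable [set: Rd R d] (EFin \o (fun y => p y * dphi t y ord0 i ^+ 2)).
  exact: (gauss_dom_int (gauss_dom_pdphi tt i)).
have phi0 y : 0 < phi t y by exact: phi_gt0.
have q0 y : 0 < mix ker t y by exact: mix_ker_gt0.
pose psi (y : Rd R d) := phi t y * mix ker t y / Z.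
have psi0 y : 0 < psi y by rewrite /psi divr_gt0// mulr_gt0.
have psidens : is_density lam psi.
  split; [|by move=> y; exact: ltW|].
    by have [m1 _] := n1; apply: measurable_funM => //; exact: m1.
  have -> : (fun y => (psi y)%:E) = (fun y => (Z^-1 * (phi t y * mix ker t y))%:E).
    by apply/funext => y; rewrite /psi mulrC.
  have := integrable_fin_num measurableT (integrable_scale Z^-1 iZ) => /fineK <-.
  rewrite -[X in X%:E = _]/(\int[lam]_y (Z^-1 * (phi t y * mix ker t y))) RintegralZl//.
  by rewrite -/Z mulVf// gt_eqF.
have psip y : psi y / p y = phi t y ^+ 2 / Z.
  by rewrite /psi /phi; field; rewrite !gt_eqF.
have lnE y : ln (psi y / p y) = 2 * ln (mix ker t y) - 2 * ln (p y) - ln Z.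
  rewrite psip /phi lnM ?posrE ?invr_gt0 ?exprn_gt0 ?mulr_gt0 ?invr_gt0//.
  rewrite lnV ?posrE// lnXn ?mulr_gt0 ?invr_gt0// lnM ?posrE ?invr_gt0// lnV ?posrE//.
  by rewrite mulr2n; ring.
have lnE' y : ln (psi y / p y) = 2 * ln (phi t y) - ln Z.
  rewrite lnE /phi lnM ?posrE ?invr_gt0// lnV ?posrE//; ring.
have dln y : is_diff y (fun z : 'rV[R]_d => ln (psi z / p z))
    (dot (2 *: ((mix ker t y)^-1 *: gmix t y) - 2 *: g y)).
  have -> : (fun z : 'rV[R]_d => ln (psi z / p z)) =
    (fun z => 2 * ln (mix ker t z) - 2 * ln (p z) - ln Z) by apply/funext => z; exact: lnE.
  apply: is_diff_lincomb => //; apply: is_diff_ln => //; exact: is_diff_mix.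
have := lsi psi psidens psi0 (fun x => ex_diff (is_diff_def := dln x)).
have -> : fisher lam psi p = (4 / Z * \sum_(i < d) \int[lam]_y (p y * dphi t y ord0 i ^+ 2))%:E.
  rewrite /fisher -(Rintegral_sum _ iD).
  have iDs := integrable_bigsum (index_enum 'I_d) iD.
  rewrite -(RintegralZl _ measurableT iDs) /Rintegral fineK; last first.
    exact: (integrable_fin_num measurableT (integrable_scale _ iDs)).
  apply: eq_integral => y _; congr (_%:E).
  rewrite (gradE (dln y)) enorm_sqr.
  have -> : 2 *: ((mix ker t y)^-1 *: gmix t y) - 2 *: g y = (2 / phi t y) *: dphi t y.
    apply/rowP => i; rewrite !mxE /phi; field.
    by rewrite !gt_eqF.
  rewrite sqnZ -mulr_sumr -[in RHS]/(p y * _).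
  have -> : \sum_(i < d) dphi t y ord0 i ^+ 2 = sqn (dphi t y).
    by apply: eq_bigr => i _; rewrite expr2.
  by rewrite /psi /phi; field; rewrite !gt_eqF.
have m_kl : measurable_fun [set: Rd R d] (fun y : Rd R d => psi y * ln (psi y / p y)).
  have [mpsi _ _] := psidens.
  apply: measurable_funM => //; apply: (measurableT_comp (@measurable_ln R)).
  by apply: measurable_funM => //; have [mi _] := gauss_dom_invp; exact: mi.
have n_kl : gauss_dom (- L) (fun y => psi y * ln (psi y / p y)).
  split => //.
  (* From [|ln x| <= x + 1 / x]: the singular part [1 / phi] cancels against the factor [phi] of
     [psi], leaving a multiple of [q]. *)
  have d1' : dom1 (- L) (fun y => 2 / Z * (phi t y * mix ker t y * phi t y) + 2 / Z * mix ker t y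
      + `|ln Z| / Z * (phi t y * mix ker t y)).
    have h1 : gauss_dom (- L) (fun y => phi t y * mix ker t y * phi t y).
      by apply: (gauss_dom_mul n1 nphi); lra.
    have h2 : gauss_dom (- L) (mix ker t) by apply: (gauss_dom_le nq); lra.
    have h3 : gauss_dom (- L) (fun y => phi t y * mix ker t y) by apply: (gauss_dom_le n1); lra.
    by have [] := gauss_dom_add (gauss_dom_add (gauss_dom_scale (2 / Z) h1) (gauss_dom_scale (2 / Z) h2))
      (gauss_dom_scale (`|ln Z| / Z) h3).
  apply: (dom_ler d1') => _ y _; rewrite lnE' normrM (gtr0_norm (psi0 y)).
  apply: le_trans (ler_norm _).
  have h : `|2 * ln (phi t y) - ln Z| <= 2 * (phi t y + (phi t y)^-1) + `|ln Z|.
    apply: le_trans (ler_normB _ _) _; rewrite lerD2r normrM [`|2|]ger0_norm// ler_wpM2l//.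
    exact: normr_ln_le.
  apply: le_trans (ler_wpM2l (ltW (psi0 y)) h) _.
  rewrite /psi le_eqVlt; apply/orP; left; apply/eqP; field.
  by rewrite !gt_eqF.
have ikl := gauss_dom_int n_kl.
have -> : KL lam psi p = (\int[lam]_y (psi y * ln (psi y / p y)))%:E.
  by rewrite /KL /Rintegral fineK//; exact: (integrable_fin_num measurableT ikl).
rewrite -EFinM lee_fin => H.
have klge : 1 - Z^-1 <= \int[lam]_y (psi y * ln (psi y / p y)).
  have e : ((3 - Z^-1) / Z) * Z + 0 * Z - 2 * \int[lam]_y mix ker t y = 1 - Z^-1.
    by rewrite integral_mix_ker//; field; rewrite gt_eqF.
  rewrite -[leLHS]e -(Rintegral_lin3' ((3 - Z^-1) / Z) 0 2 iZ iZ iq).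
  apply: le_Rintegral => //.
    apply: integrable_sub; first apply: integrable_add.
    - by apply: integrable_scale.
    - by apply: integrable_scale.
    - by apply: integrable_scale.
  move=> y _; rewrite lnE' mul0r addr0.
  (* Write [2 ln phi - ln Z = - 2 ln (Z / phi) + ln Z] and use the tangent of [ln] at 1 for both
     logarithms. As [psi Z / phi = q] has mass 1, integration gives
     [(3 - 1 / Z) - 2 = 1 - 1 / Z]. *)
  have h1 : ln (Z / phi t y) <= Z / phi t y - 1 by apply: ln_le_sub1; rewrite divr_gt0.
  have h2 : ln (Z^-1) <= Z^-1 - 1 by apply: ln_le_sub1; rewrite invr_gt0.
  move: h1 h2; rewrite lnM ?posrE ?invr_gt0// !lnV ?posrE// => h1 h2.
  have h3 : 3 - Z^-1 - 2 * (Z / phi t y) <= 2 * ln (phi t y) - ln Z by lra.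
  apply: le_trans (ler_wpM2l (ltW (psi0 y)) h3).
  rewrite /psi le_eqVlt; apply/orP; left; apply/eqP; field.
  by rewrite !gt_eqF.
move: (le_trans klge H); set DD := (\sum_(i < d) _) => H2.
have : Z * (1 - Z^-1) <= Z * (C / 2 * (4 / Z * DD)) by rewrite ler_wpM2l// ltW.
have -> : Z * (1 - Z^-1) = Z - 1 by field; rewrite gt_eqF.
by have -> // : Z * (C / 2 * (4 / Z * DD)) = 2 * C * DD by field; rewrite gt_eqF.
Qed.

(** The error rate is taken at its largest value, at the end time [e], and its integrating factor is
    likewise frozen at [e]. Then [J] is nonincreasing, and the accumulated error is linear in
    [e - s]. *)
Lemma energy_decay C eps (s e : R) : times s -> times e -> s <= e ->
  1 <= C -> LSI lam C p -> (forall w, enorm (g (X w) - S w) <= eps) ->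
  C * eps ^+ 2 <= 1 / 48 -> L * e <= 1 / 100 -> C * (d%:R * L ^+ 2 * e) <= 1 / 4392 ->
  \int[lam]_y (phi e y * mix ker e y) - 1 <=
  expR (- ((e - s) / (4 * C))) * (\int[lam]_y (phi s y * mix ker s y) - 1) +
  (4 * eps ^+ 2 + 20 * d%:R * L ^+ 2 * e) * (e - s).
Proof.
move=> ts te se C1 lsi err epsC Le hC.
set b := 4 * eps ^+ 2 + 20 * d%:R * L ^+ 2 * e.
pose I (u : R) : R := \int[lam]_y (phi u y * mix ker u y).
have C0 : 0 < C by exact: lt_le_trans ltr01 C1.
have L0 := L_gt0.
have ti u : s <= u -> u <= e -> times u.
  move=> su ue; have /andP[h1 _] := ts; have /andP[_ h2] := te.
  by apply/andP; split; [exact: lt_le_trans su|exact: le_lt_trans ue _].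
have b0 : 0 <= b.
  have e0 := ltW (times_gt0 te).
  have := mulr_ge0 (mulr_ge0 (ler0n R d) (sqr_ge0 L)) e0; have := sqr_ge0 eps.
  have -> : b = 4 * eps ^+ 2 + 20 * (d%:R * L ^+ 2 * e) by rewrite /b; ring.
  lra.
have dI (u : R) : s <= u -> u <= e ->
    2 * \int[lam]_y (phi u y * mix dker u y) <= - (4 * C)^-1 * (I u - 1) + b.
  move=> su ue; have tu := ti u su ue; have u0 := times_gt0 tu.
  have Lu : L * u <= 1 / 100 by apply: le_trans Le; rewrite ler_wpM2l// ltW.
  have h1 := dissipation_bound tu err Lu.
  have h2 := lsi_energy tu lsi.
  have h3 := energy_ge1 tu.
  have h4 : d%:R * L ^+ 2 * u <= d%:R * L ^+ 2 * e.
    by rewrite ler_wpM2l// (mulr_ge0 (ler0n R d) (sqr_ge0 L)).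
  have x0 := mulr_ge0 (mulr_ge0 (ler0n R d) (sqr_ge0 L)) (ltW (times_gt0 te)).
  have -> : b = 4 * eps ^+ 2 + 20 * (d%:R * L ^+ 2 * e) by rewrite /b; ring.
  apply: (decay_arith C0 h3 h2 _ h4 x0 (sqr_ge0 eps) hC epsC).
  have -> // : 186 / 10 * (d%:R * L ^+ 2 * u) = 186 / 10 * d%:R * L ^+ 2 * u by ring.
pose c : R := (4 * C)^-1.
pose J (u : R) : R := expR (c * u) * (I u - 1) - b * expR (c * e) * u.
have DJ (u : R) : s <= u -> u <= e -> is_derive u (1 : R) J
   (expR (c * u) * (2 * \int[lam]_y (phi u y * mix dker u y)) + (I u - 1) * (c * expR (c * u))
     - b * expR (c * e)).
  move=> su ue; have tu := ti u su ue.
  have D1 : is_derive u (1 : R) I (2 * \int[lam]_y (phi u y * mix dker u y)).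
    exact: is_derive_energy.
  have D2 : is_derive u (1 : R) (expR \o (fun v : R => c * v)) (expR (c * u) * (c * 1)).
    exact: (@is_derive1_comp _ expR (fun v : R => c * v) u _ _ (is_derive_expR _)
      (is_deriveZ c (is_derive_id u 1))).
  have := is_deriveB (is_deriveM D2 (is_deriveB D1 (is_derive_cst (1 : R) u 1)))
     (is_deriveZ (b * expR (c * e)) (is_derive_id u 1)).
  set f1 := (X in is_derive _ _ X _); set df1 := (X in is_derive _ _ _ X).
  have -> : f1 = J by apply/funext => v; rewrite /f1 /J !fctE.
  move=> H; apply: (is_derive_eq H); rewrite /df1 !fctE /= /GRing.scale /=; ring.
have DJ0 (u : R) : s <= u -> u <= e -> derive1 J u <= 0.
  move=> su ue; rewrite derive1E; have [_ ->] := DJ u su ue.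
  have h := dI u su ue.
  have e1 : expR (c * u) <= expR (c * e) by rewrite ler_expR ler_wpM2l// invr_ge0 mulr_ge0// ltW.
  have e2 := expR_ge0 (c * u).
  have h1 := ler_wpM2l e2 h.
  have h2 := ler_wpM2l b0 e1.
  by rewrite -/c in h1; nra.
have : J e <= J s.
  apply: (@ler0_derive1_nincr _ J s e) => //.
  - by move=> u; rewrite in_itv /= => /andP[su ue]; have [] := DJ u (ltW su) (ltW ue).
  - by move=> u; rewrite in_itv /= => /andP[su ue]; exact: DJ0 (ltW su) (ltW ue).
  - apply: derivable_within_continuous => u; rewrite in_itv /= => /andP[su ue].
    by have [] := DJ u su ue.
rewrite [(e - s) / _]mulrC -/c; exact: exponential_transfer.
Qed.
End kernel_mixture.

(* Completing the square: [c n <= sqrt t c^2 + n^2 / (4 sqrt t)]. *)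
Lemma small_time_exponent (R : realType) (c L t n : R) : 0 < t -> 0 <= n ->
  - (4 * t)^-1 * n ^+ 2 + c * n + L * n ^+ 2 <=
  Num.sqrt t * c ^+ 2 - ((1 - Num.sqrt t - 4 * L * t) / (4 * t)) * n ^+ 2.
Proof.
move=> t0 n0; set r := Num.sqrt t.
have r0 : 0 < r by rewrite sqrtr_gt0.
have tE : t = r ^+ 2 by rewrite sqr_sqrtr ?ltW.
have -> : (1 - r - 4 * L * t) / (4 * t) * n ^+ 2 =
  (4 * t)^-1 * n ^+ 2 - n ^+ 2 / (4 * r) - L * n ^+ 2.
  by rewrite tE; field; rewrite gt_eqF.
have : 0 <= r * (c - n / (2 * r)) ^+ 2 by rewrite mulr_ge0 ?sqr_ge0 ?ltW.
have -> : r * (c - n / (2 * r)) ^+ 2 = r * c ^+ 2 - c * n + n ^+ 2 / (4 * r).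
  by field; rewrite gt_eqF.
lra.
Qed.

(** Flattening a Gaussian by the factor [1 - a] multiplies its mass by [(1 - a)^(-1/2)] per
    dimension. The bound follows from [1 <= (1 + 2 a) (1 - a)] and [1 - a <= sqrt (1 - a)]. *)
Lemma inv_sqrt_le_expR (R : realType) (a : R) : 0 <= a -> a <= 1 / 2 ->
  (Num.sqrt (1 - a))^-1 <= expR (2 * a).
Proof.
move=> a0 a1; have b0 : 0 < 1 - a by lra.
have s0 : 0 < Num.sqrt (1 - a) by rewrite sqrtr_gt0.
rewrite -[leLHS]mul1r ler_pdivrMr//.
have h1 := expR_ge1Dx (2 * a).
have h2 : 1 - a <= Num.sqrt (1 - a).
  rewrite -{1}(sqr_sqrtr (ltW b0)) expr2 ger_pMr// -[leRHS]sqrtr1 ler_sqrt//; lra.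
have h3 : 1 <= (1 + 2 * a) * (1 - a) by nra.
apply: (le_trans h3); apply: ler_pM; lra.
Qed.

Lemma measurable_fun_inv (R : realType) (d1 : measure_display) (T : measurableType d1) (p : T -> R) :
  (forall x, 0 < p x) -> measurable_fun setT p -> measurable_fun setT (fun x => (p x)^-1).
Proof.
move=> p0 mp; have -> : (fun x => (p x)^-1) = expR \o (fun x => - ln (p x)).
  by apply/funext => x; rewrite /= expRN lnK// posrE.
apply: measurableT_comp => //; apply: measurableT_comp => //.
exact: (measurableT_comp (@measurable_ln R) mp).
Qed.

(** * Energy of the truncated interpolation at small times *)

Section small_time.
Context {R : realType} {d : nat}.
Variable lam : {measure set (Rd R d) -> \bar R}.
Hypothesis lamP : is_lebesgue lam.
Hypothesis gaussP : (\int[lam]_x (gauss_density x)%:E = 1)%E.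
Variables (p : 'rV[R]_d -> R) (g sc : 'rV[R]_d -> 'rV[R]_d) (L : R).
Hypothesis p0 : forall y, 0 < p y.
Hypothesis mp : measurable_fun [set: Rd R d] p.
Hypothesis pdiff : forall x, is_diff x (fun y => ln (p y)) (dot (g x)).
Hypothesis gL : forall x y, enorm (g x - g y) <= L * enorm (x - y).
Hypothesis L1 : 1 <= L.
Hypothesis msc : forall i, measurable_fun [set: Rd R d] (fun x => sc x ord0 i).
Variables (B : set (Rd R d)) (gam sig : R).
Hypothesis mB : measurable B.
Hypothesis gB : forall x, B x -> enorm (g x) <= gam.
Hypothesis sB : forall x, B x -> enorm (sc x) <= sig.
Variable f : 'rV[R]_d -> R.
Hypothesis mf : measurable_fun [set: Rd R d] f.
Hypothesis f0 : forall x, 0 <= f x.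
Hypothesis If : lam.-integrable [set: Rd R d] (EFin \o (fun x => f x ^+ 2 / p x)).

Variable t : R.
Hypothesis t0 : 0 < t.
Hypothesis t1 : Num.sqrt t * (1 + 4 * L) <= 1 / 2.

Let c := gam + sig / 2.
Let slam : {sigma_finite_measure set (Rd R d) -> \bar R} :=
  HB.pack (lam : set (Rd R d) -> \bar R) (Measure.class lam)
   (isSigmaFinite.Build _ _ _ lam (lebesgue_sigma_finite lamP))
   (isSFinite.Build _ _ _ lam (sfinite_measure_sigma_finite (lebesgue_sigma_finite lamP))).

Definition transition (x y : 'rV[R]_d) : R := heat t (y - x - t *: sc x).

Lemma transition_ge0 x y : 0 <= transition x y. Proof. exact: heat_ge0. Qed.

Lemma transition_le_cst x y : transition x y <= heat_cst (d := d) t.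
Proof.
rewrite /transition heatE -[leRHS]mulr1 ler_wpM2l ?expR_ge0// expR_le1 mulNr oppr_le0.
by apply: mulr_ge0; [rewrite invr_ge0 mulr_ge0// ltW|exact: sqn_ge0].
Qed.

Lemma jm_transition : jointly_measurable (T := Rd R d) transition.
Proof.
have -> : transition = (fun x y => ker (T := Rd R d) (cst 1) id sc t x y).
  by apply/funext => x; apply/funext => y; rewrite /ker /disp /transition mul1r.
by apply: jm_ker => //; exact: measurable_coord.
Qed.

(** With [n = |x - y|], passing from [p x] to [p y] costs [exp (gam n + L n^2)] and the drift costs
    [exp (sig n / 2)]. Completing the square trades the linear terms for [exp (sqrt t c^2)] and a
    slightly flatter Gaussian. *)
Lemma transition_bound x y : B x ->
  p x * transition x y <= p y * (expR (Num.sqrt t * c ^+ 2) * (heat_cst (d := d) t *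
    expR (- ((1 - Num.sqrt t - 4 * L * t) / (4 * t)) * sqn (x - y)))).
Proof.
move=> Bx; set u := y - x; set n := enorm u.
have n0 : 0 <= n := enorm_ge0 _.
have L0 : 0 <= L by exact: le_trans L1.
have h1 : p x <= p y * expR (gam * n + L * n ^+ 2).
  have := lipschitz_grad_lower x y L0 pdiff gL; rewrite -/u -enorm_sqr -/n => H.
  have := cauchy_schwarz (g x) u; rewrite -/n => /ler_normlP[H1 _].
  have H2 : enorm (g x) * n <= gam * n by rewrite ler_wpM2r// gB.
  rewrite -[p x]lnK ?posrE// -[p y]lnK ?posrE// -expRD ler_expR; lra.
have h2 : transition x y <= heat t u * expR (sig / 2 * n).
  rewrite /transition -/u heat_expand ?gt_eqF// ler_wpM2l ?heat_ge0// ler_expR.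
  rewrite dotNr dotZr sqnN sqnZ.
  have := cauchy_schwarz u (sc x); rewrite -/n => /ler_normlP[_ H1].
  have H2 : n * enorm (sc x) <= n * sig by rewrite ler_wpM2l// sB.
  have -> : - (2 * - (t * dot u (sc x)) + t ^+ 2 * sqn (sc x)) / (4 * t) =
    dot u (sc x) / 2 - t * sqn (sc x) / 4 by field; rewrite gt_eqF.
  have := mulr_ge0 (ltW t0) (sqn_ge0 (sc x)); lra.
apply: (@le_trans _ _ ((p y * expR (gam * n + L * n ^+ 2)) * (heat t u * expR (sig / 2 * n)))).
  by rewrite ler_pM ?transition_ge0// ltW.
rewrite heatE -enorm_sqr -/n -(enorm_sqr (x - y)) enormB -/u -/n.
set k := (1 - _ - _) / _.
have -> : p y * expR (gam * n + L * n ^+ 2) * (heat_cst (d := d) t *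
    expR (- (4 * t)^-1 * n ^+ 2) * expR (sig / 2 * n)) =
  p y * heat_cst (d := d) t * (expR (gam * n + L * n ^+ 2) * expR (- (4 * t)^-1 * n ^+ 2)
    * expR (sig / 2 * n)) by ring.
have -> : p y * (expR (Num.sqrt t * c ^+ 2) * (heat_cst (d := d) t * expR (- k * n ^+ 2))) =
  p y * heat_cst (d := d) t * (expR (Num.sqrt t * c ^+ 2) * expR (- k * n ^+ 2)) by ring.
rewrite ler_wpM2l ?mulr_ge0 ?expR_ge0 ?(ltW (p0 y))// -!expRD ler_expR.
have := @small_time_exponent R c L t n t0 n0; rewrite -/k /c; lra.
Qed.

Let kap : R := c ^+ 2 + 2 * d%:R * (1 + 4 * L).

(** Starting from [p] restricted to [B], a short move produces a density at most slightly above [p].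
    The flattened Gaussian of [transition_bound] has mass [(1 - a)^(-d/2) <= exp (2 d a)] with
    [a <= sqrt t (1 + 4 L)], whence the second term of [kap]. *)
Lemma integral_transition_le y :
  (\int[lam]_x (\1_B x * (p x * transition x y))%:E <= (p y * expR (kap * Num.sqrt t))%:E)%E.
Proof.
have L0 : 0 <= L by exact: le_trans L1.
set r := Num.sqrt t; have r0 : 0 < r by rewrite sqrtr_gt0.
have tE : t = r ^+ 2 by rewrite sqr_sqrtr ?ltW.
have r1 : r <= 1 by have := t1; have := mulr_ge0 (ltW r0) L0; rewrite -/r; lra.
pose a := r + 4 * L * t.
have a0 : 0 <= a by rewrite addr_ge0 ?(ltW r0)// !mulr_ge0// ltW.
have a1 : a <= r * (1 + 4 * L).
  have r2 : 0 <= 1 - r by lra.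
  by rewrite /a tE; have := mulr_ge0 (mulr_ge0 L0 (ltW r0)) r2; lra.
have a2 : a <= 1 / 2 by exact: le_trans t1.
have k0 : 0 < (1 - r - 4 * L * t) / (4 * t).
  by rewrite divr_gt0 ?mulr_gt0//; move: a2; rewrite /a; lra.
set k := (1 - r - 4 * L * t) / (4 * t) in k0 *.
pose M := p y * (expR (r * c ^+ 2) * heat_cst (d := d) t).
have M0 : 0 <= M by rewrite !mulr_ge0 ?expR_ge0 ?(ltW (p0 y)).
apply: (@le_trans _ _ (\int[lam]_x (M%:E * (expR (- k * sqn ((x : 'rV[R]_d) - y)))%:E))%E).
  apply: ge0_le_integral => //.
  - by move=> x _; rewrite lee_fin !mulr_ge0 ?(ltW (p0 _)) ?transition_ge0.
  - apply/measurable_EFinP; apply: measurable_funM => //; apply: measurable_funM => //.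
    exact: (jointly_measurable2 y jm_transition).
  - apply/measurable_EFinP/measurable_funM => //; apply: measurableT_comp => //.
    apply: measurable_funM => //.
    exact: measurable_sqn_shift.
  - move=> x _; rewrite -EFinM lee_fin indicE.
    have [xB|xB] := boolP (x \in B); rewrite ?mul1r ?mul0r; last by rewrite mulr_ge0 ?expR_ge0.
    have := transition_bound y (set_mem xB); rewrite -/r -/k => H; apply: le_trans H _.
    by rewrite /M !mulrA.
have mk : measurable_fun [set: Rd R d] (fun x : Rd R d => (expR (- k * sqn (x : 'rV[R]_d)))%:E).
  by apply/measurable_EFinP; exact: measurable_expR_sqn.
rewrite ge0_integralZl//=.
- rewrite (integral_translation lamP (- y) mk) (gaussian_integral lamP gaussP k0) -EFinM lee_fin.
  have kE : Num.sqrt (2 * pi) / Num.sqrt (2 * k) = Num.sqrt (4 * pi * t) * (Num.sqrt (1 - a))^-1 :> R.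
    have b0 : 0 < 1 - a by lra.
    have p2 : 0 <= 2 * pi :> R by rewrite mulr_ge0 ?pi_ge0.
    have p4 : 0 <= 4 * pi * t :> R by rewrite mulr_ge0 ?(ltW t0)// mulr_ge0 ?pi_ge0.
    have e1 : (Num.sqrt (2 * k))^-1 = Num.sqrt ((2 * k)^-1) by rewrite sqrtrV// mulr_ge0// ltW.
    have e2 : (Num.sqrt (1 - a))^-1 = Num.sqrt ((1 - a)^-1) by rewrite sqrtrV// ltW.
    rewrite e1 e2 -(sqrtrM _ p2) -(sqrtrM _ p4).
    congr Num.sqrt; rewrite /k /a; field.
    by rewrite !gt_eqF//; move: b0; rewrite /a; lra.
  have s4 : 0 < Num.sqrt (4 * pi * t) :> R by rewrite sqrtr_gt0 !mulr_gt0// pi_gt0.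
  rewrite kE exprMn /M heat_cstE//.
  have -> : p y * (expR (r * c ^+ 2) * (Num.sqrt (4 * pi * t) ^+ d)^-1) *
     (Num.sqrt (4 * pi * t) ^+ d * (Num.sqrt (1 - a))^-1 ^+ d) =
     p y * (expR (r * c ^+ 2) * (Num.sqrt (1 - a))^-1 ^+ d).
    have : Num.sqrt (4 * pi * t) ^+ d != 0 :> R by rewrite expf_neq0// gt_eqF.
    by move: (Num.sqrt (4 * pi * t) ^+ d) ((Num.sqrt (1 - a))^-1 ^+ d) => x z x0; field.
  rewrite ler_wpM2l ?(ltW (p0 y))//.
  apply: (@le_trans _ _ (expR (r * c ^+ 2) * expR (2 * a) ^+ d)).
    rewrite ler_wpM2l ?expR_ge0// lerXn2r ?nnegrE ?expR_ge0 ?invr_ge0 ?sqrtr_ge0//.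
    exact: inv_sqrt_le_expR.
  rewrite -expRM_natl -expRD ler_expR.
  have -> : kap * r = r * c ^+ 2 + 2 * d%:R * (r * (1 + 4 * L)) by rewrite /kap; ring.
  rewrite lerD2l.
  have -> : d%:R * (2 * a) = 2 * d%:R * a by ring.
  by rewrite ler_wpM2l// mulr_ge0.
- apply/measurable_EFinP; apply: measurableT_comp => //; apply: measurable_funM => //.
  exact: measurable_sqn_shift.
Qed.

(** Density at time [t] of the interpolation when the starting density is [f] restricted to [B]. *)
Definition pushed y : R := \int[lam]_x (\1_B x * (f x * transition x y)).

Let mtr y : measurable_fun [set: Rd R d] (fun x => transition x y).
Proof. exact: (jointly_measurable2 y jm_transition). Qed.

Let mip : measurable_fun [set: Rd R d] (fun x => (p x)^-1).
Proof. exact: measurable_fun_inv. Qed.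

(** Cauchy-Schwarz for [f / p] with the weight [p x * transition x y] on [B], whose mass is
    controlled by [integral_transition_le]. *)
Lemma pushed_sqr_le y : (((pushed y) ^+ 2 / p y)%:E <=
  (expR (kap * Num.sqrt t))%:E * \int[lam]_x (\1_B x * (f x ^+ 2 / p x * transition x y))%:E)%E.
Proof.
pose K (x : Rd R d) : R := \1_B x * (p x * transition x y).
have K0 x : 0 <= K x by rewrite !mulr_ge0 ?(ltW (p0 _)) ?transition_ge0.
have mK : measurable_fun [set: Rd R d] K.
  by apply: measurable_funM => //; apply: measurable_funM => //; exact: mtr.
have iK : lam.-integrable [set: Rd R d] (EFin \o K).
  apply/integrableP; split; first exact/measurable_EFinP.
  apply: le_lt_trans (ltry (p y * expR (kap * Num.sqrt t))).
  apply: le_trans (integral_transition_le y).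
  by under eq_integral do rewrite /= ger0_norm//.
pose u (x : Rd R d) : R := f x / p x.
have i2 : lam.-integrable [set: Rd R d] (EFin \o (fun x => u x ^+ 2 * K x)).
  apply: (@le_integrable _ _ _ lam setT measurableT _
     (EFin \o (fun x : Rd R d => heat_cst (d := d) t * (f x ^+ 2 / p x)))).
  - apply/measurable_EFinP; apply: measurable_funM => //; apply: measurable_funX.
    by apply: measurable_funM => //; exact: mip.
  - move=> x _ /=; rewrite lee_fin !ger0_norm ?mulr_ge0 ?sqr_ge0 ?expR_ge0 ?invr_ge0 ?(ltW (p0 _))//.
    have -> : u x ^+ 2 * K x = \1_B x * (f x ^+ 2 / p x) * transition x y.
      by rewrite /u /K; field; rewrite gt_eqF.
    rewrite mulrC; apply: ler_pM; rewrite ?transition_ge0 ?mulr_ge0 ?sqr_ge0 ?invr_ge0 ?(ltW (p0 _))//.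
      exact: transition_le_cst.
    apply: ler_piMl; first by rewrite divr_ge0 ?sqr_ge0 ?(ltW (p0 _)).
    by rewrite indicE; case: (_ \in _).
  - exact: (integrable_scale _ If).
have i1 : lam.-integrable [set: Rd R d] (EFin \o (fun x => u x * K x)).
  apply: (@le_integrable _ _ _ lam setT measurableT _
     (EFin \o (fun x => K x + u x ^+ 2 * K x))).
  - apply/measurable_EFinP; apply: measurable_funM => //.
    by apply: measurable_funM => //; exact: mip.
  - move=> x _ /=; rewrite lee_fin.
    have u0 : 0 <= u x by rewrite divr_ge0 ?(ltW (p0 _)).
    have h2 := addr_ge0 (K0 x) (mulr_ge0 (sqr_ge0 (u x)) (K0 x)).
    rewrite (ger0_norm (mulr_ge0 u0 (K0 x))) (ger0_norm h2).
    rewrite -{2}[K x]mul1r -mulrDl ler_wpM2r//; have := sqr_ge0 (u x - 1); nra.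
  - exact: (integrable_add iK i2).
have H := weighted_cauchy_schwarz K0 iK i1 i2.
have e1 : pushed y = \int[lam]_x (u x * K x).
  by apply: eq_Rintegral => x _; rewrite /u /K; field; rewrite gt_eqF.
have e2 : (\int[lam]_x (\1_B x * (f x ^+ 2 / p x * transition x y))%:E =
    (\int[lam]_x (u x ^+ 2 * K x))%:E)%E.
  rewrite /Rintegral fineK; last exact: (integrable_fin_num measurableT i2).
  by apply: eq_integral => x _; congr (_%:E); rewrite /u /K; field; rewrite gt_eqF.
rewrite e2 -EFinM lee_fin ler_pdivrMr// e1; apply: (le_trans H).
have -> : expR (kap * Num.sqrt t) * \int[lam]_x (u x ^+ 2 * K x) * p y =
  (p y * expR (kap * Num.sqrt t)) * \int[lam]_x (u x ^+ 2 * K x).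
  by move: (Rintegral _ _ _) => z; ring.
apply: ler_wpM2r; first by apply: Rintegral_ge0 => x _; rewrite mulr_ge0 ?sqr_ge0.
have := integral_transition_le y.
by rewrite -(fineK (integrable_fin_num measurableT iK)) lee_fin.
Qed.

Lemma measurable_pushed : measurable_fun [set: Rd R d] pushed.
Proof.
have mind : measurable_fun [set: Rd R d] (fun x : Rd R d => \1_B x : R) by exact: measurable_indic.
have jB : jointly_measurable (T := Rd R d) (d := d) (fun x y => \1_B x : R).
  exact: (measurableT_comp mind (@measurable_fst _ _ (Rd R d) (Rd R d))).
have jf : jointly_measurable (T := Rd R d) (d := d) (fun x y => f x) by exact: (measurableT_comp mf measurable_fst).
have j1 := jm_mul jB (jm_mul jf jm_transition).
apply: (measurableT_comp (@fine_measurable _ setT measurableT)).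
apply: (@measurable_fun_fubini_tonelli_G _ _ _ _ R slam
  (fun z : Rd R d * Rd R d => (\1_B z.1 * (f z.1 * transition z.1 z.2))%:E)).
  exact/measurable_EFinP.
by move=> z; rewrite lee_fin !mulr_ge0 ?transition_ge0.
Qed.

(** Integrate the pointwise bound in [y] and exchange the integrals: for fixed [x] the transition
    density has mass 1 in [y]. *)
Lemma pushed_energy_le :
  (\int[lam]_y ((pushed y) ^+ 2 / p y)%:E <=
  (expR (kap * Num.sqrt t))%:E * \int[lam]_x (f x ^+ 2 / p x)%:E)%E.
Proof.
have mind : measurable_fun [set: Rd R d] (fun x : Rd R d => \1_B x : R) by exact: measurable_indic.
have jB : jointly_measurable (T := Rd R d) (d := d) (fun x y => \1_B x : R).
  exact: (measurableT_comp mind (@measurable_fst _ _ (Rd R d) (Rd R d))).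
have mg2 : measurable_fun [set: Rd R d] (fun x => f x ^+ 2 / p x).
  by apply: measurable_funM => //; exact: measurable_funX.
have jg2 : jointly_measurable (T := Rd R d) (d := d) (fun x y => f x ^+ 2 / p x) by exact: (measurableT_comp mg2 measurable_fst).
have j2 := jm_mul jB (jm_mul jg2 jm_transition).
have pos2 x y : 0 <= \1_B x * (f x ^+ 2 / p x * transition x y).
  by rewrite !mulr_ge0 ?sqr_ge0 ?invr_ge0 ?(ltW (p0 _)) ?transition_ge0.
have mpushed := measurable_pushed.
have mG : measurable_fun [set: Rd R d] (fun y : Rd R d =>
    \int[lam]_x (\1_B x * (f x ^+ 2 / p x * transition x y))%:E)%E.
  apply: (@measurable_fun_fubini_tonelli_G _ _ _ _ R slam
    (fun z : Rd R d * Rd R d => (\1_B z.1 * (f z.1 ^+ 2 / p z.1 * transition z.1 z.2))%:E)).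
    exact/measurable_EFinP.
  by move=> z; rewrite lee_fin.
apply: (@le_trans _ _ (\int[lam]_y ((expR (kap * Num.sqrt t))%:E *
    \int[lam]_x (\1_B x * (f x ^+ 2 / p x * transition x y))%:E))%E).
  apply: ge0_le_integral => //.
  - by move=> y _; rewrite lee_fin divr_ge0 ?sqr_ge0 ?(ltW (p0 _)).
  - by apply/measurable_EFinP; apply: measurable_funM => //; exact: measurable_funX.
  - exact: measurable_funeM.
  - by move=> y _; exact: pushed_sqr_le.
have e0 : (0 <= (expR (kap * Num.sqrt t))%:E)%E by rewrite lee_fin expR_ge0.
have G0 y : [set: Rd R d] y ->
    (0 <= \int[lam]_x (\1_B x * (f x ^+ 2 / p x * transition x y))%:E)%E.
  by move=> _; apply: integral_ge0 => x _; rewrite lee_fin.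
rewrite (ge0_integralZl lam measurableT mG G0 e0).
rewrite lee_wpmul2l ?lee_fin ?expR_ge0//.
have j2E : measurable_fun [set: Rd R d * Rd R d]
  (fun z : Rd R d * Rd R d => (\1_B z.1 * (f z.1 ^+ 2 / p z.1 * transition z.1 z.2))%:E).
  exact/measurable_EFinP.
have j2p (z : Rd R d * Rd R d) :
  (0 <= (\1_B z.1 * (f z.1 ^+ 2 / p z.1 * transition z.1 z.2))%:E)%E by rewrite lee_fin.
have -> : (\int[lam]_y \int[lam]_x (\1_B x * (f x ^+ 2 / p x * transition x y))%:E =
    \int[lam]_x \int[lam]_y (\1_B x * (f x ^+ 2 / p x * transition x y))%:E)%E.
  exact/esym/(@fubini_tonelli _ _ _ _ R slam slam _ j2E j2p).
apply: ge0_le_integral; first exact: measurableT.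
- by move=> x _; apply: integral_ge0 => y _; rewrite lee_fin.
- apply: (@measurable_fun_fubini_tonelli_F _ _ _ _ R slam
    (fun z : Rd R d * Rd R d => (\1_B z.1 * (f z.1 ^+ 2 / p z.1 * transition z.1 z.2))%:E)).
    exact/measurable_EFinP.
  by move=> z; rewrite lee_fin.
- exact/measurable_EFinP.
move=> x _.
have -> : (fun y : Rd R d => (\1_B x * (f x ^+ 2 / p x * transition x y))%:E) =
  (fun y : Rd R d => ((\1_B x * (f x ^+ 2 / p x))%:E * (heat t ((y : 'rV[R]_d) - (x + t *: sc x)))%:E)%E).
  by apply/funext => y; rewrite -EFinM mulrA /transition opprD addrA.
have mh : measurable_fun [set: Rd R d]
    (fun y : Rd R d => (heat t ((y : 'rV[R]_d) - (x + t *: sc x)))%:E).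
  by apply/measurable_EFinP; exact: measurable_heat_shift.
have h0 y : [set: Rd R d] y -> (0 <= (heat t ((y : 'rV[R]_d) - (x + t *: sc x)))%:E)%E.
  by move=> _; rewrite lee_fin heat_ge0.
have c0 : (0 <= (\1_B x * (f x ^+ 2 / p x))%:E)%E.
  by rewrite lee_fin mulr_ge0// divr_ge0 ?sqr_ge0 ?(ltW (p0 _)).
rewrite (ge0_integralZl lam measurableT mh h0 c0).
rewrite (integral_heat lamP gaussP _ t0) mule1 lee_fin.
apply: ler_piMl; first by rewrite divr_ge0 ?sqr_ge0 ?(ltW (p0 _)).
by rewrite indicE; case: (_ \in _).
Qed.

End small_time.

(** * Densities, monotone convergence and one-sided limits *)

Section density.
Context {R : realType} (d1 : measure_display) (T : measurableType d1).

Lemma ae_eq_density (lam : {measure set T -> \bar R}) (f g : T -> \bar R) :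
  measurable_fun setT f -> measurable_fun setT g -> (forall x, 0 <= f x)%E ->
  (\int[lam]_x f x < +oo)%E ->
  (forall A, measurable A -> \int[lam]_(x in A) f x = \int[lam]_(x in A) g x)%E ->
  ae_eq lam setT f g.
Proof.
move=> mf mg f0 fi fg; apply: integral_ae_eq => //; last by move=> E _; exact: fg.
by apply/integrableP; split => //; under eq_integral do rewrite gee0_abs//.
Qed.

Import Radon_Nikodym_SigmaFinite.

(** The given density agrees almost everywhere with the Radon-Nikodym derivative, for which the
    change of variables is known. *)
Lemma ge0_integral_density (lam : {sigma_finite_measure set T -> \bar R})
    (mu : {finite_measure set T -> \bar R}) (f : T -> R) (F : T -> \bar R) :
  measurable_fun setT f -> (forall x, 0 <= f x) ->
  (forall A, measurable A -> mu A = \int[lam]_(x in A) (f x)%:E)%E ->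
  measurable_fun setT F -> (forall x, 0 <= F x)%E ->
  (\int[mu]_x F x = \int[lam]_x (F x * (f x)%:E))%E.
Proof.
move=> mf f0 muf mF F0.
have mfE : measurable_fun setT (EFin \o f) by exact/measurable_EFinP.
have mulam : mu `<< lam.
  apply/null_content_dominatesP => A mA A0.
  by rewrite muf// null_set_integral//; exact: measurable_funTS.
rewrite -(change_of_variables mulam F0 measurableT mF).
have iRN := f_integrable mulam.
apply: ge0_ae_eq_integral => //.
- by apply: emeasurable_funM => //; exact: measurable_int iRN.
- exact: emeasurable_funM.
- by move=> x _; rewrite mule_ge0// f_ge0.
- by move=> x _; rewrite mule_ge0// lee_fin.
- have fi : (\int[lam]_x Radon_Nikodym_SigmaFinite.f mu lam x < +oo)%E.
    by rewrite -f_integral// -ge0_fin_numE// fin_num_measure.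
  have fE A : measurable A -> (\int[lam]_(x in A) Radon_Nikodym_SigmaFinite.f mu lam x =
     \int[lam]_(x in A) (EFin \o f) x)%E.
    by move=> mA; rewrite -f_integral// muf.
  have := ae_eq_density (measurable_int _ iRN) mfE (f_ge0 mulam) fi fE.
  by apply: filterS => x /= H Tx; rewrite -(H Tx).
Qed.

End density.

Lemma monotone_cvg (R : realType) (d1 : measure_display) (T : measurableType d1)
    (mu : {measure set T -> \bar R}) (u : nat -> T -> R) (v : T -> R) :
  (forall n, measurable_fun setT (u n)) -> (forall n x, 0 <= u n x) ->
  (forall x, nondecreasing_seq (u ^~ x)) -> (forall x, u n x @[n --> \oo] --> v x) ->
  (\int[mu]_x (u n x)%:E @[n --> \oo] --> \int[mu]_x (v x)%:E)%E.
Proof.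
move=> mu_ u0 ndu uv.
have -> : (\int[mu]_x (v x)%:E = \int[mu]_x limn (fun n => (u n x)%:E))%E.
  apply: eq_integral => x _; apply/esym/cvg_lim => //.
  by apply: cvg_EFin; [exact: nearW|exact: uv].
apply: cvg_monotone_convergence => //.
- by move=> n; exact/measurable_EFinP.
- by move=> n x _; rewrite lee_fin.
- by move=> x _ m n mn; rewrite lee_fin; exact: ndu.
Qed.

Lemma le_at_right_limit (R : realType) (F : R -> R) (a r0 : R) : 0 < r0 ->
  {for 0, continuous F} -> (forall r, 0 < r -> r < r0 -> a <= F r) -> a <= F 0.
Proof.
move=> r00 cF aF.
have cv : F x @[x --> 0^'+] --> F 0 by apply: cvg_at_right_filter.
apply: (cvgr_to_ge cv).
near=> r; apply: aF => //.
Unshelve. all: by end_near.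
Qed.

(** * One step of the algorithm: removal of the initial time and of the truncation *)

Section one_step.
Context {R : realType} {d : nat}.
Variable lam : {measure set (Rd R d) -> \bar R}.
Hypothesis lamP : is_lebesgue lam.
Hypothesis gaussP : (\int[lam]_x (gauss_density x)%:E = 1)%E.
Variables (p : 'rV[R]_d -> R) (g sc : 'rV[R]_d -> 'rV[R]_d) (L C eps h : R).
Hypothesis p0 : forall y, 0 < p y.
Hypothesis mp : measurable_fun [set: Rd R d] p.
Hypothesis pint : (\int[lam]_y (p y)%:E = 1)%E.
Hypothesis pdiff : forall x, is_diff x (fun y => ln (p y)) (dot (g x)).
Hypothesis mg : forall i, measurable_fun [set: Rd R d] (fun x => g x ord0 i).
Hypothesis gL : forall x y, enorm (g x - g y) <= L * enorm (x - y).
Hypothesis L1 : 1 <= L.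
Hypothesis msc : forall i, measurable_fun [set: Rd R d] (fun x => sc x ord0 i).
Hypothesis C1 : 1 <= C.
Hypothesis lsi : LSI lam C p.
Hypothesis err : forall x, enorm (g x - sc x) <= eps.
Hypothesis epsC : C * eps ^+ 2 <= 1 / 48.
Hypothesis h0 : 0 < h.
Hypothesis Lh : L * h <= 1 / 1000.
Hypothesis Ch : C * (d%:R * L ^+ 2 * h) <= 1 / 4392.
Variables (mu : probability (Rd R d) R) (f : 'rV[R]_d -> R).
Hypothesis muf : density_of lam mu f.
Hypothesis If : lam.-integrable [set: Rd R d] (EFin \o (fun x => f x ^+ 2 / p x)).

Let slam : {sigma_finite_measure set (Rd R d) -> \bar R} :=
  HB.pack (lam : set (Rd R d) -> \bar R) (Measure.class lam)
   (isSigmaFinite.Build _ _ _ lam (lebesgue_sigma_finite lamP))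
   (isSFinite.Build _ _ _ lam (sfinite_measure_sigma_finite (lebesgue_sigma_finite lamP))).

Let mf : measurable_fun [set: Rd R d] f. Proof. by case: muf. Qed.
Let f0 x : 0 <= f x. Proof. by case: muf. Qed.

Let density_integral (F : Rd R d -> \bar R) :
  measurable_fun setT F -> (forall x, 0 <= F x)%E ->
  (\int[mu]_x F x = \int[lam]_x (F x * (f x)%:E))%E.
Proof. by move=> mF F0; apply: (ge0_integral_density (lam := slam)) => //; case: muf. Qed.

Let pi : lam.-integrable [set: Rd R d] (EFin \o p).
Proof.
apply/integrableP; split; first exact/measurable_EFinP.
by under eq_integral do rewrite /= ger0_norm ?(ltW (p0 _))//; rewrite pint ltry.
Qed.

Let p1 : \int[lam]_y p y = 1. Proof. by rewrite /Rintegral pint. Qed.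

Let I0 : R := \int[lam]_x (f x ^+ 2 / p x).
Let b : R := 4 * eps ^+ 2 + 20 * d%:R * L ^+ 2 * h.
Let decay : R := expR (- (h / (4 * C))).

Lemma pushed_law (B : set (Rd R d)) t y : measurable B ->
  pushed lam sc B f t y = \int[mu]_x (\1_B x * transition sc t x y).
Proof.
move=> mB; rewrite /pushed /Rintegral; congr fine.
rewrite density_integral//.
- by apply: eq_integral => x _; rewrite -EFinM; congr (_%:E); ring.
- apply/measurable_EFinP; apply: measurable_funM; first exact: measurable_indic.
  exact: (jointly_measurable2 y (jm_transition msc t)).
- by move=> x; rewrite lee_fin mulr_ge0 ?transition_ge0.
Qed.

(** The kernel mixture is used with [mu] itself as probability space and weight [\1_B / c], where
    [c] is the mass of [B]. Energies then carry a factor [c^-2], removed at the end. The bound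
    depends neither on [B] nor on [rho], which permits the later limit. *)
Lemma truncated_step (B : set (Rd R d)) rho : measurable B ->
  (forall x, B x -> enorm x <= rho) -> 0 <= rho ->
  (\int[lam]_y ((pushed lam sc B f h y) ^+ 2 / p y)%:E <= (decay * I0 + (1 - decay + b * h))%:E)%E.
Proof.
move=> mB Brho rho0.
have L0 : 0 < L by exact: lt_le_trans ltr01 L1.
have C0 : 0 < C by exact: lt_le_trans ltr01 C1.
have I00 : 0 <= I0 by apply: Rintegral_ge0 => x _; rewrite divr_ge0 ?sqr_ge0 ?(ltW (p0 _)).
have b0 : 0 <= b.
  have e1 := sqr_ge0 eps; have e2 := mulr_ge0 (mulr_ge0 (ler0n R d) (sqr_ge0 L)) (ltW h0).
  by rewrite /b -!mulrA mulrA; lra.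
have d0 : 0 <= decay := expR_ge0 _.
have d1 : decay <= 1.
  by rewrite expR_le1 oppr_le0 divr_ge0 ?(ltW h0) ?mulr_ge0 ?(ltW C0).
have tot0 : 0 <= decay * I0 + (1 - decay + b * h).
  by have := mulr_ge0 d0 I00; have := mulr_ge0 b0 (ltW h0); lra.
have muB : mu B \is a fin_num by exact: fin_num_measure.
pose c := fine (mu B).
have cE : mu B = c%:E by rewrite /c fineK.
have c0 : 0 <= c by rewrite -lee_fin -cE measure_ge0.
have c1 : c <= 1 by rewrite -lee_fin -cE; exact: probability_le1.
have mind : measurable_fun [set: Rd R d] (fun x : Rd R d => \1_B x : R) by exact: measurable_indic.
have mtr t y : measurable_fun [set: Rd R d] (fun x => transition sc t x y).
  exact: (jointly_measurable2 y (jm_transition msc t)).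
have pushedE t y := pushed_law t y mB.
(* If [mu B = 0] the weight cannot be normalized, but then the pushed density vanishes
   identically. *)
have [c00|cn0] := eqVneq c 0.
  have pz y : pushed lam sc B f h y = 0.
    rewrite pushedE /Rintegral.
    have -> : (\int[mu]_x (\1_B x * transition sc h x y)%:E = \int[mu]_(x in B) (transition sc h x y)%:E)%E.
      rewrite [RHS]integral_mkcond epatch_indic; apply: eq_integral => x _ /=.
      by rewrite EFinM muleC.
    rewrite null_set_integral//; last by rewrite /= cE c00.
    by apply: measurable_funTS; exact/measurable_EFinP.
  under eq_integral do rewrite pz expr0n mul0r; rewrite integral0 lee_fin//.
have cp : 0 < c by rewrite lt_neqAle eq_sym cn0.
pose a (x : Rd R d) : R := \1_B x / c.
(* Points outside [B] are sent to the origin: the weight vanishes there, and both position and drift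
   stay bounded everywhere. *)
pose X (x : Rd R d) : 'rV[R]_d := (\1_B x : R) *: (x : 'rV[R]_d).
pose S (x : Rd R d) : 'rV[R]_d := sc (X x).
have ma : measurable_fun setT a by exact: measurable_funM.
have a0 x : 0 <= a x by rewrite divr_ge0.
have aA x : a x <= c^-1.
  by rewrite /a ler_piMl ?invr_ge0// indicE; case: (_ \in _).
have mX i : measurable_fun [set: Rd R d] (fun x => X x ord0 i).
  rewrite /X; under eq_fun do rewrite mxE; apply: measurable_funM => //; exact: measurable_coord.
have mXX : measurable_fun [set: Rd R d] (X : Rd R d -> Rd R d) by exact: measurable_Rd_coord.
have mS i : measurable_fun [set: Rd R d] (fun x => S x ord0 i).
  exact: (measurableT_comp (msc i) mXX).
have Xrho x : enorm (X x) <= rho.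
  rewrite /X indicE; have [xB|_] := boolP (x \in B).
    by rewrite scale1r Brho//; exact: set_mem.
  by rewrite scale0r -(scale0r (0 : 'rV[R]_d)) enormZ normr0 mul0r.
have gbd x : enorm x <= rho -> enorm (g x) <= enorm (g 0) + L * rho.
  move=> xr; rewrite -[g x](subrK (g 0)); apply: le_trans (enormD _ _) _.
  rewrite addrC lerD2l; apply: le_trans (gL x 0) _; rewrite subr0.
  by rewrite ler_wpM2l// ltW.
have sbd x : enorm x <= rho -> enorm (sc x) <= enorm (g 0) + L * rho + eps.
  move=> xr; rewrite -[sc x](subrK (g x)); apply: le_trans (enormD _ _) _.
  by rewrite addrC lerD// ?gbd// enormB.
set gam := enorm (g 0) + L * rho in gbd sbd.
set sig := gam + eps in sbd.
have Ssig x : enorm (S x) <= sig by exact/sbd/Xrho.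
have a1 : \int[mu]_w a w = 1.
  rewrite /Rintegral /a.
  have -> : (\int[mu]_x (\1_B x / c)%:E = \int[mu]_x ((c^-1)%:E * (\1_B x)%:E))%E.
    by apply: eq_integral => x _; rewrite -EFinM mulrC.
  rewrite ge0_integralZl//; last 2 first.
    - exact/measurable_EFinP.
    - by rewrite lee_fin invr_ge0.
  by rewrite integral_indic// setIT [X in (_ * X)%E]cE -EFinM/= mulVf.
have tr_le t x y : 0 < t -> transition sc t x y <= heat_cst (d := d) t.
  by move=> t0; exact: transition_le_cst.
have mixE t y : 0 < t -> mix mu (ker a X S) t y = c^-1 * pushed lam sc B f t y.
  move=> t0; rewrite pushedE /mix -RintegralZl//.
    apply: eq_Rintegral => x _; rewrite /ker /disp /a /S /X /transition.
    have [->|->] : (\1_B x = 1 :> R) \/ (\1_B x = 0 :> R).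
        by rewrite indicE; case: (x \in B); [left|right].
      by rewrite !scale1r !mul1r.
    by rewrite !mul0r mulr0.
  apply: (integrable_bounded mu (M := heat_cst (d := d) t)); first exact: measurable_funM.
  move=> x; rewrite ger0_norm ?mulr_ge0 ?transition_ge0//.
  rewrite indicE; case: (x \in B); rewrite ?mul1r ?mul0r ?expR_ge0//; exact: tr_le.
have energyE t : 0 < t -> \int[lam]_y (phi mu a X S p t y * mix mu (ker a X S) t y) =
    fine (\int[lam]_y ((c ^+ 2)^-1%:E * ((pushed lam sc B f t y) ^+ 2 / p y)%:E)%E)%E.
  move=> t0; rewrite /Rintegral; congr fine; apply: eq_integral => y _.
  by rewrite /phi !mixE// -EFinM; congr (_%:E); field; rewrite cn0 gt_eqF.
pose J t := (\int[lam]_y ((pushed lam sc B f t y) ^+ 2 / p y)%:E)%E.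
have mpush t : measurable_fun [set: Rd R d] (fun y => ((pushed lam sc B f t y) ^+ 2 / p y)%:E).
  apply/measurable_EFinP; apply: measurable_funM; last exact: measurable_fun_inv.
  apply: measurable_funX; exact: (measurable_pushed lamP msc mB mf f0).
have J0 t : (0 <= J t)%E.
  by apply: integral_ge0 => y _; rewrite lee_fin divr_ge0 ?sqr_ge0 ?(ltW (p0 _)).
have energyJ t : 0 < t -> \int[lam]_y (phi mu a X S p t y * mix mu (ker a X S) t y) =
    (c ^+ 2)^-1 * fine (J t).
  move=> t0; rewrite energyE// ge0_integralZl//.
  - rewrite -/(J t); case: (J t) (J0 t) => [r| |]//= _.
    by rewrite gt0_muley ?lte_fin ?invr_gt0 ?exprn_gt0//= mulr0.
  - by move=> y _; rewrite lee_fin divr_ge0 ?sqr_ge0 ?(ltW (p0 _)).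
  - by rewrite lee_fin invr_ge0 sqr_ge0.
(* The time window ends at [2 * h], so the requirement reads [640 L h <= 1]. *)
have t1L : 40 * L <= (8 * (2 * h))^-1.
  by rewrite -[leRHS]mul1r ler_pdivlMr; [have := Lh; lra|have := h0; lra].
have Lh' : L * h <= 1 / 100 by have := Lh; lra.
have step (s : R) : 0 < s -> s < h -> Num.sqrt s * (1 + 4 * L) <= 1 / 2 ->
   (J h < +oo)%E /\ (c ^+ 2)^-1 * fine (J h) - 1 <=
   expR (- ((h - s) / (4 * C))) * ((c ^+ 2)^-1 * (expR (((gam + sig / 2) ^+ 2 +
     2 * d%:R * (1 + 4 * L)) * Num.sqrt s) * I0) - 1) + b * (h - s).
  move=> s0 sh sL.
  (* The open window from [s / 2] to [2 * h] contains both [s] and [h]. *)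
  have tau0 : 0 < s / 2 by rewrite divr_gt0.
  have taut1 : s / 2 < 2 * h by lra.
  have ts : times (s / 2) (2 * h) s by apply/andP; split; lra.
  have th : times (s / 2) (2 * h) h by apply/andP; split; lra.
  have := energy_decay lamP gaussP ma a0 aA mX mS Xrho Ssig L1 tau0 taut1 a1 p0 mp pdiff mg gL t1L pi p1
    ts th (ltW sh) C1 lsi (fun w => err (X w)) epsC Lh' Ch.
  have := energy_ge1 lamP gaussP ma a0 aA mX mS Xrho Ssig L1 tau0 taut1 a1 p0 mp pdiff gL t1L pi p1 th.
  rewrite !energyJ//.
  move=> H1 H2; split.
    (* As [fine] sends [+oo] to 0, the lower bound 1 on the energy excludes an infinite [J h]. *)
    case: (J h) (J0 h) H1 => [r| |]//= _; first by rewrite ltry.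
    by rewrite mulr0 ler10.
  apply: (le_trans H2); rewrite lerD2r ler_wpM2l ?expR_ge0// lerD2r ler_wpM2l ?invr_ge0 ?sqr_ge0//.
  have := pushed_energy_le lamP gaussP p0 mp pdiff gL L1 msc mB
    (fun x Bx => gbd x (Brho x Bx)) (fun x Bx => sbd x (Brho x Bx)) mf f0 If s0 sL.
  have -> : (\int[lam]_x (f x ^+ 2 / p x)%:E = I0%:E)%E.
    by rewrite /I0 /Rintegral fineK//; exact: (integrable_fin_num measurableT If).
  rewrite -/(J s) -EFinM; case: (J s) (J0 s) => [r| |]//=.
set kap := (gam + sig / 2) ^+ 2 + 2 * d%:R * (1 + 4 * L) in step.
(* With [r = sqrt s] the bound is continuous at 0, and its value there no longer contains [kap]. *)
pose F (r : R) : R := expR (- ((h - r ^+ 2) / (4 * C))) *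
  ((c ^+ 2)^-1 * (expR (kap * r) * I0) - 1) + b * (h - r ^+ 2).
have L4 : 0 < 2 * (1 + 4 * L) by have := L1; lra.
pose r0 := Num.min (Num.sqrt h) (2 * (1 + 4 * L))^-1.
have r00 : 0 < r0 by rewrite /r0 lt_min sqrtr_gt0 h0 invr_gt0.
have stepF r : 0 < r -> r < r0 -> (J h < +oo)%E /\ (c ^+ 2)^-1 * fine (J h) - 1 <= F r.
  rewrite /r0 lt_min => rp /andP[rh rL].
  have := step (r ^+ 2); rewrite sqrtr_sqr (gtr0_norm rp); apply.
  - by rewrite exprn_gt0.
  - by rewrite -(sqr_sqrtr (ltW h0)) ltr_pXn2r ?nnegrE ?(ltW rp) ?sqrtr_ge0.
  - have := rL; rewrite -[X in _ < X]mul1r ltr_pdivlMr// => rL'; lra.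
have cF : {for 0, continuous F}.
  have cX : {for 0, continuous (fun r : R => r ^+ 2)} by exact: exprn_continuous.
  have cB : {for 0, continuous (fun r : R => h - r ^+ 2)} by apply: cvgB => //; exact: cvg_cst.
  apply: cvgD; last by apply: cvgM => //; exact: cvg_cst.
  apply: cvgM.
    apply: (continuous_comp (f := fun r : R => - ((h - r ^+ 2) / (4 * C)))); last exact: continuous_expR.
    by apply: cvgN; apply: cvgM => //; exact: cvg_cst.
  apply: cvgB; last exact: cvg_cst.
  apply: cvgM; first exact: cvg_cst.
  apply: cvgM; last exact: cvg_cst.
  apply: (continuous_comp (f := fun r : R => kap * r)); last exact: continuous_expR.
  by apply: cvgM => //; exact: cvg_cst.
have [Jfin _] := stepF (r0 / 2) ltac:(lra) ltac:(lra).
have := le_at_right_limit r00 cF (fun r rp rr => (stepF r rp rr).2).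
rewrite /F expr0n subr0 mulr0 expR0 mul1r -/decay.
have JE : J h = (fine (J h))%:E by rewrite fineK// ge0_fin_numE.
rewrite -/(J h) JE lee_fin; move: (fine (J h)) => j.
have c2 : 0 < c ^+ 2 by rewrite exprn_gt0.
have c21 : c ^+ 2 <= 1 by rewrite expr_le1.
move=> /(ler_wpM2l (ltW c2)).
have -> : c ^+ 2 * ((c ^+ 2)^-1 * j - 1) = j - c ^+ 2 by field.
have -> : c ^+ 2 * (decay * ((c ^+ 2)^-1 * I0 - 1) + b * h) =
  decay * I0 + c ^+ 2 * (b * h - decay) by field.
have bh := mulr_ge0 b0 (ltW h0).
(* The inequality reads [j <= decay I0 + c^2 (1 - decay + b h)]; replacing [c^2] by 1 only weakens
   it. *)
have : 0 <= (1 - c ^+ 2) * (1 - decay + b * h) by rewrite mulr_ge0 ?subr_ge0//; lra.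
by move: (c ^+ 2) (b * h) => u v; lra.
Qed.

Definition step_density y : R := \int[mu]_x transition sc h x y.

(** Monotone convergence along growing balls is used twice: under [mu], for the pointwise
    convergence of the truncated densities, and under [lam], for that of their energies. *)
Lemma step_energy_le :
  (\int[lam]_y ((step_density y) ^+ 2 / p y)%:E <= (decay * I0 + (1 - decay + b * h))%:E)%E.
Proof.
pose B n : set (Rd R d) := [set x : Rd R d | sqn (x : 'rV[R]_d) <= n%:R ^+ 2].
have mB n : measurable (B n).
  rewrite -[B n]setTI; by apply: measurable_fun_le => //; exact: measurable_sqn.
have Bn n x : B n x -> enorm x <= n%:R.
  by rewrite /B /= -enorm_sqr ler_pXn2r ?nnegrE ?enorm_ge0.
have mtr y : measurable_fun [set: Rd R d] (fun x => transition sc h x y).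
  exact: (jointly_measurable2 y (jm_transition msc h)).
have tr_le x y := transition_le_cst sc h0 x y.
have itr y : mu.-integrable setT (EFin \o (fun x => transition sc h x y)).
  apply: (integrable_bounded mu (M := heat_cst (d := d) h)) => // x.
  by rewrite ger0_norm ?transition_ge0.
have indB n x : (0 <= \1_(B n) x :> R) /\ (\1_(B n) x <= 1 :> R).
  by rewrite indicE; case: (_ \in _).
have ndB x m n : (m <= n)%N -> \1_(B m) x <= \1_(B n) x :> R.
  move=> mn; rewrite !indicE; case: (boolP (x \in B m)) => // /set_mem xm.
  rewrite mem_set// /B /=; apply: le_trans xm _.
  by rewrite lerXn2r ?nnegrE// ler_nat.
have mpart n y : measurable_fun [set: Rd R d] (fun x => \1_(B n) x * transition sc h x y).
  by apply: measurable_funM => //; exact: measurable_indic.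
have ipart n y : mu.-integrable setT (EFin \o (fun x => \1_(B n) x * transition sc h x y)).
  apply: (integrable_bounded mu (M := heat_cst (d := d) h)) => // x.
  have [i0 i1] := indB n x; rewrite ger0_norm ?mulr_ge0 ?transition_ge0//.
  by rewrite -[leRHS]mul1r ler_pM ?transition_ge0.
have cvB (x : Rd R d) : \1_(B n) x @[n --> \oo] --> (1 : R).
  apply: cvg_near_cst.
  exists (Num.truncn (enorm x)).+1 => // n /= xn; rewrite indicE mem_set// /B /= -enorm_sqr.
  rewrite lerXn2r ?nnegrE ?enorm_ge0//; apply: ltW; apply: lt_le_trans (truncnS_gt _) _.
  by rewrite ler_nat.
pose q n y := pushed lam sc (B n) f h y.
have q0 n y : 0 <= q n y.
  by apply: Rintegral_ge0 => x _; rewrite !mulr_ge0 ?transition_ge0.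
have mq n : measurable_fun [set: Rd R d] (q n).
  exact: (measurable_pushed lamP msc (mB n) mf f0).
have ndq y : nondecreasing_seq (q ^~ y).
  move=> m n mn; rewrite /q !pushed_law//; apply: le_Rintegral => // x _.
  by rewrite ler_wpM2r ?transition_ge0 ?ndB.
have cvq y : q n y @[n --> \oo] --> step_density y.
  have -> : q ^~ y = fun n => \int[mu]_x (\1_(B n) x * transition sc h x y).
    by apply/funext => n; exact: pushed_law.
  apply: fine_cvg; rewrite fineK; last exact: (integrable_fin_num measurableT (itr y)).
  apply: monotone_cvg => [n|n x|x|x].
  - exact: mpart.
  - by rewrite mulr_ge0 ?transition_ge0.
  - by move=> m n mn; rewrite ler_wpM2r ?transition_ge0 ?ndB.
  - by rewrite -[X in _ --> X]mul1r; apply: cvgM => //; exact: cvg_cst.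
have cvI : (\int[lam]_y (q n y ^+ 2 / p y)%:E @[n --> \oo] -->
    \int[lam]_y ((step_density y) ^+ 2 / p y)%:E)%E.
  apply: monotone_cvg => [n|n y|y|y].
  - apply: measurable_funM; last exact: measurable_fun_inv.
    exact: measurable_funX.
  - by rewrite divr_ge0 ?sqr_ge0 ?(ltW (p0 _)).
  - move=> m n mn; rewrite ler_wpM2r ?invr_ge0 ?(ltW (p0 _))// lerXn2r ?nnegrE//.
    exact: ndq.
  - apply: cvgM; last exact: cvg_cst.
    by rewrite expr2; under eq_fun do rewrite expr2; exact: cvgM.
apply: (cvge_to_le cvI); apply: nearW => n.
exact: (truncated_step (mB n) (@Bn n)).
Qed.

End one_step.

(** * Independence of a pair from an event *)

Section independence.
Context {R : realType}.

Lemma rectangle_measure_unique (d1 d2 : measure_display) (T1 : measurableType d1)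
    (T2 : measurableType d2) (m m' : {measure set (T1 * T2) -> \bar R}) :
  (m setT < +oo)%E ->
  (forall A B, measurable A -> measurable B -> m (A `*` B) = m' (A `*` B)) ->
  forall M, measurable M -> m M = m' M.
Proof.
move=> mT mm'.
pose C : set (set (T1 * T2)) :=
  [set C | exists A, measurable A /\ exists B, measurable B /\ C = A `*` B].
have CI : setI_closed C.
  move=> /= _ _ [X1 [mX1 [X2 [mX2 ->]]]] [Y1 [mY1 [Y2 [mY2 ->]]]].
  rewrite -setXI; exists (X1 `&` Y1); split; first exact: measurableI.
  by exists (X2 `&` Y2); split => //; exact: measurableI.
move=> M mM; apply: (measure_unique C (fun=> setT)) => //.
- rewrite measurable_prod_measurableType //; congr (<<s _ >>).
  rewrite predeqE; split => [[A mA [B mB <-]]|[A [mA [B [mB ->]]]]].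
    by exists A; split => //; exists B.
  by exists A => //; exists B.
- by move=> n; exists setT; split => //; exists setT; split => //; rewrite setXTT.
- by rewrite bigcup_const.
- by move=> A [A1 [mA1 [A2 [mA2 ->]]]]; exact: mm'.
Qed.

Context (d0 : measure_display) (T : measurableType d0) (P : probability T R).

(** Both sides are finite measures in [M], namely the law of the pair restricted to [E] and the full
    law scaled by [P E]; they agree on rectangles. *)
Lemma pair_independent_event (d1 d2 : measure_display) (T1 : measurableType d1)
    (T2 : measurableType d2) (X : T -> T1) (Y : T -> T2) (E : set T) :
  measurable_fun setT X -> measurable_fun setT Y -> measurable E ->
  (forall A B, measurable A -> measurable B ->
    P (X @^-1` A `&` Y @^-1` B `&` E) = (P (X @^-1` A `&` Y @^-1` B) * P E)%E) ->
  forall M, measurable M ->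
    P ((fun w => (X w, Y w)) @^-1` M `&` E) = (P ((fun w => (X w, Y w)) @^-1` M) * P E)%E.
Proof.
move=> mX mY mE XYE M mM.
have mXY : measurable_fun setT (fun w => (X w, Y w)) by exact: measurable_fun_pair.
have PE : P E \is a fin_num by exact: fin_num_measure.
pose r : {nonneg R} := NngNum (fine_ge0 (measure_ge0 P E)).
pose m1 : {measure set (T1 * T2) -> \bar R} := measure_function_pushforward__canonical__measure_function_Measure (mrestr P mE) mXY.
pose m2 : {measure set (T1 * T2) -> \bar R} := mscale r (measure_function_pushforward__canonical__measure_function_Measure P mXY).
have m1E A : m1 A = P ((fun w => (X w, Y w)) @^-1` A `&` E) by [].
have m2E A : m2 A = (P ((fun w => (X w, Y w)) @^-1` A) * P E)%E.
  by rewrite -[in RHS](fineK PE) muleC.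
rewrite -m1E -m2E; apply: rectangle_measure_unique mM => [|A B mA mB].
  by rewrite m1E preimage_setT setTI ltey_eq PE.
by rewrite m1E m2E; exact: XYE.
Qed.

End independence.

(** * Law of the iterates and independence of the next noise *)

Section langevin_law.
Context {R : realType} {d : nat}.
Variables (h : R) (s : Rd R d -> Rd R d).
Hypothesis ms : measurable_fun setT s.

Definition langevin_move (z : Rd R d * Rd R d) : Rd R d :=
  (z.1 : 'rV[R]_d) + h *: (s z.1 : 'rV[R]_d) + Num.sqrt (2 * h) *: (z.2 : 'rV[R]_d).

Lemma measurable_langevin_move : measurable_fun setT langevin_move.
Proof.
apply: measurable_Rd_coord => i; rewrite /langevin_move.
under eq_fun do rewrite !mxE.
have c1 := measurableT_comp (measurable_coord i) (@measurable_fst _ _ (Rd R d) (Rd R d)).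
have c2 := measurableT_comp (measurable_coord i) (@measurable_snd _ _ (Rd R d) (Rd R d)).
have c3 := measurableT_comp (measurable_coord i)
  (measurableT_comp ms (@measurable_fst _ _ (Rd R d) (Rd R d))).
exact: (measurable_funD (measurable_funD c1 (measurable_funM (measurable_cst h) c3))
  (measurable_funM (measurable_cst (Num.sqrt (2 * h))) c2)).
Qed.

Context (d0 : measure_display) (T : measurableType d0) (P : probability T R).
Variables (x0 : T -> Rd R d) (xi : nat -> T -> Rd R d).
Hypothesis mx0 : measurable_fun setT x0.
Hypothesis mxi : forall k, measurable_fun setT (xi k).

Local Notation x := (LMC h s x0 xi).

Lemma measurable_LMC k : measurable_fun setT (x k).
Proof.
elim: k => //= k IH.
have -> : (fun w => x k w + h *: (s (x k w) : 'rV[R]_d) + Num.sqrt (2 * h) *: (xi k w : 'rV[R]_d)) =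
  langevin_move \o (fun w => (x k w, xi k w)) by [].
apply: measurableT_comp; first exact: measurable_langevin_move.
exact: measurable_fun_pair.
Qed.

Hypothesis indep : mutually_independent P
  (fun i : option nat => match i with None => x0 | Some k => xi k end).

Let noise (J : seq nat) (A : nat -> set (Rd R d)) := \bigcap_(j in [set` J]) (xi j @^-1` A j).

Let measurable_preim (f : T -> Rd R d) A : measurable_fun setT f -> measurable A ->
  measurable (f @^-1` A).
Proof. by move=> mf mA; rewrite -[_ @^-1` _]setTI; exact: mf. Qed.

Let measurable_noise J A : (forall j, measurable (A j)) -> measurable (noise J A).
Proof.
move=> mA; apply: fin_bigcap_measurable; first exact: finite_seq.
by move=> j _; exact: measurable_preim.
Qed.

Let noise_cons k J A : noise (k :: J) A = xi k @^-1` A k `&` noise J A.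
Proof.
apply/seteqP; split => [w Hw|w [Hk HJ] j /=].
  split; first by apply: (Hw k); rewrite /= in_cons eqxx.
  by move=> j jJ; apply: (Hw j); rewrite /= in_cons jJ orbT.
by rewrite in_cons => /orP[/eqP ->//|]; exact: HJ.
Qed.

Let noise_prod J A : uniq J -> (forall j, measurable (A j)) ->
  P (noise J A) = (\prod_(j <- J) fine (P (xi j @^-1` A j)))%:E.
Proof.
move=> uJ mA.
have := @indep (map Some J) (fun i => if i is Some j then A j else setT).
rewrite map_inj_uniq; last by move=> ? ? [].
move=> /(_ uJ); rewrite big_map => <-; last by case.
congr (P _); apply/seteqP; split => [w Hw [j|]//=|w Hw j /= jJ].
- by move=> /mapP[i iJ [->]]; exact: Hw.
- by apply: (Hw (Some j)); rewrite /= map_f.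
Qed.

(** Induction on [k], as the iterate [k.+1] is a function of the iterate [k] and of [xi k]. The
    statement covers all finite families of future noises because each step adds the index [k] to
    the family. *)
Lemma LMC_indep_noise k J A B : uniq J -> (forall j, j \in J -> (k <= j)%N) ->
  (forall j, measurable (A j)) -> measurable B ->
  P (x k @^-1` B `&` noise J A) = (P (x k @^-1` B) * P (noise J A))%E.
Proof.
elim: k J A B => [|k IH] J A B uJ kJ mA mB.
  have := @indep (None :: map Some J) (fun i => if i is Some j then A j else B).
  rewrite /= map_inj_uniq; last by move=> ? ? [].
  have -> : None \notin [seq Some i | i <- J] by apply/mapP => -[].
  move=> /(_ uJ); rewrite big_cons big_map EFinM -noise_prod// fineK ?fin_num_measure//;
    last exact: measurable_preim.
  move=> <-; last by case.
  congr (P _); apply/seteqP; split => [w [xB Hw] [j|]//=|w Hw].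
  - rewrite in_cons /= => /mapP[i iJ [->]]; exact: Hw.
  - split; first by apply: (Hw None); rewrite /= in_cons.
    by move=> j jJ; apply: (Hw (Some j)); rewrite /= in_cons map_f.
have kNJ : k \notin J by apply/negP => /kJ; rewrite ltnn.
have -> : x k.+1 @^-1` B = (fun w => (x k w, xi k w)) @^-1` (langevin_move @^-1` B) by [].
apply: pair_independent_event => //; [exact: measurable_LMC|exact: measurable_noise| |]; last first.
  by rewrite -[_ @^-1` _]setTI; exact: measurable_langevin_move.
move=> A1 A2 mA1 mA2.
(* Placing the event of [xi k] in slot [k] makes it, together with the future noises, one noise
   event over [k :: J], to which the induction hypothesis applies. *)
pose A' j := if j == k then A2 else A j.
have mA' j : measurable (A' j) by rewrite /A'; case: ifP.
have A'J : noise J A' = noise J A.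
  apply: eq_bigcapr => j jJ; rewrite /A'; case: ifP => // /eqP jk.
  by move: jJ; rewrite jk /= (negbTE kNJ).
have A'k : A' k = A2 by rewrite /A' eqxx.
have ukJ : uniq (k :: J) by rewrite /= kNJ.
have E1 := noise_cons k J A'; rewrite A'J A'k in E1.
have E2 : noise [:: k] A' = xi k @^-1` A2.
  by rewrite noise_cons A'k (_ : noise [::] A' = setT) ?setIT//; apply/seteqP; split.
rewrite -setIA -E1 -{1}E2 !IH//; last 2 first.
- by move=> j; rewrite mem_seq1 => /eqP ->.
- by move=> j; rewrite in_cons => /orP[/eqP ->//|/kJ]; exact: ltnW.
rewrite -muleA; congr (_ * _)%E.
by rewrite -A'J !noise_prod// big_cons big_seq1 EFinM.
Qed.

Lemma LMC_joint_law k (A B : set (Rd R d)) : measurable A -> measurable B ->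
  P (x k @^-1` A `&` xi k @^-1` B) = (P (x k @^-1` A) * P (xi k @^-1` B))%E.
Proof.
move=> mA mB.
have := @LMC_indep_noise k [:: k] (fun=> B) A isT.
rewrite noise_cons (_ : noise [::] (fun=> B) = setT); last by apply/seteqP; split.
by rewrite setIT; apply => // j; rewrite mem_seq1 => /eqP ->.
Qed.

Variable lam : {measure set (Rd R d) -> \bar R}.
Hypothesis lamP : is_lebesgue lam.
Hypothesis gauss : forall k (A : set (Rd R d)), measurable A ->
  P (xi k @^-1` A) = (\int[lam]_(x in A) (gauss_density x)%:E)%E.
Hypothesis h0 : 0 < h.

Definition law k : probability (Rd R d) R :=
  distribution P (HB.pack (x k) (isMeasurableFun.Build _ _ _ _ _ (measurable_LMC k))).

Lemma integral_EFin_indic (A : set (Rd R d)) (F : Rd R d -> R) :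
  (\int[lam]_(z in A) (F z)%:E = \int[lam]_z (\1_A z * F z)%:E)%E.
Proof.
by rewrite integral_mkcond epatch_indic; apply: eq_integral => z _; rewrite /= EFinM muleC.
Qed.

(** Change of variables [y = sqrt (2 h) z + w]: the heat kernel at time [h] is the density of
    [sqrt (2 h)] times a standard Gaussian. *)
Lemma gauss_noise_law w (A : set (Rd R d)) : measurable A ->
  (\int[lam]_(z in (affine_map (Num.sqrt (2 * h)) w) @^-1` A) (gauss_density z)%:E =
   \int[lam]_(y in A) (heat h ((y : 'rV[R]_d) - w))%:E)%E.
Proof.
move=> mA; set c := Num.sqrt (2 * h).
have c0 : 0 < c by rewrite sqrtr_gt0 mulr_gt0.
have mh : measurable_fun [set: Rd R d] (fun y : Rd R d => (\1_A y * heat h ((y : 'rV[R]_d) - w))%:E).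
  apply/measurable_EFinP; apply: measurable_funM; first exact: measurable_indic.
  exact: measurable_heat_shift.
have h00 y : (0 <= (\1_A y * heat h ((y : 'rV[R]_d) - w))%:E)%E.
  by rewrite lee_fin mulr_ge0 ?heat_ge0.
have cd : c ^+ d != 0 by rewrite expf_neq0 ?gt_eqF.
have heatc (z : Rd R d) : heat h (affine_map c w z - w : 'rV[R]_d) = (c ^+ d)^-1 * gauss_density z.
  rewrite /affine_map addrK heatE sqnZ heat_cstE// /gauss_density enorm_sqr /c sqr_sqrtr ?mulr_ge0 ?(ltW h0)//.
  have -> : 4 * pi * h = (2 * h) * (2 * pi) by ring.
  rewrite sqrtrM ?mulr_ge0 ?(ltW h0)// exprMn invfM.
  have -> : - (4 * h)^-1 * (2 * h * sqn z) = - sqn z / 2 by field; rewrite gt_eqF.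
  by rewrite -/c; ring.
have := ge0_integral_affine lamP w c0 mh h00.
have mgd : measurable_fun [set: Rd R d] (fun z : Rd R d => (\1_(affine_map c w @^-1` A) z * gauss_density z)%:E).
  have -> : (fun z : Rd R d => (\1_(affine_map c w @^-1` A) z * gauss_density z)%:E) =
    (fun z => (c ^+ d)%:E * (\1_A (affine_map c w z) * heat h (affine_map c w z - w : 'rV[R]_d))%:E)%E.
    apply/funext => z; rewrite heatc -EFinM; congr (_%:E).
    have -> : \1_(affine_map c w @^-1` A) z = \1_A (affine_map c w z) :> R by [].
    by field.
  by apply: measurable_funeM; exact: (measurableT_comp mh (measurable_affine_map c w)).
have -> : (\int[lam]_y (\1_A (affine_map c w y) * heat h (affine_map c w y - w : 'rV[R]_d))%:E =
  (c ^+ d)^-1%:E * \int[lam]_z (\1_(affine_map c w @^-1` A) z * gauss_density z)%:E)%E.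
  rewrite -ge0_integralZl//.
  - apply: eq_integral => z _; rewrite heatc -EFinM; congr (_%:E).
    have -> : \1_(affine_map c w @^-1` A) z = \1_A (affine_map c w z) :> R by [].
    by ring.
  - by move=> z _; rewrite lee_fin mulr_ge0// divr_ge0 ?expR_ge0 ?exprn_ge0 ?sqrtr_ge0.
  - by rewrite lee_fin invr_ge0 exprn_ge0// ltW.
rewrite (integral_EFin_indic A) (integral_EFin_indic (affine_map c w @^-1` A)) => /(congr1 (fun e => (c ^+ d)%:E * e)%E).
by rewrite !muleA -!EFinM mulfV// !mul1e.
Qed.

Let slam : {sigma_finite_measure set (Rd R d) -> \bar R} :=
  HB.pack (lam : set (Rd R d) -> \bar R) (Measure.class lam)
   (isSigmaFinite.Build _ _ _ lam (lebesgue_sigma_finite lamP))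
   (isSFinite.Build _ _ _ lam (sfinite_measure_sigma_finite (lebesgue_sigma_finite lamP))).

(** By independence the joint law of iterate and noise is a product. Integrating first over the
    noise yields the heat kernel around the drifted point, and exchanging the integrals exhibits the
    density. *)
Lemma LMC_step_law k : density_of lam (law k.+1) (step_density s h (law k)).
Proof.
pose nu : probability (Rd R d) R :=
  distribution P (HB.pack (xi k) (isMeasurableFun.Build _ _ _ _ _ (mxi k))).
have mXY : measurable_fun setT (fun w => (x k w, xi k w)).
  by apply: measurable_fun_pair => //; exact: measurable_LMC.
pose m' : {measure set (Rd R d * Rd R d) -> \bar R} :=
  measure_function_pushforward__canonical__measure_function_Measure P mXY.
have prodE M : measurable M -> P ((fun w => (x k w, xi k w)) @^-1` M) = (law k \x nu)%E M.
  move=> mM; apply/esym.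
  apply: (product_measure_unique (m1 := law k) (m2 := nu) (m' := m')) mM => A B mA mB.
  exact: LMC_joint_law.
have msi i : measurable_fun [set: Rd R d] (fun y : Rd R d => (s y : 'rV[R]_d) ord0 i).
  exact: (measurableT_comp (measurable_coord i) ms).
have jt : measurable_fun [set: Rd R d * Rd R d]
    (fun z : Rd R d * Rd R d => transition s h z.1 z.2) := jm_transition msi h.
have t0 z y : 0 <= transition s h z y by exact: transition_ge0.
have it y : (law k).-integrable setT (EFin \o (fun z => transition s h z y)).
  apply: (integrable_bounded (law k) (M := heat_cst (d := d) h)).
    exact: (jointly_measurable2 y jt).
  move=> z; rewrite ger0_norm//.
  exact: transition_le_cst.
have sdE y : (\int[law k]_z (transition s h z y)%:E = (step_density s h (law k) y)%:E)%E.
  by rewrite /step_density /Rintegral fineK//; exact: (integrable_fin_num measurableT (it y)).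
split.
- apply: (measurableT_comp (@fine_measurable _ setT measurableT)).
  apply: (@measurable_fun_fubini_tonelli_G _ _ _ _ R (law k)
    (fun z : Rd R d * Rd R d => (transition s h z.1 z.2)%:E)).
    exact/measurable_EFinP.
  by move=> z; rewrite lee_fin.
- by move=> y; apply: Rintegral_ge0 => z _.
move=> A mA.
have mM : measurable (langevin_move @^-1` A).
  by rewrite -[_ @^-1` _]setTI; exact: measurable_langevin_move.
have -> : law k.+1 A = (law k \x nu)%E (langevin_move @^-1` A) by rewrite -prodE.
have jA : measurable_fun [set: Rd R d * Rd R d]
    (fun z : Rd R d * Rd R d => (\1_A z.2 * transition s h z.1 z.2)%:E).
  apply/measurable_EFinP; apply: measurable_funM => //.
  have mI : measurable_fun [set: Rd R d] (fun y : Rd R d => \1_A y : R) by exact: measurable_indic.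
  exact: (measurableT_comp mI (@measurable_snd _ _ (Rd R d) (Rd R d))).
have jA0 (z : Rd R d * Rd R d) : (0 <= (\1_A z.2 * transition s h z.1 z.2)%:E)%E.
  by rewrite lee_fin mulr_ge0.
transitivity (\int[law k]_z \int[lam]_y (\1_A y * transition s h z y)%:E)%E.
  apply: eq_integral => z _ /=.
  have -> : xsection (langevin_move @^-1` A) z =
      affine_map (Num.sqrt (2 * h)) ((z : 'rV[R]_d) + h *: (s z : 'rV[R]_d)) @^-1` A.
    by apply/seteqP; split => y; rewrite /xsection /= inE /= /langevin_move /affine_map /= addrC.
  have mpre : measurable (affine_map (Num.sqrt (2 * h)) ((z : 'rV[R]_d) + h *: (s z : 'rV[R]_d)) @^-1` A).
    by rewrite -[_ @^-1` _]setTI; exact: measurable_affine_map.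
  rewrite -[nu _]/(P (xi k @^-1` _)) gauss// gauss_noise_law// (integral_EFin_indic A).
  by apply: eq_integral => y _; rewrite /transition opprD addrA.
transitivity (\int[lam]_y \int[law k]_z (\1_A y * transition s h z y)%:E)%E.
  exact: (@fubini_tonelli _ _ _ _ R (law k) slam _ jA jA0).
rewrite (integral_EFin_indic A); apply: eq_integral => y _.
under eq_integral do rewrite EFinM.
rewrite ge0_integralZl//.
- by rewrite sdE -EFinM.
- apply/measurable_EFinP; exact: (jointly_measurable2 y jt).
- by move=> z _; rewrite lee_fin.
Qed.

End langevin_law.

(** * Chi-square divergence of a law *)

Section chi2_law.
Context {R : realType} {d : nat}.
Variable lam : {measure set (Rd R d) -> \bar R}.
Variable p : Rd R d -> R.
Hypothesis p0 : forall x, 0 < p x.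
Hypothesis mp : measurable_fun setT p.

(** The definition picks a density by choice; densities of one law agree almost everywhere, so any
    of them gives the same value. *)
Lemma chi2_lawE (mu : set (Rd R d) -> \bar R) f : (mu setT < +oo)%E -> density_of lam mu f ->
  chi2_law lam mu p = chi2 lam f p.
Proof.
move=> muT muf; rewrite /chi2_law; case: pselect => [H|[]]; last by exists f.
case: cid => /= f' [mf' f'0 muf']; case: muf => mf f0 muf.
rewrite /chi2; congr (_ - _)%E.
have m2 (g : Rd R d -> R) : measurable_fun setT g ->
    measurable_fun setT (fun x => (g x ^+ 2 / p x)%:E).
  move=> mg; apply/measurable_EFinP; apply: measurable_funM; last exact: measurable_fun_inv.
  exact: measurable_funX.
apply: ge0_ae_eq_integral => //; [exact: m2|exact: m2| | |].
- by move=> x _; rewrite lee_fin divr_ge0 ?sqr_ge0 ?(ltW (p0 _)).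
- by move=> x _; rewrite lee_fin divr_ge0 ?sqr_ge0 ?(ltW (p0 _)).
have : ae_eq lam setT (EFin \o f') (EFin \o f).
  apply: ae_eq_density; [exact/measurable_EFinP|exact/measurable_EFinP| | |].
  - by move=> x; rewrite lee_fin.
  - by rewrite -muf'.
  - by move=> A mA; rewrite -muf'// -muf.
by apply: filterS => x H' /H'[->].
Qed.

Lemma chi2_ge (f : Rd R d -> R) : (- 1%:E <= chi2 lam f p)%E.
Proof.
rewrite /chi2 -[X in (X <= _)%E]add0e leeD//.
by apply: integral_ge0 => x _; rewrite lee_fin divr_ge0 ?sqr_ge0 ?(ltW (p0 _)).
Qed.

(** Serves to exclude the value [-oo] in the recursion. *)
Lemma chi2_law_ge (mu : set (Rd R d) -> \bar R) : (- 1%:E <= chi2_law lam mu p)%E.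
Proof. by rewrite /chi2_law; case: pselect => [H|_]; [exact: chi2_ge|rewrite leey]. Qed.

End chi2_law.

(** * Iteration over the steps and conclusion *)

(** [K] is a supersolution of the recursion, hence absorbs all accumulated errors. An infinite
    initial value makes the bound trivial; a finite one reduces the induction to real arithmetic. *)
Lemma affine_recursion (R : realType) (q : nat -> \bar R) (r c K : R) :
  0 < r -> 0 <= K -> r * K + c <= K -> (- 1%:E <= q 0%N)%E ->
  (forall k, q k.+1 <= r%:E * q k + c%:E)%E ->
  forall n, (q n <= (r ^+ n)%:E * q 0%N + K%:E)%E.
Proof.
move=> r0 K0 rK q0 qS n.
case q0E : (q 0%N) q0 => [a| |]// _; last first.
  by rewrite gt0_muley ?lte_fin ?exprn_gt0// addye// leey.
elim: n => [|n IH]; first by rewrite q0E expr0 mul1e -EFinD lee_fin lerDl.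
apply: le_trans (qS n) _.
apply: (@le_trans _ _ (r%:E * ((r ^+ n)%:E * a%:E + K%:E) + c%:E)%E).
  by rewrite leeD2r// lee_wpmul2l// lee_fin ltW.
by rewrite -!EFinM -!EFinD lee_fin exprS mulrDr mulrA -addrA lerD2l.
Qed.

(** Uses [exp (- x) <= 1 / (1 + x)]; the inequality [1 <= (1 + x) (1 - 4/5 x)] holds exactly up to
    [x = 1/4]. *)
Lemma one_sub_expR_ge (R : realType) (x : R) : 0 <= x -> x <= 1 / 4 ->
  4 / 5 * x <= 1 - expR (- x).
Proof.
move=> x0 x1; have e1 := expR_ge1Dx x.
have e2 : expR (- x) <= (1 + x)^-1 by rewrite expRN lef_pV2 ?posrE ?expR_gt0//; lra.
have e3 : (1 + x)^-1 <= 1 - 4 / 5 * x.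
  rewrite -[leLHS]mul1r ler_pdivrMr; last lra.
  nra.
lra.
Qed.

Lemma step_size_bounds (R : realType) (d : nat) (L C h : R) : 1 <= L -> 1 <= C -> 0 < h ->
  h <= 1 / (4392 * d%:R * C * L ^+ 2) ->
  [/\ C * (d%:R * L ^+ 2 * h) <= 1 / 2000, C * (d%:R * L ^+ 2 * h) <= 1 / 4392,
      L * h <= 1 / 1000 & h <= 1].
Proof.
move=> L1 C1 h0 hle.
have C0 : 0 < C by exact: lt_le_trans ltr01 C1.
have L0 : 0 < L by exact: lt_le_trans ltr01 L1.
have d1 : 1 <= d%:R :> R.
  (* For [d = 0] the quotient is 0 by the convention on inverses, against [0 < h]. *)
  rewrite ler1n lt0n; apply/eqP => dz.
  by move: hle; rewrite dz mulr0 !mul0r invr0 mulr0 leNgt h0.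
have d0 : 0 < d%:R :> R by exact: lt_le_trans ltr01 d1.
have dCL : 0 < 4392 * d%:R * C * L ^+ 2.
  exact: (mulr_gt0 (mulr_gt0 (mulr_gt0 (ltr0Sn R 4391) d0) C0) (exprn_gt0 2 L0)).
pose e := d%:R * L ^+ 2 * h.
have e0 : 0 <= e := mulr_ge0 (mulr_ge0 (ler0n R d) (sqr_ge0 L)) (ltW h0).
have Ch : C * e <= 1 / 4392 by move: hle; rewrite (ler_pdivlMr _ _ dCL) /e; lra.
have Ce : C * e <= 1 / 2000 by apply: (le_trans Ch); clear; lra.
have eC : e <= 1 / 2000 by apply: le_trans Ce; rewrite ler_peMl.
rewrite -/e; clear hle dCL.
have h1 : L ^+ 2 * h <= e by rewrite /e -mulrA ler_peMl// mulr_ge0 ?sqr_ge0 ?(ltW h0).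
have h2 : L * h <= L ^+ 2 * h by rewrite ler_wpM2r ?(ltW h0)// expr2 ler_peMl// ltW.
have h3 : h <= L * h by rewrite ler_peMl// ltW.
by split => //; clear Ch; lra.
Qed.

Theorem theorem6 (R : realType) (d : nat)
    (lam : {measure set (Rd R d) -> \bar R})
    (p : Rd R d -> R) (L C eps1 h : R) (s : Rd R d -> Rd R d)
    (d0 : measure_display) (T : measurableType d0) (P : probability T R)
    (x0 : T -> Rd R d) (xi : nat -> T -> Rd R d) (N : nat) :
  is_lebesgue lam ->
  (* p is a probability density, ln p is C^1 *)
  is_density lam p -> (forall x, 0 < p x) ->
  (forall x : 'rV[R]_d, differentiable (fun y : 'rV[R]_d => ln (p y)) x) ->
  continuous (grad (fun y : 'rV[R]_d => ln (p y))) ->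
  (* grad ln p is L-Lipschitz, L >= 1 *)
  1 <= L ->
  (forall x y : 'rV[R]_d,
     enorm (grad (fun y : 'rV[R]_d => ln (p y)) x
            - grad (fun y : 'rV[R]_d => ln (p y)) y) <= L * enorm (x - y)) ->
  (* log-Sobolev inequality with constant C >= 1 *)
  1 <= C -> LSI lam C p ->
  (* score estimate *)
  measurable_fun setT s ->
  eps1 <= Num.sqrt (1 / (48 * C)) ->
  (forall x : 'rV[R]_d,
     enorm (grad (fun y : 'rV[R]_d => ln (p y)) x - (s x : 'rV[R]_d)) <= eps1) ->
  (* step size *)
  0 < h -> h <= 1 / (4392 * d%:R * C * L ^+ 2) ->
  (* x_0 ~ q_0, xi_k ~ N(0, I_d) i.i.d., independent of x_0 *)
  measurable_fun setT x0 -> (forall k, measurable_fun setT (xi k)) ->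
  (forall k (A : set (Rd R d)), measurable A ->
     P (xi k @^-1` A) = (\int[lam]_(x in A) (gauss_density x)%:E)%E) ->
  mutually_independent P
    (fun i : option nat => match i with None => x0 | Some k => xi k end) ->
  let q := fun k => chi2_law lam (fun A => P (LMC h s x0 xi k @^-1` A)) p in
  (forall k : nat,
     (q k.+1 <= (expR (- (h / (4 * C))))%:E * q k
                + (170 * d%:R * L ^+ 2 * h ^+ 2 + 5 * eps1 ^+ 2 * h)%:E)%E)
  /\
  (q N <= (expR (- (N%:R * h / (4 * C))))%:E * q 0%N
          + (680 * d%:R * L ^+ 2 * h * C + 20 * eps1 ^+ 2 * C)%:E
   <= (expR (- (N%:R * h / (4 * C))))%:E * q 0%N + 1)%E.
Proof.
move=> lamP [mp _ pint] p0 dp cg L1 gL C1 lsi ms epsle err h0 hle mx0 mxi gauss indep q.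
set g := grad (fun y : 'rV[R]_d => ln (p y)) in cg gL err.
(* The noise has total probability 1, which yields the Gaussian normalization. *)
have gaussP : (\int[lam]_x (gauss_density x)%:E = 1)%E.
  by rewrite -(gauss 0%N)// preimage_setT probability_setT.
have pdiff x : is_diff x (fun y => ln (p y)) (dot (g x)) by exact: is_diff_grad.
have mg i : measurable_fun [set: Rd R d] (fun x => g x ord0 i).
  apply: measurable_fun_continuous => x.
  exact: (@continuous_comp _ _ _ g (fun v : 'rV[R]_d => v ord0 i) x (cg x) (@coord_continuous R 1 d ord0 i _)).
have msc i : measurable_fun [set: Rd R d] (fun x : Rd R d => (s x : 'rV[R]_d) ord0 i).
  exact: (measurableT_comp (measurable_coord i) ms).
have C0 : 0 < C by exact: lt_le_trans ltr01 C1.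
have L0 : 0 < L by exact: lt_le_trans ltr01 L1.
have eps0 : 0 <= eps1 by exact: le_trans (enorm_ge0 _) (err 0).
have epsC : C * eps1 ^+ 2 <= 1 / 48.
  have : eps1 ^+ 2 <= 1 / (48 * C).
    have c48 : 0 <= 1 / (48 * C) by rewrite divr_ge0// mulr_ge0// ltW.
    by rewrite -(sqr_sqrtr c48) lerXn2r ?nnegrE ?sqrtr_ge0.
  by rewrite ler_pdivlMr ?mulr_gt0//; clear -C0; lra.
have [Ce1 Ch Lh hh] := step_size_bounds L1 C1 h0 hle.
have energy k f := @step_energy_le _ _ lam lamP gaussP p g s L C eps1 h p0 mp pint pdiff mg gL
  L1 msc C1 lsi err epsC h0 Lh Ch (law h ms P mx0 mxi k) f.
clear hle Ch epsle.
pose e := d%:R * L ^+ 2 * h; rewrite -/e in Ce1.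
have e0 : 0 <= e := mulr_ge0 (mulr_ge0 (ler0n R d) (sqr_ge0 L)) (ltW h0).
pose b := 4 * eps1 ^+ 2 + 20 * d%:R * L ^+ 2 * h.
pose r := expR (- (h / (4 * C))).
have bE : b = 4 * eps1 ^+ 2 + 20 * e by rewrite /b /e; ring.
have e2 := sqr_ge0 eps1.
have b0 : 0 <= b by rewrite bE; lra.
pose mu k := law h ms P mx0 mxi k.
have qE k f : density_of lam (mu k) f -> q k = chi2 lam f p.
  by move=> muf; apply: chi2_lawE => //; rewrite [ltLHS](probability_setT (mu k)) ltry.
have step k : (q k.+1 <= r%:E * q k + (b * h)%:E)%E.
  (* An infinite divergence makes the step trivial; a finite one forces a density to exist, as
     [chi2_law] is [+oo] without one. *)
  have [qy|qNy] := eqVneq (q k) +oo%E.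
    by rewrite qy gt0_muley ?lte_fin ?expR_gt0// addye// leey.
  have [[f muf]|nof] := pselect (exists f, density_of lam (mu k) f); last first.
    by move: qNy; rewrite /q /chi2_law; case: pselect.
  have [mf f0 _] := muf.
  pose I := (\int[lam]_x (f x ^+ 2 / p x)%:E)%E.
  have I0 : (0 <= I)%E.
    by apply: integral_ge0 => x _; rewrite lee_fin divr_ge0 ?sqr_ge0 ?(ltW (p0 _)).
  have qI : q k = (I - 1)%E by exact: qE.
  have Ify : (I < +oo)%E by move: qNy; rewrite qI; case: (I) I0 => [i| |]//; rewrite ltry.
  have If : lam.-integrable [set: Rd R d] (EFin \o (fun x => f x ^+ 2 / p x)).
    apply/integrableP; split.
      apply/measurable_EFinP; apply: measurable_funM; last exact: measurable_fun_inv.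
      exact: measurable_funX.
    by under eq_integral do rewrite /= ger0_norm ?divr_ge0 ?sqr_ge0 ?(ltW (p0 _))//.
  have := energy k f muf If.
  rewrite (qE _ _ (LMC_step_law ms mx0 mxi indep lamP gauss h0 k)) qI /chi2 -/r -/b => H.
  have IE : I = (\int[lam]_x (f x ^+ 2 / p x))%:E by rewrite /Rintegral fineK// ge0_fin_numE.
  rewrite IE -EFinB -EFinM -EFinD.
  apply: (le_trans (leeB H (lexx 1%:E))); rewrite -EFinB lee_fin.
  rewrite -/r -/b le_eqVlt; apply/orP; left; apply/eqP; ring.
have x0' : 0 <= h / (4 * C) by rewrite divr_ge0 ?mulr_ge0 ?(ltW h0) ?(ltW C0).
have x1 : h / (4 * C) <= 1 / 4.
  by rewrite ler_pdivrMr ?mulr_gt0//; lra.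
(* With [x = h / (4 * C)] one has [1 - r >= 4/5 x], and [4/5 * x * K = b * h]: this is where the
   factor 5 comes from. *)
pose K := 5 * C * b.
have K0 : 0 <= K := mulr_ge0 (mulr_ge0 (ler0n R 5) (ltW C0)) b0.
have rK : r * K + b * h <= K.
  have H := ler_wpM2r K0 (one_sub_expR_ge x0' x1); rewrite -/r in H.
  have E : 4 / 5 * (h / (4 * C)) * K = b * h by rewrite /K; field; rewrite gt_eqF.
  by rewrite E in H; lra.
have KE : K = 20 * eps1 ^+ 2 * C + 100 * (C * e) by rewrite /K bE; ring.
have Ce0 : 0 <= C * e by rewrite mulr_ge0 ?(ltW C0).
have tE : 680 * d%:R * L ^+ 2 * h * C + 20 * eps1 ^+ 2 * C = 680 * (C * e) + 20 * (C * eps1 ^+ 2).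
  by rewrite /e; ring.
split.
  move=> k; apply: le_trans (step k) _; rewrite leeD2l// lee_fin.
  have -> : 170 * d%:R * L ^+ 2 * h ^+ 2 + 5 * eps1 ^+ 2 * h = (170 * e + 5 * eps1 ^+ 2) * h.
    by rewrite /e; ring.
  by rewrite ler_wpM2r ?(ltW h0)// bE; lra.
have -> : expR (- (N%:R * h / (4 * C))) = r ^+ N.
  by rewrite /r -expRM_natl; congr expR; rewrite mulrN mulrA.
rewrite tE; apply/andP; split.
  apply: (le_trans (affine_recursion (expR_gt0 _) K0 rK (chi2_law_ge lam p0 _) step N)).
  by rewrite leeD2l// lee_fin KE; lra.
(* The sum is at most [680 / 2000 + 20 / 48 < 1]. *)
by rewrite leeD2l// lee_fin; lra.
Qed.
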